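(* Let $n\ge1$, let $D\subset\mathbb{R}^n$ be an open connected set, $\xi\in D$, and let $u,v$ be real-valued harmonic functions on $D$ such that $u$ is non-negative and $v$ is differentially subordinate to $u$. Then: (i) for $0<p<1$, $\|v\|_{p,\infty}\le 2\|u\|_p$, and this inequality is sharp (the constant $2$ cannot be replaced by a smaller one); (ii) for $p\ge2$, $\|v\|_{p,\infty}\le \frac p2(p-1)^{-1/p}\|u\|_p$.
   Context: $v$ is differentially subordinate to $u$ if $|v(\xi)|\le|u(\xi)|$ and $|\nabla v(x)|\le|\nabla u(x)|$ for all $x\in D$. For a bounded domain $D_0$ with $\xi\in D_0\subset \overline{D_0}\subset D$, let $\mu^\xi_{D_0}$ be the harmonic measure on $\partial D_0$ corresponding to $\xi$. Define $\|u\|_{p,\infty}=\sup_{\lambda>0}\sup_{D_0}[\lambda^p\mu^\xi_{D_0}(\{x\in\partial D_0:|u(x)|\ge\lambda\})]^{1/p}$ and $\|u\|_p=\sup_{D_0}[\int_{\partial D_0}|u(x)|^p\,d\mu^\xi_{D_0}(x)]^{1/p}$, the suprema over $D_0$ being over all such bounded subdomains. *)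

(* Defs.v *)
From HB Require Import structures.
From mathcomp Require Import all_boot all_order all_algebra.
From mathcomp Require Import all_classical all_reals all_analysis.
Set Implicit Arguments. Unset Strict Implicit. Unset Printing Implicit Defensive.
Import Order.TTheory GRing.Theory Num.Theory.
Import numFieldNormedType.Exports.
Local Open Scope classical_set_scope.
Local Open Scope ring_scope.

(* Euclidean space R^n is modelled by row vectors 'rV[R]_n, with the
   product (max-norm) topology of MathComp-Analysis (same topology as the
   Euclidean one). *)

Definition unitv (R : realType) (n : nat) (i : 'I_n) : 'rV[R]_n :=
  delta_mx 0 i.

Definition partial (R : realType) (n : nat) (i : 'I_n)
  (f : 'rV[R]_n -> R) : 'rV[R]_n -> R :=
  fun x => 'D_(unitv R i) f x.

Definition C2_on (R : realType) (n : nat) (U : set 'rV[R]_n)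
  (f : 'rV[R]_n -> R) : Prop :=
  [/\ forall x, U x -> differentiable f x,
      forall i x, U x -> differentiable (partial i f) x &
      forall i j x, U x -> {for x, continuous (partial j (partial i f))}].

Definition harmonic_on (R : realType) (n : nat) (U : set 'rV[R]_n)
  (f : 'rV[R]_n -> R) : Prop :=
  C2_on U f /\ forall x, U x -> \sum_(i < n) partial i (partial i f) x = 0.

Definition grad_norm (R : realType) (n : nat) (f : 'rV[R]_n -> R)
  (x : 'rV[R]_n) : R :=
  Num.sqrt (\sum_(i < n) (partial i f x) ^+ 2).

Definition domain (R : realType) (n : nat) (D : set 'rV[R]_n) : Prop :=
  open D /\ connected D.

Definition bdry (R : realType) (n : nat) (D0 : set 'rV[R]_n) : set 'rV[R]_n :=
  closure D0 `\` D0.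

Definition diff_subordinate (R : realType) (n : nat) (D : set 'rV[R]_n)
  (xi : 'rV[R]_n) (u v : 'rV[R]_n -> R) : Prop :=
  `|v xi| <= `|u xi| /\ forall x, D x -> grad_norm v x <= grad_norm u x.

(* Hyperharmonic functions on an open set W (Armitage-Gardiner):
   lower semicontinuous, > -oo, and satisfying the comparison principle with
   harmonic functions on relatively compact open subsets. *)
Definition hyperharmonic_on (R : realType) (n : nat) (W : set 'rV[R]_n)
  (s : 'rV[R]_n -> \bar R) : Prop :=
  [/\ forall x, W x -> s x != -oo%E,
      forall x, W x -> forall c : R, (c%:E < s x)%E ->
        \forall y \near x, (c%:E < s y)%E &
      forall V : set 'rV[R]_n, open V -> bounded_set V -> closure V `<=` W ->
        forall h : 'rV[R]_n -> R, {within closure V, continuous h} ->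
        harmonic_on V h ->
        (forall y, bdry V y -> ((h y)%:E <= s y)%E) ->
        forall y, V y -> ((h y)%:E <= s y)%E].

(* upper Perron-Wiener-Brelot class of the boundary function f on D0 *)
Definition upper_PWB_class (R : realType) (n : nat) (D0 : set 'rV[R]_n)
  (f : 'rV[R]_n -> R) : set ('rV[R]_n -> \bar R) :=
  [set s | [/\ hyperharmonic_on D0 s,
     (exists M : R, forall x, D0 x -> (M%:E <= s x)%E) &
     forall y, bdry D0 y -> forall c : R, c < f y ->
       \forall x \near y, D0 x -> (c%:E < s x)%E]].

Definition upper_PWB (R : realType) (n : nat) (D0 : set 'rV[R]_n)
  (f : 'rV[R]_n -> R) (x : 'rV[R]_n) : \bar R :=
  ereal_inf [set s x | s in upper_PWB_class D0 f].

Definition borelRn (R : realType) (n : nat) :=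
  g_sigma_algebraType (@open 'rV[R]_n).

(* mu is the harmonic measure of D0 (on its boundary) relative to xi:
   the Borel measure representing f |-> H_f(xi) on continuous boundary data *)
Definition harmonic_measure (R : realType) (n : nat) (D0 : set 'rV[R]_n)
  (xi : 'rV[R]_n) (mu : {measure set (borelRn R n) -> \bar R}) : Prop :=
  forall f : 'rV[R]_n -> R, {within bdry D0, continuous f} ->
    (\int[mu]_(x in (bdry D0 : set (borelRn R n))) (f x)%:E)%E
      = upper_PWB D0 f xi.

Definition admissible (R : realType) (n : nat) (D : set 'rV[R]_n)
  (xi : 'rV[R]_n) (D0 : set 'rV[R]_n) : Prop :=
  [/\ domain D0, bounded_set D0, D0 xi & closure D0 `<=` D].

Definition hnorm (R : realType) (n : nat) (D : set 'rV[R]_n)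
  (xi : 'rV[R]_n) (p : R) (u : 'rV[R]_n -> R) : \bar R :=
  ereal_sup [set z | exists (D0 : set 'rV[R]_n)
                            (mu : {measure set (borelRn R n) -> \bar R}),
     [/\ admissible D xi D0, harmonic_measure D0 xi mu &
         z = ((\int[mu]_(x in (bdry D0 : set (borelRn R n)))
                 (`|u x| `^ p)%:E) `^ p^-1)%E]].

Definition hweak_norm (R : realType) (n : nat) (D : set 'rV[R]_n)
  (xi : 'rV[R]_n) (p : R) (u : 'rV[R]_n -> R) : \bar R :=
  ereal_sup [set z | exists (lam : R) (D0 : set 'rV[R]_n)
                            (mu : {measure set (borelRn R n) -> \bar R}),
     [/\ 0 < lam, admissible D xi D0, harmonic_measure D0 xi mu &
         z = (((lam `^ p)%:E
                * mu ([set x | bdry D0 x /\ (lam <= `|u x|)%R]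
                        : set (borelRn R n))) `^ p^-1)%E]].

(* Main.v *)
(** If [s] is continuous and can be touched from above at every point by functions
    of arbitrarily small Laplacian, then comparison in the Perron class gives
    [\int s dmu <= s xi] for every harmonic measure [mu] based at [xi]. Both upper
    bounds apply this to [s = U(u, |v|)] for a Burkholder function [U], which
    differential subordination makes touchable, with [U <= 0] or [U <= 2 u] where
    [|v| <= u] and [U] dominating the indicator of [|v| >= 1] up to a multiple of
    [u `^ p].

    For [p < 1] the resulting bound contains [u xi] instead of [||u||_p]; they are
    compared by means of the harmonic measures of small balls. Harmonic measures of
    ellipsoids exist because the Dirichlet problem with polynomial data has a
    polynomial solution there, so that density of polynomials and the Riesz
    representation theorem produce the measure.

    For the sharpness take [u = 1 + x_0] and [v = 1 - x_0] on the half-space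
    [x_0 > -1], with [xi = 0]: by concavity [||u||_p <= 1], while the exit point
    from a large ellipsoid close to the half-space is, with probability close to
    [1], near the hyperplane [x_0 = -1], where [v] is close to [2]. *)

Require Import Defs.
From HB Require Import structures.
From mathcomp Require Import all_boot all_order all_algebra.
From mathcomp Require Import all_classical all_reals all_analysis.
From mathcomp Require Import measurable_realfun ring lra.
Set Implicit Arguments. Unset Strict Implicit. Unset Printing Implicit Defensive.
Import Order.TTheory GRing.Theory Num.Theory.
Import numFieldNormedType.Exports.
Local Open Scope classical_set_scope.
Local Open Scope ring_scope.

(** * Second-order jets *)

(** The obstacle is regularity: [weak1_fun] has a corner along u + |v| = 1 and [special] switches
    between formulas, so no Laplacian of U(u, |v|) exists everywhere. Touching from above avoids
    smoothing: at each point one smooth branch, plus a quadratic penalty of small weight, lies above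
    the function, and the Laplacian of that branch is a nonnegative multiple of |grad v|^2 - |grad
    u|^2. The subdomains are arbitrary, so their harmonic measures are accessible only through the
    Perron formula; the upper bounds ask of them nothing beyond the inequality for touched
    functions. Existence of a harmonic measure matters only where a norm is bounded from below, and
    there the subdomain can be chosen to be an ellipsoid. For p < 1 the exponent enters
    elementarily: mu <= min(1, t) with t = 2 u(xi) / lam, and min(1, t) <= t^p. For p >= 2 the
    constant is the p-th root of K = (p/2)^p / (p - 1), the smallest factor for which the curve K
    r^(p-1) stays above the line prescribed by the layers. *)

(** Asks for first and second derivatives along the coordinate axes only, the second ones at the
    single point [x]: this is what the second-derivative test at a minimum consumes, and it is
    closed under sums and products. *)
Definition jet2 {R : realType} {n : nat} (f : 'rV[R]_n -> R) (x : 'rV[R]_n)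
    (a : 'I_n -> R) (l : R) : Prop :=
  exists2 b : 'I_n -> R,
    (forall i, [/\ \forall y \near x, derivable f y (unitv R i),
                   is_derive x (unitv R i) f (a i) &
                   is_derive x (unitv R i) (partial i f) (b i)])
    & l = \sum_i b i.

Section jets.
Context {R : realType} {n : nat}.
Implicit Types (f g : 'rV[R]_n -> R) (x : 'rV[R]_n).

Lemma jet2_cst (k : R) x : jet2 (fun=> k) x (fun=> 0) 0.
Proof.
exists (fun=> 0); last by rewrite big1.
move=> i; split.
- by near=> y; exact: derivable_cst.
- exact: is_derive_cst.
- rewrite (_ : partial i _ = cst 0); first exact: is_derive_cst.
  by apply/funext => y; rewrite /partial (derive_cst k).
Unshelve. all: by end_near. Qed.

Lemma is_derive_coord (k i : 'I_n) x :
  is_derive x (unitv R i) (fun y : 'rV[R]_n => y 0 k) (i == k)%:R.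
Proof.
apply: DeriveDef; first exact/diff_derivable/differentiable_coord.
rewrite /derive; apply: cvg_lim => //.
apply: (@cvg_trans _ (cst (i == k)%:R @ (0 : R)^')); last exact: cvg_cst.
apply: near_eq_cvg; near=> h.
rewrite /= !mxE eqxx addrK /= eq_sym /GRing.scale/= mulKf//.
by near: h; exact: nbhs_dnbhs_neq.
Unshelve. all: by end_near. Qed.

Lemma jet2_coord (k : 'I_n) x :
  jet2 (fun y : 'rV[R]_n => y 0 k) x (fun i => (i == k)%:R) 0.
Proof.
exists (fun=> 0); last by rewrite big1.
move=> i; split.
- by near=> y; have [] := is_derive_coord k i y.
- exact: is_derive_coord.
- rewrite (_ : partial i _ = cst (i == k)%:R); first exact: is_derive_cst.
  by apply/funext => y; have [_] := is_derive_coord k i y.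
Unshelve. all: by end_near. Qed.

Lemma jet2D f g x a b l m : jet2 f x a l -> jet2 g x b m ->
  jet2 (fun y => f y + g y) x (fun i => a i + b i) (l + m).
Proof.
move=> [a2 fa ->] [b2 gb ->]; exists (fun i => a2 i + b2 i); last first.
  by rewrite big_split.
move=> i; have [df dfx df2] := fa i; have [dg dgx dg2] := gb i; split.
- by apply: filterS2 df dg => y; exact: derivableD.
- exact: is_deriveD.
- apply: near_eq_is_derive (is_deriveD df2 dg2).
  by apply: filterS2 df dg => y fy gy; rewrite /partial deriveD.
Qed.

Lemma jet2M f g x a b l m : jet2 f x a l -> jet2 g x b m ->
  jet2 (fun y => f y * g y) x (fun i => f x * b i + g x * a i)
    (f x * m + 2 * (\sum_i a i * b i) + g x * l).
Proof.
move=> [a2 fa ->] [b2 gb ->].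
exists (fun i => f x * b2 i + 2 * (a i * b i) + g x * a2 i); last first.
  by rewrite !big_split/= !mulr_sumr.
move=> i; have [df dfx df2] := fa i; have [dg dgx dg2] := gb i; split.
- by apply: filterS2 df dg => y; exact: derivableM.
- exact: is_deriveM.
- have := is_deriveD (is_deriveM dfx dg2) (is_deriveM dgx df2).
  rewrite [X in is_derive _ _ _ X](_ : _ = f x * b2 i + 2 * (a i * b i) + g x * a2 i); last first.
    have [_ <-] := dfx; have [_ <-] := dgx; rewrite /partial /GRing.scale/=; ring.
  apply: near_eq_is_derive.
  by apply: filterS2 df dg => y fy gy; exact/esym/(deriveM fy gy).
Qed.

Lemma jet2_eq f x a l a' l' :
  jet2 f x a l -> a =1 a' -> l = l' -> jet2 f x a' l'.
Proof. by move=> [b H ->] /funext <- <-; exists b. Qed.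

Lemma jet2Z (k : R) f x a l :
  jet2 f x a l -> jet2 (fun y => k * f y) x (fun i => k * a i) (k * l).
Proof.
move=> H; apply: jet2_eq (jet2M (jet2_cst k x) H) _ _ => [i|].
  by rewrite mulr0 addr0.
by rewrite big1 ?mulr0 ?addr0// => i _; rewrite mul0r.
Qed.

Lemma jet2_sqr f x a l : jet2 f x a l ->
  jet2 (fun y => f y ^+ 2) x (fun i => 2 * f x * a i)
    (2 * f x * l + 2 * \sum_i a i ^+ 2).
Proof.
move=> H; rewrite (_ : (fun y => _) = fun y => f y * f y)//.
apply: jet2_eq (jet2M H H) _ _ => [i|]; first ring.
under [X in _ + _ * X + _ = _]eq_bigr do rewrite -expr2.
ring.
Qed.

Lemma jet2_sum (I : Type) (r : seq I) (f : I -> 'rV[R]_n -> R) x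
    (a : I -> 'I_n -> R) (l : I -> R) :
  (forall j, jet2 (f j) x (a j) (l j)) ->
  jet2 (fun y => \sum_(j <- r) f j y) x (fun i => \sum_(j <- r) a j i)
    (\sum_(j <- r) l j).
Proof.
move=> H; elim: r => [|j r IH].
  rewrite big_nil (_ : (fun y => _) = fun=> 0); last first.
    by apply/funext => y; rewrite big_nil.
  by apply: jet2_eq (jet2_cst 0 x) _ _ => // i; rewrite big_nil.
rewrite big_cons (_ : (fun y => _) = fun y => f j y + \sum_(k <- r) f k y).
  by apply: jet2_eq (jet2D (H j) IH) _ _ => // i; rewrite big_cons.
by apply/funext => y; rewrite big_cons.
Qed.

Lemma jet2_C2 (U : set 'rV[R]_n) f x : open U -> C2_on U f -> U x ->
  jet2 f x (fun i => partial i f x) (\sum_i partial i (partial i f) x).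
Proof.
move=> oU [d1 d2 _] Ux; exists (fun i => partial i (partial i f) x) => // i.
split.
- near=> y; apply/diff_derivable/d1; near: y; exact: open_nbhs_nbhs.
- exact/derivableP/diff_derivable/d1.
- exact/derivableP/diff_derivable/d2.
Unshelve. all: by end_near. Qed.

Lemma jet2_harmonic (U : set 'rV[R]_n) f x : open U -> harmonic_on U f -> U x ->
  jet2 f x (fun i => partial i f x) 0.
Proof. by move=> oU [c2 h0] Ux; rewrite -(h0 _ Ux); exact: jet2_C2 c2 Ux. Qed.

Lemma jet2_dist2 (c x : 'rV[R]_n) :
  jet2 (fun y => \sum_i (y 0 i - c 0 i) ^+ 2) x
    (fun i => 2 * (x 0 i - c 0 i)) (2 * n%:R).
Proof.
have H i : jet2 (fun y : 'rV[R]_n => (y 0 i - c 0 i) ^+ 2) x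
    (fun j => 2 * (x 0 i - c 0 i) * (j == i)%:R) 2.
  have := jet2_sqr (jet2D (jet2_coord i x) (jet2_cst (- c 0 i) x)).
  move/jet2_eq; apply=> [j|]; first by rewrite addr0.
  rewrite addr0 mulr0 add0r (bigD1 i)//= eqxx addr0 expr1n big1 ?addr0 ?mulr1//.
  by move=> j /negbTE ->; rewrite addr0 expr0n.
apply: jet2_eq (jet2_sum _ H) _ _ => [j|].
  rewrite (bigD1 j)//= eqxx mulr1 big1 ?addr0// => i.
  by rewrite eq_sym => /negbTE ->; rewrite mulr0.
by rewrite sumr_const card_ord mulr_natr.
Qed.

End jets.

(** * Comparison with functions touched from above *)

Lemma continuous_bigsum (R : realType) (T : topologicalType) (I : Type)
    (r : seq I) (f : I -> T -> R) (x : T) :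
  (forall i, {for x, continuous (f i)}) ->
  {for x, continuous (fun y => \sum_(i <- r) f i y)}.
Proof.
move=> cf; elim: r => [|i r IH].
  rewrite (_ : (fun y => _) = cst 0); first exact: cvg_cst.
  by apply/funext => y; rewrite big_nil.
rewrite (_ : (fun y => _) = f i \+ (fun y => \sum_(i <- r) f i y)).
  by apply: cvgD; [exact: cf|exact: IH].
by apply/funext => y; rewrite big_cons.
Qed.

Section comparison.
Context {R : realType} {n : nat}.
Implicit Types (F : 'rV[R]_n -> R) (x : 'rV[R]_n).

Lemma is_derive_line F x e t : derivable F (t *: e + x) e ->
  is_derive t (1 : R) (fun s : R => F (s *: e + x)) ('D_e F (t *: e + x)).
Proof.
move=> dF.
have E : (fun h : R => h^-1 *: (((fun s : R => F (s *: e + x)) \o shift t) (h *: (1 : R))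
      - F (t *: e + x))) =
    (fun h : R => h^-1 *: ((F \o shift (t *: e + x)) (h *: e) - F (t *: e + x))).
  apply/funext => h /=.
  by rewrite [h *: 1]mulr1 scalerDl addrA.
by apply: DeriveDef; rewrite ?/derivable ?/derive E.
Qed.

(** If [b] were negative, the directional derivative would be larger at [x] than just after it and
    smaller than just before it. Whatever its sign at [x], the mean value theorem then makes [F]
    fall below [F x] on one side. *)
Lemma derive2_ge0_of_min F x e b :
  (\forall y \near x, derivable F y e) ->
  is_derive x e (fun y => 'D_e F y) b ->
  (\forall y \near x, F x <= F y) -> 0 <= b.
Proof.
move=> dF [d2F d2FE] minF; rewrite leNgt; apply/negP => b0.
have lineN (P : set 'rV[R]_n) : (\forall y \near x, P y) ->
    \forall h \near (0 : R), P (h *: e + x).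
  move=> Px.
  have cl : h *: e + x @[h --> (0 : R)] --> x.
    rewrite -[X in _ --> X]add0r -[X in _ --> X + _](scale0r e).
    by apply: cvgD; [apply: cvgZr_tmp; exact: cvg_id|exact: cvg_cst].
  exact: cl _ Px.
have quo : \forall h \near (0 : R)^',
    h^-1 * ('D_e F (h *: e + x) - 'D_e F x) < 0.
  have : h^-1 * ('D_e F (h *: e + x) - 'D_e F x) @[h --> (0 : R)^'] --> b.
    by rewrite -d2FE; exact: d2F.
  by move=> /cvgr_lt/(_ _ b0).
have [r /= r0 H] : \forall h \near (0 : R), [/\ derivable F (h *: e + x) e,
    F x <= F (h *: e + x) & h != 0 -> h^-1 * ('D_e F (h *: e + x) - 'D_e F x) < 0].
  near=> h; split.
  - by near: h; exact: lineN dF.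
  - by near: h; exact: lineN minF.
  - by near: h; exact: quo.
have Hr h : `|h| < r -> [/\ derivable F (h *: e + x) e,
    F x <= F (h *: e + x) & h != 0 -> h^-1 * ('D_e F (h *: e + x) - 'D_e F x) < 0].
  by move=> hr; apply: H; rewrite /= sub0r normrN.
pose g (s : R) := F (s *: e + x).
have g0 : g 0 = F x by rewrite /g scale0r add0r.
have mvt (s t : R) : s < t -> `|s| < r -> `|t| < r ->
    exists2 c, s < c < t & g t - g s = 'D_e F (c *: e + x) * (t - s).
  move=> st sr tr.
  have dg h : h \in `[s, t] -> derivable F (h *: e + x) e.
    rewrite in_itv/= => /andP[sh ht]; have [] // := Hr h.
    move: sr tr; rewrite !ltr_norml => /andP[? ?] /andP[? ?].
    by rewrite (lt_le_trans _ sh)//= (le_lt_trans ht).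
  have [||c] := @MVT R g (fun h => 'D_e F (h *: e + x)) s t st.
  - move=> h hst; apply: is_derive_line; apply: dg.
    by move: hst; rewrite !in_itv/= => /andP[/ltW -> /ltW ->].
  - apply: derivable_within_continuous => h hst.
    by have [] := is_derive_line (dg _ hst).
  - by rewrite in_itv/= => ct gE; exists c.
have r2 : `|r / 2| < r by rewrite gtr0_norm; lra.
(* A nonpositive slope at [x] produces smaller values to the right, a positive slope smaller values
   to the left; the vanishing of the slope at a minimum is never established. *)
have [c0|c0] := leP ('D_e F x) 0.
  have [|||c /andP[c1 c2] ] := mvt 0 (r / 2); rewrite ?normr0//; first lra.
  rewrite subr0 g0 => gE.
  have cr : `|c| < r by rewrite gtr0_norm//; lra.
  have [_ _] := Hr c cr; rewrite gt_eqF// => /(_ isT).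
  rewrite pmulr_rlt0 ?invr_gt0// => Dc.
  have [_ + _] := Hr _ r2; rewrite -/(g (r / 2)); apply/negP; rewrite -ltNge.
  by rewrite -subr_lt0 gE pmulr_llt0; lra.
have r2' : `|- (r / 2)| < r by rewrite normrN.
have [|||c /andP[c1 c2] ] := mvt (- (r / 2)) 0; rewrite ?normr0//; first lra.
rewrite sub0r opprK g0 => gE.
have cr : `|c| < r by rewrite ltr0_norm//; lra.
have [_ _] := Hr c cr; rewrite lt_eqF// => /(_ isT).
rewrite nmulr_rlt0 ?invr_lt0// => Dc.
have [_ + _] := Hr _ r2'; rewrite -/(g (- (r / 2))); apply/negP; rewrite -ltNge.
rewrite -subr_gt0 gE pmulr_lgt0; lra.
Unshelve. all: by end_near. Qed.

Lemma jet2_min_ge0 F x a l : jet2 F x a l ->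
  (\forall y \near x, F x <= F y) -> 0 <= l.
Proof.
move=> [b H ->] mF; apply: sumr_ge0 => i _.
by have [dF _ d2F] := H i; exact: derive2_ge0_of_min dF d2F mF.
Qed.

Lemma bounded_setP (A : set 'rV[R]_n) :
  bounded_set A <-> exists M, forall x, A x -> `|x| <= M.
Proof.
split=> [[M [_ AM]]|[M AM]]; first by exists (M + 1) => x; apply: AM; rewrite ltrDl.
by exists M; split; [exact: num_real|move=> r /ltW Mr x /AM /le_trans; exact].
Qed.

Lemma closure_bounded (V : set 'rV[R]_n) : bounded_set V -> bounded_set (closure V).
Proof.
move=> /bounded_setP[M HM]; apply/bounded_setP; exists M => x clx.
have cM : closed [set y : 'rV[R]_n | `|y| <= M].
  apply: (@preimage_closed _ _ (fun y : 'rV[R]_n => `|y|) [set r | r <= M]).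
    by move=> y _; exact: norm_continuous.
  exact: closed_le.
have /(@closureS _ V)/(_ _ clx) : V `<=` [set y | `|y| <= M] by [].
by rewrite -((closure_id _).1 cM).
Qed.

Lemma compact_closure (V : set 'rV[R]_n) : bounded_set V -> compact (closure V).
Proof.
by move=> bV; apply: bounded_closed_compact;
  [exact: closure_bounded|exact: closed_closure].
Qed.

(** A pointwise substitute for a nonpositive Laplacian. The touching function may depend on [e],
    which leaves room for penalty terms. *)
Definition touched_above F x : Prop :=
  forall e : R, 0 < e -> exists (phi : 'rV[R]_n -> R) (a : 'I_n -> R) (l : R),
    [/\ jet2 phi x a l, l < e, F x = phi x & \forall y \near x, F y <= phi y].

Lemma ler_coord_norm x (i : 'I_n) : `|x 0 i| <= `|x|.
Proof.
rewrite [leRHS]/Num.Def.normr /= mx_normrE; apply/bigmax_geP; right => /=.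
by exists (ord0, i).
Qed.

Lemma jet2_continuous_dist2 (c : 'rV[R]_n) :
  continuous (fun y : 'rV[R]_n => \sum_i (y 0 i - c 0 i) ^+ 2).
Proof.
move=> x; apply: continuous_bigsum => i.
apply: (@continuous_comp _ _ _ (fun y : 'rV[R]_n => y 0 i - c 0 i)
  (fun t : R => t ^+ 2)); last exact: exprn_continuous.
apply: (@continuousB _ _ _ (fun y : 'rV[R]_n => y 0 i) (cst (c 0 i))).
  exact: coord_continuous.
exact: cst_continuous.
Qed.

(** If [F] were negative inside, [F - e * q] with [q] the squared Euclidean norm would attain its
    minimum at an interior point. There the touching function minus [e * q] has a local minimum too,
    so its Laplacian [l - 2 * n * e] is nonnegative, against [l < e] and [n >= 1]. *)
Lemma touched_comparison (V : set 'rV[R]_n) F : (0 < n)%N ->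
  open V -> bounded_set V -> {within closure V, continuous F} ->
  (forall x, V x -> touched_above F x) ->
  (forall y, bdry V y -> 0 <= F y) -> forall y, V y -> 0 <= F y.
Proof.
move=> n0 oV bV cF tF bF y0 Vy0; rewrite leNgt; apply/negP => Fy0.
pose q (x : 'rV[R]_n) := \sum_i (x 0 i - (0 : 'rV[R]_n) 0 i) ^+ 2.
have q0 x : 0 <= q x by apply: sumr_ge0 => i _; exact: sqr_ge0.
have [Q Q0 qQ] : exists2 Q, 0 <= Q & forall x, closure V x -> q x <= Q.
  have /bounded_setP[M HM] := closure_bounded bV.
  exists (n%:R * M ^+ 2) => [|x /HM/= xM]; first by rewrite mulr_ge0 ?sqr_ge0.
  have -> : n%:R * M ^+ 2 = \sum_(i < n) M ^+ 2.
    by rewrite sumr_const card_ord mulr_natl.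
  apply: ler_sum => i _; rewrite mxE subr0 -real_normK ?num_real//.
  by rewrite lerXn2r ?nnegrE ?(le_trans (ler_coord_norm x i))// (le_trans _ xM).
(* Small enough that [e * Q < - F y0]: the penalty cannot push the minimum to the boundary, where
   [F >= 0]. *)
pose e := - F y0 / (2 * (Q + 1)).
have e0 : 0 < e by rewrite divr_gt0//; lra.
have eQ : e * Q < - F y0.
  have : e * (2 * (Q + 1)) = - F y0 by rewrite divfK//; apply/eqP; lra.
  by nra.
pose G x := F x - e * q x.
have cG : {within closure V, continuous G}.
  move=> x; apply: cvgB; first exact: cF.
  apply: cvgM; first exact: cvg_cst.
  exact: (continuous_subspaceT (@jet2_continuous_dist2 0)).
have clV := subset_closure Vy0.
have [|x1] := EVT_min_rV _ (compact_closure bV) cG; first by exists y0.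
rewrite inE => clx1 minG.
have Gx1 : G x1 < - (e * Q).
  have := minG y0 (mem_set clV); rewrite {2}/G => h; apply: (le_lt_trans h).
  by have := q0 y0; nra.
have Vx1 : V x1.
  apply: contrapT => nV; have := bF _ (conj clx1 nV); apply/negP; rewrite -ltNge.
  by have := qQ _ clx1; move: Gx1; rewrite /G; nra.
have [phi [a [l [jphi le Fphi Fle]]]] := tF _ Vx1 _ e0.
have : 0 <= l + - e * (2 * n%:R).
  apply: (jet2_min_ge0 (jet2D jphi (jet2Z (- e) (jet2_dist2 0 x1)))).
  near=> y; rewrite -Fphi.
  have Vy : V y by near: y; exact: open_nbhs_nbhs.
  have Fy : F y <= phi y by near: y.
  have := minG y (mem_set (subset_closure Vy)); rewrite /G /q; lra.
have : 1 <= n%:R :> R by rewrite ler1n.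
nra.
Unshelve. all: by end_near. Qed.

End comparison.

(** * Perron-Wiener-Brelot solutions *)

Section perron.
Context {R : realType} {n : nat}.
Implicit Types (f s h : 'rV[R]_n -> R) (x : 'rV[R]_n) (E V : set 'rV[R]_n).

Lemma continuous_in_within (A : set 'rV[R]_n) f :
  (forall x, A x -> {for x, continuous f}) -> {within A, continuous f}.
Proof. by move=> cf; apply: continuous_in_subspaceT => x /set_mem; exact: cf. Qed.

Lemma bdry_closure V y : bdry V y -> closure V y.
Proof. by case. Qed.

Lemma touched_aboveB s h x (V : set 'rV[R]_n) : open V -> V x ->
  harmonic_on V h -> touched_above s x -> touched_above (fun y => s y - h y) x.
Proof.
move=> oV Vx hh ts e /ts[phi [a [l [jphi le sE sle]]]].
exists (fun y => phi y + -1 * h y), (fun i => a i + -1 * partial i h x), (l + -1 * 0).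
split; first exact: jet2D jphi (jet2Z (-1) (jet2_harmonic oV hh Vx)).
- by rewrite mulr0 addr0.
- by rewrite sE mulN1r.
- by near=> y; rewrite mulN1r lerD2r; near: y; exact: sle.
Unshelve. all: by end_near.
Qed.

Lemma touched_above_jet s x a l : jet2 s x a l -> l <= 0 -> touched_above s x.
Proof.
move=> js l0 e e0; exists s, a, l; split => //; first exact: le_lt_trans e0.
near=> y; exact: lexx.
Unshelve. all: by end_near.
Qed.

Lemma touched_ge_harmonic V s h : (0 < n)%N -> open V -> bounded_set V ->
  {within closure V, continuous s} -> (forall x, V x -> touched_above s x) ->
  {within closure V, continuous h} -> harmonic_on V h ->
  (forall y, bdry V y -> h y <= s y) -> forall y, V y -> h y <= s y.
Proof.
move=> n0 oV bV cs ts ch hh hs y Vy; rewrite -subr_ge0.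
apply: (touched_comparison n0 oV bV (F := fun y => s y - h y)) => //.
- by move=> z; apply: cvgB; [exact: cs|exact: ch].
- by move=> x Vx; apply: touched_aboveB hh _ => //; exact: ts.
- by move=> z bz; rewrite subr_ge0; exact: hs.
Qed.

(** Hyperharmonicity is the comparison principle applied to [s - h], which is touched above because
    subtracting a harmonic function leaves the Laplacian of the touching function unchanged. *)
Lemma touched_upper_PWB_class E s f : (0 < n)%N -> E !=set0 -> bounded_set E ->
  (forall x, closure E x -> {for x, continuous s}) ->
  (forall x, E x -> touched_above s x) ->
  (forall y, bdry E y -> f y <= s y) ->
  upper_PWB_class E f (fun x => (s x)%:E).
Proof.
move=> n0 [x0 Ex0] bE cs ts fs; split.
- split => // [x Ex c|V oV bV VE h ch hh hs y Vy].
    rewrite lte_fin => csx; have := cvgr_gt _ (cs x (subset_closure Ex)) c csx.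
    by move=> sc; near=> z; rewrite lte_fin; near: z; exact: sc.
  rewrite lee_fin; apply: (touched_ge_harmonic n0 oV bV _ _ ch hh) => //.
  + by apply: continuous_in_within => x /VE /subset_closure; exact: cs.
  + by move=> x /subset_closure/VE; exact: ts.
- have [|x1 _ H] := EVT_min_rV _ (compact_closure bE) (continuous_in_within cs).
    by exists x0; exact: subset_closure.
  by exists (s x1) => x Ex; rewrite lee_fin H// inE; exact: subset_closure.
- move=> y by0 c cf; have csy : c < s y by rewrite (lt_le_trans cf)//; exact: fs.
  have := cvgr_gt _ (cs y (bdry_closure by0)) c csy.
  by move=> sc; near=> z => _; rewrite lte_fin; near: z; exact: sc.
Unshelve. all: by end_near.
Qed.

Lemma upper_PWB_le E s f x : (0 < n)%N -> E !=set0 -> bounded_set E ->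
  (forall x, closure E x -> {for x, continuous s}) ->
  (forall x, E x -> touched_above s x) ->
  (forall y, bdry E y -> f y <= s y) ->
  (upper_PWB E f x <= (s x)%:E)%E.
Proof.
move=> n0 En bE cs ts fs; apply: ereal_inf_lbound.
by exists (fun x => (s x)%:E) => //; exact: touched_upper_PWB_class.
Qed.

Lemma le_upper_PWB E f g x : (forall y, bdry E y -> f y <= g y) ->
  (upper_PWB E f x <= upper_PWB E g x)%E.
Proof.
move=> fg; apply: ereal_inf_le_tmp => _ [s [h1 h2 h3] <-]; exists s => //; split => //.
by move=> y by0 c cf; apply: h3 => //; rewrite (lt_le_trans cf)//; exact: fg.
Qed.

Lemma sublevel_closure (rho : 'rV[R]_n -> R) (c : R) : continuous rho ->
  closure [set x | rho x < c] `<=` [set x | rho x <= c].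
Proof.
move=> cr.
have clr : closed [set x | rho x <= c].
  by apply: (@preimage_closed _ _ rho [set r | r <= c]) => //; exact: closed_le.
rewrite ((closure_id _).1 clr); apply: closureS => x; exact: ltW.
Qed.

Lemma sublevel_open (rho : 'rV[R]_n -> R) (c : R) : continuous rho ->
  open [set x | rho x < c].
Proof.
by move=> cr; apply: (@open_comp _ _ rho [set r | r < c]) => //; exact: open_lt.
Qed.

Lemma sublevel_bdry (rho : 'rV[R]_n -> R) (c : R) : continuous rho ->
  forall x, bdry [set x | rho x < c] x -> rho x = c.
Proof.
move=> cr x [/(sublevel_closure cr)/= xc /negP]; rewrite -leNgt => cx.
by apply/eqP; rewrite eq_le xc cx.
Qed.

(* The comparison principle is applied on [rho < - k.+1%:R^-1], close enough to
   the boundary for the boundary estimate on [s] to hold there. *)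
Lemma upper_PWB_ge (rho h f : 'rV[R]_n -> R) x : continuous rho ->
  bounded_set [set x | rho x < 0] -> rho x < 0 ->
  continuous h -> harmonic_on [set x | rho x < 0] h ->
  (forall y, bdry [set x | rho x < 0] y -> h y <= f y) ->
  ((h x)%:E <= upper_PWB [set x | (rho x < 0)%R] f x)%E.
Proof.
set D := [set x | rho x < 0] => cr bD rx ch hh hf.
apply: le_ereal_inf_tmp => _ [s [[hs1 hs2 hs3] _ sb] <-].
apply/lee_addgt0Pr => e e0.
have e2 : 0 < e / 2 by rewrite divr_gt0.
pose A : set 'rV[R]_n := [set z | D z -> ((h z - e)%:E <= s z)%E].
have nA y : bdry D y -> nbhs y A.
  move=> by0; have := sb y by0 (f y - e / 2).
  rewrite ltrBlDr ltrDl => /(_ e2) H1.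
  have H2 : \forall z \near y, h z < h y + e / 2.
    by apply: (cvgr_lt _ (ch y)); rewrite ltrDl.
  near=> z => Dz; have hz : h z < h y + e / 2 by near: z; exact: H2.
  have sz : ((f y - e / 2)%:E < s z)%E by move: Dz; near: z; exact: H1.
  apply: (le_trans _ (ltW sz)).
  rewrite lee_fin; have := hf y by0; lra.
have cl : compact (closure D) by exact: compact_closure.
have [k [kx kA]] : exists k : nat, rho x < - k.+1%:R^-1 /\
    forall z, closure D z -> rho z = - k.+1%:R^-1 -> A z.
  have inv0 (r : R) : r < 0 -> \forall k \near \oo, r < - k.+1%:R^-1.
    move=> r0; near=> k; rewrite ltrNr; near: k.
    by apply: (cvgr_lt _ (@cvg_harmonic R)); rewrite oppr_gt0.
  (* Uniformity in [z] by compactness: near an interior point the level [- k.+1%:R^-1] is missed for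
     all large [k], and near a boundary point [A] holds for every [k]. *)
  have : \forall k \near \oo, closure D `<=` [set z | rho z = - k.+1%:R^-1 -> A z].
    apply: ((compact_near_coveringP _).1 cl) => z clz.
    have [rz|rz] := ltP (rho z) 0.
      have rz2 : rho z / 2 < 0 by rewrite pmulr_llt0.
      exists ([set z' | rho z' < rho z / 2], [set k | rho z / 2 < - k.+1%:R^-1]).
        split; last exact: inv0.
        by apply: (cvgr_lt _ (cr z)); lra.
      move=> [z' k] /= [h1 h2] h3; suff : false by [].
      by have := lt_trans h1 h2; rewrite h3 ltxx.
    have bz : bdry D z by split=> //; apply/negP; rewrite -leNgt.
    by exists (A, setT) => [|[z' k] [/=]//]; split; [exact: nA|exact: filterT].
  move=> H; near \oo => k; exists k; split; first by near: k; exact: inv0.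
  by move=> z clz; apply: (near H k).
have kD : [set x | rho x < - k.+1%:R^-1] `<=` D.
  by move=> z /= /lt_trans; apply; rewrite oppr_lt0.
have kD' : closure [set x | rho x < - k.+1%:R^-1] `<=` D.
  by move=> z /(sublevel_closure cr)/= /le_lt_trans; apply; rewrite oppr_lt0.
suff : ((h x - e)%:E <= s x)%E.
  by rewrite EFinB leeBlDr.
apply: (hs3 [set x | rho x < - k.+1%:R^-1] _ _ _ (fun y => h y - e)) => //.
- exact: sublevel_open.
- case/bounded_setP : bD => M HM; apply/bounded_setP; exists M => z /kD; exact: HM.
- apply: continuous_in_within => z _; apply: (@continuousB _ _ _ h (cst e)).
    exact: ch.
  exact: cst_continuous.
- case: hh => -[d1 d2 d3] lap.
  have pE i : partial i (fun y => h y - e) = partial i h.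
    apply/funext => y; rewrite /partial /derive.
    rewrite (_ : (fun t => _) =
      (fun t => t^-1 *: ((h \o shift y) (t *: unitv R i) - h y)))//.
    by apply/funext => t /=; rewrite opprB addrA subrK.
  split; last by move=> z /kD zD; under eq_bigr do rewrite pE; exact: lap.
  split.
  + move=> z /kD zD; apply: differentiableB; [exact: d1|exact: differentiable_cst].
  + by move=> i z /kD zD; rewrite pE; exact: d2.
  + by move=> i j z /kD zD; rewrite pE; exact: d3.
- move=> y by0; apply: kA.
  + by apply: closureS (bdry_closure by0).
  + exact: (sublevel_bdry cr by0).
  + exact/kD'/bdry_closure.
Unshelve. all: by end_near. Qed.

End perron.

(** * The Dirichlet problem with polynomial data on a quadric *)

(** Finite-dimensional injective-implies-surjective, modulo a predicate [W] of negligible vectors.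
    Write the characteristic polynomial as [q * 'X^m] with [q.[0] != 0]. By Cayley-Hamilton
    [q(A) * A^m = 0], so pulling 0 back through [A] [m] times puts [d * q(A)] in [W]; and [q(A)] is
    the invertible scalar [q.[0]] plus a multiple of [A]. *)
Lemma mulmx_surj_mod (F : fieldType) (N : nat) (A : 'M[F]_N) (W : 'rV[F]_N -> Prop) :
  W 0 -> (forall c, W (c *m A) -> W c) -> forall c, exists c', W (c + c' *m A).
Proof.
case: N A W => [A W W0 _ c|N A W W0 inj c].
  by exists 0; rewrite (thinmx0 (c + _)).
have [m [q]] := multiplicity_XsubC (char_poly A) 0.
rewrite monic_neq0 ?char_poly_monic//= => q0 charE.
have [r rE] : exists r, q - (q.[0])%:P = r * ('X - 0%:P).
  by apply/factor_theorem; rewrite /root !hornerE subrr.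
have qr : horner_mx A q = (q.[0])%:M + horner_mx A r *m A.
  rewrite {1}(_ : q = (q.[0])%:P + r * ('X - 0%:P)); last by rewrite -rE addrC subrK.
  by rewrite rmorphD rmorphM/= rmorphB/= !horner_mx_C horner_mx_X raddf0 subr0.
have HA : horner_mx A q *m A ^+ m = 0.
  have := Cayley_Hamilton A; rewrite charE rmorphM/= rmorphXn/= rmorphB/=.
  by rewrite horner_mx_X horner_mx_C raddf0 subr0.
have q0' : q.[0] != 0 by exact: q0.
pose d := (q.[0])^-1 *: c.
have Wd : W (d *m horner_mx A q).
  have : W (d *m horner_mx A q *m A ^+ m) by rewrite -mulmxA HA mulmx0.
  elim: m {HA charE} => [|m IH]; first by rewrite expr0 mulmx1.
  by rewrite exprSr mulmxA => /inj.
exists (d *m horner_mx A r); move: Wd.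
by rewrite qr mulmxDr mul_mx_scalar /d scalerA divff// scale1r mulmxA.
Qed.

(** Polynomial functions of degree strictly less than the index. Index 0 leaves only the zero
    function, so that truncated predecessors give the right index for derivatives and products;
    quadratic polynomials have index 3. *)
Inductive polyfun {R : realType} {n : nat} : nat -> ('rV[R]_n -> R) -> Prop :=
| polyfun0 k : polyfun k (fun=> 0)
| polyfunC k c : polyfun k.+1 (fun=> c)
| polyfunD k f g : polyfun k f -> polyfun k g -> polyfun k (fun x => f x + g x)
| polyfunX k i f : polyfun k f -> polyfun k.+1 (fun x => x 0 i * f x).

Section polyfun_theory.
Context {R : realType} {n : nat}.
Implicit Types (f g : 'rV[R]_n -> R) (x : 'rV[R]_n).

Lemma polyfun_eq0 f : polyfun 0 f -> f = fun=> 0.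
Proof.
suff H k : polyfun k f -> k = 0%N -> f = fun=> 0 by move=> /H; exact.
elim=> // {k f} k f g _ IHf _ IHg k0.
by rewrite IHf// IHg//; apply/funext => x; rewrite addr0.
Qed.

Lemma polyfun_ext k f g : f =1 g -> polyfun k f -> polyfun k g.
Proof. by move=> /funext ->. Qed.

Lemma polyfunS k f : polyfun k f -> polyfun k.+1 f.
Proof. by elim => *; constructor. Qed.

Lemma polyfun_leq k l f : (k <= l)%N -> polyfun k f -> polyfun l f.
Proof. by move=> /subnK <-; elim: (l - k)%N => // m IH /IH; exact: polyfunS. Qed.

Lemma polyfunM k l f g : polyfun k f -> polyfun l g ->
  polyfun (k.-1 + l) (fun x => f x * g x).
Proof.
move=> pf pg; elim: pf => {k f} [k|k c|k f f' _ IH _ IH'|k i f pf IH].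
- by apply: polyfun_ext (polyfun0 _) => x; rewrite mul0r.
- apply: (@polyfun_leq l); first exact: leq_addl.
  elim: pg => {l g} [l|l d|l g h _ IHg _ IHh|l i g _ IH].
  + by apply: polyfun_ext (polyfun0 _) => x; rewrite mulr0.
  + exact: polyfunC.
  + by apply: polyfun_ext (polyfunD IHg IHh) => x; rewrite mulrDr.
  + by apply: polyfun_ext (polyfunX i IH) => x; rewrite mulrCA.
- by apply: polyfun_ext (polyfunD IH IH') => x; rewrite mulrDl.
- case: k pf IH => [/polyfun_eq0 -> _|k pf IH].
    by apply: polyfun_ext (polyfun0 _) => x; rewrite mulr0 mul0r.
  by apply: polyfun_ext (polyfunX i IH) => x; rewrite mulrA.
Qed.

Lemma polyfunZ k c f : polyfun k f -> polyfun k (fun x => c * f x).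
Proof. exact: polyfunM (polyfunC 0 c). Qed.

Lemma polyfun_sum k (I : Type) (r : seq I) (F : I -> 'rV[R]_n -> R) :
  (forall i, polyfun k (F i)) -> polyfun k (fun x => \sum_(i <- r) F i x).
Proof.
move=> pF; elim: r => [|i r IH].
  by apply: polyfun_ext (polyfun0 _) => x; rewrite big_nil.
by apply: polyfun_ext (polyfunD (pF i) IH) => x; rewrite big_cons.
Qed.

Lemma polyfun_coord i : polyfun 2 (fun x => x 0 i).
Proof. by apply: polyfun_ext (polyfunX i (polyfunC 0 1)) => x; rewrite mulr1. Qed.

Lemma polyfun_differentiable k f x : polyfun k f -> differentiable f x.
Proof.
elim=> {k f} [k|k c|k f g _ IHf _ IHg|k i f _ IH].
- exact: differentiable_cst.
- exact: differentiable_cst.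
- exact: differentiableD.
- by apply: differentiableM => //; exact: differentiable_coord.
Qed.

Lemma polyfun_continuous k f : polyfun k f -> continuous f.
Proof.
by move=> pf x; apply: differentiable_continuous; exact: polyfun_differentiable pf.
Qed.

Lemma polyfun_derivable k f x v : polyfun k f -> derivable f x v.
Proof. by move=> pf; apply: diff_derivable; exact: polyfun_differentiable pf. Qed.

Lemma partial_polyfunD k l f g i : polyfun k f -> polyfun l g ->
  partial i (fun x => f x + g x) = fun x => partial i f x + partial i g x.
Proof.
move=> pf pg; apply/funext => x; rewrite /partial -deriveD//.
  exact: polyfun_derivable pf.
exact: polyfun_derivable pg.
Qed.

Lemma partial_polyfunM k l f g i : polyfun k f -> polyfun l g ->
  partial i (fun x => f x * g x) =
  fun x => f x * partial i g x + g x * partial i f x.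
Proof.
move=> pf pg; apply/funext => x.
have fx := @polyfun_derivable k f x (unitv R i) pf.
have gx := @polyfun_derivable l g x (unitv R i) pg.
exact: (deriveM fx gx).
Qed.

Lemma partial_cst (c : R) (i : 'I_n) :
  partial i (fun _ : 'rV[R]_n => c) = fun _ => 0 : R.
Proof. by apply/funext => x; rewrite /partial (derive_cst c). Qed.

Lemma partial_polyfunZ k c f i : polyfun k f ->
  partial i (fun x => c * f x) = fun x => c * partial i f x.
Proof.
move=> pf; rewrite (partial_polyfunM _ (polyfunC 0 c) pf) partial_cst.
by apply/funext => x; rewrite mulr0 addr0.
Qed.

Lemma polyfun_partial k f i : polyfun k f -> polyfun k.-1 (partial i f).
Proof.
elim=> {k f} [k|k c|k f g pf IHf pg IHg|k j f pf IH] //=.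
- by rewrite partial_cst; exact: polyfun0.
- by rewrite partial_cst; exact: polyfun0.
- by rewrite (partial_polyfunD _ pf pg); exact: polyfunD.
- rewrite (partial_polyfunM _ (polyfun_coord j) pf).
  case: k pf IH => [/polyfun_eq0 -> _|k pf IH].
    by apply: polyfun_ext (polyfun0 _) => x; rewrite partial_cst mulr0 mul0r addr0.
  apply: polyfun_ext (polyfunD (polyfunX j IH) (polyfunZ (i == j)%:R pf)) => x.
  by have [_ <-] := is_derive_coord j i x; congr (_ + _); exact: mulrC.
Qed.

Definition laplacian f x := \sum_i partial i (partial i f) x.

Lemma polyfun_laplacian k f : polyfun k f -> polyfun k.-2 (laplacian f).
Proof. by move=> pf; apply: polyfun_sum => i; do 2 apply: polyfun_partial. Qed.

Lemma laplacian_polyfunD k l f g : polyfun k f -> polyfun l g ->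
  laplacian (fun x => f x + g x) = fun x => laplacian f x + laplacian g x.
Proof.
move=> pf pg; apply/funext => x; rewrite /laplacian -big_split/=.
apply: eq_bigr => i _.
by rewrite (partial_polyfunD _ pf pg)
  (partial_polyfunD _ (polyfun_partial i pf) (polyfun_partial i pg)).
Qed.

Lemma laplacian_polyfunZ k c f : polyfun k f ->
  laplacian (fun x => c * f x) = fun x => c * laplacian f x.
Proof.
move=> pf; apply/funext => x; rewrite /laplacian mulr_sumr.
apply: eq_bigr => i _.
by rewrite (partial_polyfunZ _ _ pf) (partial_polyfunZ _ _ (polyfun_partial i pf)).
Qed.

Lemma laplacian_cst (c : R) : laplacian (fun=> c) = fun=> 0.
Proof.
by apply/funext => x; rewrite /laplacian big1// => i _; rewrite !partial_cst.
Qed.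

Lemma laplacian_polyfun_sum k (I : Type) (r : seq I) (F : I -> 'rV[R]_n -> R) :
  (forall i, polyfun k (F i)) ->
  laplacian (fun x => \sum_(i <- r) F i x) = fun x => \sum_(i <- r) laplacian (F i) x.
Proof.
move=> pF; elim: r => [|i r IH].
  rewrite (_ : (fun x => _) = fun=> 0); last by apply/funext => x; rewrite big_nil.
  by rewrite laplacian_cst; apply/funext => x; rewrite big_nil.
rewrite (_ : (fun x => _) = fun x => F i x + \sum_(j <- r) F j x); last first.
  by apply/funext => x; rewrite big_cons.
rewrite (laplacian_polyfunD (pF i) (polyfun_sum r pF)) IH.
by apply/funext => x; rewrite big_cons.
Qed.

Lemma polyfun_C2 (U : set 'rV[R]_n) k f : polyfun k f -> C2_on U f.
Proof.
move=> pf; split => [x _|i x _|i j x _].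
- exact: polyfun_differentiable pf.
- exact: polyfun_differentiable (polyfun_partial i pf).
- exact: (polyfun_continuous (polyfun_partial j (polyfun_partial i pf))).
Qed.

(** The family consists of words in the coordinates, hence spans with repetitions. Coefficient
    vectors are thus not unique, and linear algebra on them has to be done modulo those representing
    zero. *)
Lemma polyfun_span k : exists (I : finType) (e : I -> 'rV[R]_n -> R),
  (forall j, polyfun k (e j)) /\
  forall f, polyfun k f -> exists c : I -> R, f = fun x => \sum_j c j * e j x.
Proof.
elim: k => [|k [I [e [pe span]]]].
  exists unit, (fun=> fun=> 0); split=> [_|f /polyfun_eq0 ->]; first exact: polyfun0.
  by exists (fun=> 0); apply/funext => x; rewrite big1// => i _; rewrite mulr0.
pose e' (o : unit + 'I_n * I) : 'rV[R]_n -> R :=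
  if o is inr (i, j) then fun x => x 0 i * e j x else fun=> 1.
exists _, e'; split=> [[u|[i j]]|]; [exact: polyfunC|exact: polyfunX|].
suff H k' f : polyfun k' f -> k' = k.+1 ->
    exists c, f = fun x => \sum_j c j * e' j x by move=> f /H; exact.
elim=> {k' f} [l|l c|l f g _ IHf _ IHg|l i f pf _] E.
- by exists (fun=> 0); apply/funext => x; rewrite big1// => i _; rewrite mul0r.
- exists (fun o => if o is inl _ then c else 0); apply/funext => x.
  rewrite big_sumType/= [X in _ + X]big1 ?addr0; last by move=> o _; rewrite mul0r.
  by rewrite big_const card_unit/= addr0 mulr1.
- have [[c1 ->] [c2 ->]] := (IHf E, IHg E).
  exists (fun o => c1 o + c2 o); apply/funext => x.
  by rewrite -big_split/=; apply: eq_bigr => o _; rewrite mulrDl.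
- case: E => lk; move: pf; rewrite lk => /span[c ->].
  exists (fun o => if o is inr (i', j) then (i' == i)%:R * c j else 0).
  apply/funext => x.
  rewrite big_sumType/= [X in _ = X + _]big1 ?add0r; last by move=> o _; rewrite mul0r.
  transitivity (\sum_i' \sum_j (i' == i)%:R * c j * (x 0 i' * e j x)); last first.
    by rewrite pair_bigA; apply: eq_bigr => -[].
  rewrite (bigD1 i)//= [X in _ + X]big1 ?addr0; last first.
    by move=> i' /negbTE ->; rewrite big1// => j _; rewrite !mul0r.
  by rewrite mulr_sumr; apply: eq_bigr => j _; rewrite eqxx mul1r mulrCA.
Qed.

(* The Laplacian of [rho * q] has at most the degree of [q] when [rho] is
   quadratic, and [q |-> laplacian (rho * q)] is injective by the maximum
   principle, hence surjective on polynomials of bounded degree. *)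
Lemma dirichlet_polyfun (rho : 'rV[R]_n -> R) k f : (0 < n)%N -> polyfun 3 rho ->
  bounded_set [set x | rho x < 0] -> polyfun k f ->
  exists h l, [/\ polyfun l h, harmonic_on [set x | rho x < 0] h &
    forall x, rho x = 0 -> h x = f x].
Proof.
move=> n0 prho bD pf; set D := [set x | rho x < 0].
have crho : continuous rho := polyfun_continuous prho.
have oD : open D by exact: sublevel_open.
have [I [e [pe span]]] := polyfun_span k.
pose comb (c : 'rV[R]_#|I|) x := \sum_j c 0 (enum_rank j) * e j x.
have pcomb c : polyfun k (comb c).
  by apply: polyfun_sum => j; exact: polyfunZ.
have combP g : polyfun k g -> exists c, g = comb c.
  move=> /span[c ->]; exists (\row_i c (enum_val i)); apply/funext => x.
  by apply: eq_bigr => j _; rewrite mxE enum_rankK.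
have prq q : polyfun k q -> polyfun (2 + k) (fun x => rho x * q x).
  exact: polyfunM prho.
have plap q : polyfun k q -> polyfun k (laplacian (fun x => rho x * q x)).
  by move=> /prq/polyfun_laplacian.
have [a aE] := choice (fun j => combP _ (plap _ (pe j))).
pose A : 'M[R]_#|I| := \matrix_(i, j) a (enum_val i) 0 j.
have lapcomb c : laplacian (fun x => rho x * comb c x) = comb (c *m A).
  rewrite (_ : (fun x => _) =
      fun x => \sum_j c 0 (enum_rank j) * (rho x * e j x)); last first.
    by apply/funext => x; rewrite mulr_sumr; apply: eq_bigr => j _; rewrite mulrCA.
  rewrite (laplacian_polyfun_sum _ (fun j => polyfunZ _ (prq _ (pe j)))).
  apply/funext => x.
  under eq_bigr do rewrite (laplacian_polyfunZ _ (prq _ (pe _))) aE mulr_sumr.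
  rewrite exchange_big/=; apply: eq_bigr => j _.
  rewrite mxE mulr_suml (reindex_onto enum_rank enum_val) => [|i _]; last first.
    exact: enum_valK.
  apply: eq_big => [i|i _]; first by rewrite enum_rankK eqxx.
  by rewrite mxE enum_rankK mulrA.
(* Coefficient vectors negligible on [D]. If [rho * comb c] is harmonic on [D], it vanishes there,
   being zero on the boundary; since [rho < 0] inside, [comb c] vanishes as well. This is the
   injectivity hypothesis of [mulmx_surj_mod]. *)
pose W c := forall x, D x -> comb c x = 0.
have W0 : W 0.
  by move=> x _; rewrite /comb big1// => j _; rewrite mxE mul0r.
have injW c : W (c *m A) -> W c.
  move=> Wc.
  have ge0 (s : R) x : D x -> 0 <= s * (rho x * comb c x).
    have pg := polyfunZ s (prq _ (pcomb c)).
    apply: (touched_comparison n0 oD bD (F := fun x => s * (rho x * comb c x))).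
    - by apply: continuous_in_within => y _; exact: (polyfun_continuous pg).
    - move=> y Dy; apply: touched_above_jet (jet2_C2 oD (polyfun_C2 _ pg) Dy) _.
      have := congr1 (fun F => F y) (laplacian_polyfunZ s (prq _ (pcomb c))).
      by rewrite /laplacian => ->; rewrite -/(laplacian _ _) lapcomb Wc// mulr0.
    - by move=> y /(sublevel_bdry crho) ->; rewrite mul0r mulr0.
  move=> x Dx; have := ge0 1 x Dx; have := ge0 (-1) x Dx.
  rewrite mul1r mulN1r oppr_ge0 => g1 g2.
  have /eqP : rho x * comb c x = 0 by apply/eqP; rewrite eq_le g1 g2.
  by rewrite mulf_eq0 lt_eqF//= => /eqP.
have pf2 : polyfun k (laplacian f).
  by apply: polyfun_leq (polyfun_laplacian pf); rewrite -subn2 leq_subr.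
have [c cE] := combP _ pf2.
(* [Wc'] says that on [D] the Laplacians of [f] and of [rho * comb c'] cancel, while the correction
   vanishes where [rho] does. *)
have [c' Wc'] := mulmx_surj_mod W0 injW c.
have ph := polyfunD (polyfun_leq (leq_addl 2 k) pf) (prq _ (pcomb c')).
exists (fun x => f x + rho x * comb c' x), (2 + k)%N; split => //.
- split; first exact: polyfun_C2 ph.
  move=> x Dx; rewrite -/(laplacian _ _) (laplacian_polyfunD pf (prq _ (pcomb c'))).
  rewrite lapcomb cE -[RHS](Wc' x Dx) /comb -big_split/=.
  by apply: eq_bigr => j _; rewrite [(c + _) _ _]mxE mulrDl.
- by move=> x ->; rewrite mul0r addr0.
Qed.

End polyfun_theory.

(** * Density of polynomials *)

Definition poly_approx {R : realType} {n : nat} (K : set 'rV[R]_n)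
    (f : 'rV[R]_n -> R) : Prop :=
  forall e : R, 0 < e -> exists k q,
    polyfun k q /\ forall x, K x -> `|f x - q x| <= e.

Section poly_density.
Context {R : realType} {n : nat}.
Variable K : set 'rV[R]_n.
Hypothesis cK : compact K.
Implicit Types (f g : 'rV[R]_n -> R) (x : 'rV[R]_n).

Lemma within_continuous_bounded f : {within K, continuous f} ->
  exists2 M : R, 0 < M & forall x, K x -> `|f x| <= M.
Proof.
move=> cf; have /compact_bounded[M [_ HM]] := continuous_compact cf cK.
exists (`|M| + 1); first by rewrite ltr_wpDl.
by move=> x Kx; apply: HM; [rewrite (le_lt_trans (ler_norm M))// ltrDl|exists x].
Qed.

Lemma polyfun_within k f : polyfun k f -> {within K, continuous f}.
Proof. by move=> /polyfun_continuous/continuous_subspaceT. Qed.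

Lemma poly_approx_polyfun k f : polyfun k f -> poly_approx K f.
Proof. by move=> pf e e0; exists k, f; split => // x _; rewrite subrr normr0 ltW. Qed.

Lemma poly_approxD f g : poly_approx K f -> poly_approx K g ->
  poly_approx K (fun x => f x + g x).
Proof.
move=> af ag e e0; have e2 : 0 < e / 2 by rewrite divr_gt0.
have [[k [q [pq qf]]] [l [r [pr rg]]]] := (af _ e2, ag _ e2).
exists (maxn k l), (fun x => q x + r x); split.
  by apply: polyfunD; [apply: polyfun_leq pq|apply: polyfun_leq pr];
    rewrite leq_max leqnn ?orbT.
move=> x Kx; rewrite opprD addrACA (le_trans (ler_normD _ _))//.
by have := qf x Kx; have := rg x Kx; lra.
Qed.

Lemma poly_approxZ c f : poly_approx K f -> poly_approx K (fun x => c * f x).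
Proof.
move=> af e e0; have c0 : 0 < `|c| + 1 by rewrite ltr_wpDl.
have [k [q [pq qf]]] := af (e / (`|c| + 1)) (divr_gt0 e0 c0).
exists k, (fun x => c * q x); split; first exact: polyfunZ.
move=> x Kx; rewrite -mulrBr normrM.
have := qf x Kx; rewrite ler_pdivlMr// mulrC => /(le_trans _); apply.
by rewrite ler_wpM2r// lerDl.
Qed.

Lemma poly_approx_lim f : (forall e : R, 0 < e -> exists g, poly_approx K g /\
  forall x, K x -> `|f x - g x| <= e) -> poly_approx K f.
Proof.
move=> H e e0; have e2 : 0 < e / 2 by rewrite divr_gt0.
have [g [ag fg]] := H _ e2; have [k [q [pq gq]]] := ag _ e2.
exists k, q; split=> // x Kx; have := fg x Kx; have := gq x Kx => h1 h2.
rewrite (le_trans (ler_distD (g x) _ _))//; lra.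
Qed.

(** The classical polynomial iteration [r + (f^2 - r^2) / 2] for the square root of [f^2], started
    at 0. *)
Fixpoint abs_iter f (m : nat) : 'rV[R]_n -> R :=
  if m is m'.+1
  then fun x => abs_iter f m' x + 2^-1 * (f x * f x + -1 * (abs_iter f m' x * abs_iter f m' x))
  else fun=> 0.

Lemma polyfun_abs_iter k f m : polyfun k f -> exists l, polyfun l (abs_iter f m).
Proof.
move=> pf; elim: m => [|m [l IH]]; first by exists 0%N; exact: polyfun0.
have p1 := polyfunM pf pf; have p2 := polyfunZ (-1) (polyfunM IH IH).
pose N := (l + (k.-1 + k) + (l.-1 + l))%N.
exists N; apply: polyfunD.
  by apply: polyfun_leq IH; rewrite /N -addnA leq_addr.
apply/polyfunZ/polyfunD; last by apply: polyfun_leq p2; exact: leq_addl.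
by apply: polyfun_leq p1; rewrite /N addnAC leq_addl.
Qed.

(** With [d = |f x| - r] the error, one step multiplies [d] by [1 - (|f x| + r) / 2 <= 1 - d / 2],
    and this recursion keeps [d] below [2 / (m + 1)]. The rate is uniform in [x]. *)
Lemma abs_iter_bound f m x : `|f x| <= 1 ->
  0 <= abs_iter f m x <= `|f x| /\ (`|f x| - abs_iter f m x) * m.+1%:R <= 2.
Proof.
set t := `|f x| => t1; have t0 : 0 <= t by exact: normr_ge0.
have t2 : f x * f x = t * t by rewrite /t -normrM ger0_norm// -expr2 sqr_ge0.
elim: m => [|m [/andP[r0 rt] IH]] /=; first by split; [rewrite lexx t0|lra].
move: IH; rewrite t2; set r := abs_iter f m x in r0 rt *.
rewrite -[m.+2]addn1 natrD; set M : R := m.+1%:R => IH.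
have M1 : 1 <= M by rewrite ler1n.
split; first by apply/andP; split; nra.
have d0 : 0 <= t - r by lra.
have -> : t - (r + 2^-1 * (t * t + -1 * (r * r))) = (t - r) * (1 - (t + r) / 2) by lra.
have h1 : (t - r) * (1 - (t + r) / 2) <= (t - r) * (1 - (t - r) / 2).
  by apply: ler_wpM2l => //; lra.
apply: le_trans (ler_wpM2r _ h1) _; first by lra.
by nra.
Qed.

Lemma poly_approx_norm_polyfun k f : polyfun k f -> poly_approx K (fun x => `|f x|).
Proof.
move=> pf; have [M M0 fM] := within_continuous_bounded (polyfun_within pf).
rewrite (_ : (fun x => _) = fun x => M * `|M^-1 * f x|); last first.
  by apply/funext => x; rewrite normrM gtr0_norm ?invr_gt0// mulVKf ?gt_eqF.
apply: poly_approxZ => e e0.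
have [m me] : exists m : nat, 2 / m.+1%:R <= e.
  exists (Num.truncn (2 / e)); rewrite ler_pdivrMr// mulrC -ler_pdivrMr//.
  by rewrite ltW// truncnS_gt.
have [l pl] := polyfun_abs_iter m (polyfunZ M^-1 pf).
exists l, (abs_iter (fun x => M^-1 * f x) m); split => // x Kx.
have M1 : `|M^-1 * f x| <= 1.
  by rewrite normrM gtr0_norm ?invr_gt0// mulrC ler_pdivrMr// mul1r fM.
have [/andP[r0 rt]] := abs_iter_bound (f := fun x => M^-1 * f x) m M1.
rewrite -ler_pdivlMr// => H; rewrite ger0_norm ?subr_ge0//.
exact: le_trans me.
Qed.

Lemma poly_approx_norm f : poly_approx K f -> poly_approx K (fun x => `|f x|).
Proof.
move=> af; apply: poly_approx_lim => e /af[k [q [pq fq]]].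
exists (fun x => `|q x|); split; first exact: poly_approx_norm_polyfun pq.
by move=> x /fq; apply: le_trans; exact: ler_dist_dist.
Qed.

Lemma poly_approx_min f g : poly_approx K f -> poly_approx K g ->
  poly_approx K (fun x => Num.min (f x) (g x)).
Proof.
move=> af ag; rewrite (_ : (fun x => _) =
    fun x => 2^-1 * ((f x + g x) + -1 * `|f x + -1 * g x|)); last first.
  apply/funext => x; rewrite mulN1r minEle; case: leP => fg.
    rewrite ler0_norm ?subr_le0//; lra.
  rewrite gtr0_norm ?subr_gt0//; lra.
apply/poly_approxZ/poly_approxD; first exact: poly_approxD.
by apply/poly_approxZ/poly_approx_norm/poly_approxD => //; exact: poly_approxZ.
Qed.

Lemma sqr_norm_le_sum x : `|x| ^+ 2 <= \sum_i x 0 i ^+ 2.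
Proof.
have [->|x0] := eqVneq x 0.
  by rewrite normr0 expr0n; apply: sumr_ge0 => i _; exact: sqr_ge0.
have [] := @mx_norm_neq0 _ 1 n x; first by rewrite -[mx_norm x]/`|x| normr_eq0.
move=> [i j] /= xE; rewrite -[`|x|]/(mx_norm x) xE real_normK ?num_real// ord1.
rewrite (bigD1 j)//= lerDl; apply: sumr_ge0 => k _; exact: sqr_ge0.
Qed.

(* [f] is approximated from above by a finite minimum of the paraboloids
   [f y + e + N * |x - y|^2]. *)
Lemma continuous_poly_approx f : {within K, continuous f} -> poly_approx K f.
Proof.
move=> cf; have [M M0 fM] := within_continuous_bounded cf.
apply: poly_approx_lim => e' e'0; pose e := e' / 3.
have e0 : 0 < e by rewrite divr_gt0.
have wf y : K y -> \forall x \near y, K x -> `|f x - f y| < e.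
  move=> Ky; have /cvgrPdist_lt/(_ _ e0) := (subspace_continuousP _ _).1 cf y Ky.
  rewrite /prop_near1/= withinE => -[B nB BK].
  near=> x => Kx; rewrite distrC.
  have Bx : B x by near: x.
  by have : (B `&` K) x by []; rewrite -BK => -[].
have par y : exists p, K y -> [/\ exists k, polyfun k p,
    forall x, K x -> f x <= p x & \forall x \near y, K x -> p x < f x + e'].
  have [Ky|nKy] := pselect (K y); last by exists (fun=> 0).
  have [d /= d0 Hd] := (nbhs_ballP _ _).1 (wf y Ky).
  (* At distance at least [d] from [y] the quadratic term is at least [2 * M], a bound for the
     oscillation of [f] on [K]; closer to [y] the summand [e] suffices. *)
  pose N := 2 * M / d ^+ 2.
  have N0 : 0 < N by rewrite divr_gt0 ?exprn_gt0// mulr_gt0.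
  pose p x := (f y + e) + N * \sum_i (x 0 i - y 0 i) ^+ 2.
  have pp : exists k, polyfun k p.
    exists 3%N; apply: polyfunD; first exact: polyfunC.
    apply: polyfunZ; apply: polyfun_sum => i.
    have H := polyfunD (polyfun_coord i) (polyfunC 1 (- y 0 i)).
    by apply: polyfun_ext (polyfunM H H) => x; rewrite expr2.
  exists p => _; split => //.
    move=> x Kx; rewrite /p; have [xy|xy] := ltP `|y - x| d.
      have : `|f x - f y| < e by apply: Hd Kx; rewrite -ball_normE.
      rewrite ltr_norml => /andP[_ h].
      have : 0 <= N * \sum_i (x 0 i - y 0 i) ^+ 2.
        apply: mulr_ge0; first exact: ltW.
        by apply: sumr_ge0 => i _; exact: sqr_ge0.
      lra.
    have : d ^+ 2 <= \sum_i (x 0 i - y 0 i) ^+ 2.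
      apply: (@le_trans _ _ (`|x - y| ^+ 2)).
        by rewrite distrC lerXn2r ?nnegrE// ltW.
      apply: le_trans (sqr_norm_le_sum _) _.
      by apply: ler_sum => i _; rewrite !mxE.
    have d2 : 0 < d ^+ 2 by rewrite exprn_gt0.
    rewrite -(ler_pM2l N0).
    rewrite {1}/N divfK ?gt_eqF// => h.
    have := fM x Kx; have := fM y Ky; rewrite !ler_norml => /andP[? ?] /andP[? ?].
    lra.
  have [k pk] := pp.
  have py : p y < f y + 2 * e.
    rewrite /p big1 => [|i _]; last by rewrite subrr expr0n.
    by rewrite mulr0; lra.
  have cp := polyfun_continuous pk; have pn := cvgr_lt _ (cp y) _ py.
  near=> x => Kx.
  have h1 : p x < f y + 2 * e by near: x; exact: pn.
  have : `|f x - f y| < e by move: Kx; near: x; exact: wf.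
  rewrite ltr_norml => /andP[h2 _].
  have ee : e' = 3 * e by rewrite /e mulrC divfK.
  lra.
have [p pP] := choice par.
pose O y : set 'rV[R]_n := interior [set x | K x -> p y x < f x + e'].
have oO y : K y -> open (O y) by move=> _; exact: open_interior.
have := cK; rewrite compact_cover => /(_ _ K O oO)[|s sK sO].
  by move=> y Ky; exists y => //; have [] := pP y Ky.
have [g [ag fg gf]] : exists g, [/\ poly_approx K g, forall x, K x -> f x <= g x &
    forall y, y \in finmap.enum_fset s -> forall x, K x -> O y x -> g x < f x + e'].
  have : forall y, y \in finmap.enum_fset s -> K y by move=> y /sK /set_mem.
  move: (finmap.enum_fset s); elim=> [_|y r IH rK].
    exists (fun=> M); split => //; first exact: poly_approx_polyfun (polyfunC 0 M).
    by move=> x Kx; rewrite (le_trans (ler_norm _))// fM.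
  have [|g [ag fg gf]] := IH _; first by move=> z zr; apply: rK; rewrite inE zr orbT.
  have [[k pk] fp pf] := pP y (rK y (mem_head _ _)).
  exists (fun x => Num.min (p y x) (g x)); split.
  - exact: poly_approx_min (poly_approx_polyfun pk) ag.
  - by move=> x Kx; rewrite le_min fp// fg.
  - move=> z; rewrite inE => /predU1P[->|zr] x Kx Ox; rewrite gt_min.
      by have := interior_subset Ox => /(_ Kx) ->.
    by rewrite (gf z zr)// orbT.
exists g; split => // x Kx.
have [y ys Oy] := sO x Kx.
have := fg x Kx; have := gf y ys x Kx Oy.
rewrite ler_norml; lra.
Unshelve. all: by end_near. Qed.

End poly_density.

(** * The Riesz representation theorem *)

(** The distance to the complement of [G], capped at 1. Putting 1 into the set [S x] also covers the
    case where the complement is empty. *)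
Lemma open_bump (R : realType) (V : normedModType R) (G : set V) : open G ->
  exists g : V -> R, [/\ continuous g, forall x, 0 <= g x & forall x, G x <-> 0 < g x].
Proof.
move=> oG.
pose S x : set R := [set r | r = 1 \/ exists2 y, ~ G y & r = `|x - y|].
have Sge0 x : lbound (S x) 0 by move=> r [->|[y _ ->]].
have lbS x : has_lbound (S x) by exists 0.
have S1 x : S x 1 by left.
pose g x := inf (S x).
have g_lip x y : g y <= g x + `|x - y|.
  rewrite -lerBlDr; apply: lb_le_inf; first by exists 1.
  move=> r [->|[z Gz ->]]; rewrite lerBlDr.
    by rewrite (le_trans (ge_inf (lbS y) (S1 y)))// lerDl.
  have Sy : S y `|y - z| by right; exists z.
  rewrite (le_trans (ge_inf (lbS y) Sy))// (le_trans (ler_distD x _ _))//.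
  by rewrite (distrC y x) addrC.
exists g; split.
- move=> x; apply/cvgrPdist_lt => e e0; near=> y.
  have xy : `|x - y| < e by near: y; exact: cvgr_dist_lt.
  have := g_lip x y; have := g_lip y x; rewrite (distrC y x) => h1 h2.
  by rewrite ltr_norml; lra.
- by move=> x; apply: lb_le_inf => //; exists 1.
- move=> x; split=> [Gx|].
    have /nbhs_ballP[d /= d0 dG] := open_nbhs_nbhs (conj oG Gx).
    apply: (@lt_le_trans _ _ (Num.min 1 d)); first by rewrite lt_min ltr01.
    apply: lb_le_inf; first by exists 1.
    move=> r [->|[y Gy ->]]; first by rewrite ge_min lexx.
    rewrite ge_min; apply/orP; right; rewrite leNgt; apply/negP => xy.
    by apply: Gy; apply: dG; rewrite -ball_normE.
  move=> gx; apply: contrapT => Gx; move: gx; apply/negP; rewrite -leNgt.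
  by apply: ge_inf => //; right; exists x => //; rewrite subrr normr0.
Unshelve. all: by end_near. Qed.

Section within_continuous.
Context {R : realType} {n : nat}.
Implicit Types (f g : 'rV[R]_n -> R) (K : set 'rV[R]_n).

Lemma withinD K f g : {within K, continuous f} -> {within K, continuous g} ->
  {within K, continuous (fun x => f x + g x)}.
Proof. by move=> cf cg x; apply: cvgD; [exact: cf|exact: cg]. Qed.

Lemma withinM K f g : {within K, continuous f} -> {within K, continuous g} ->
  {within K, continuous (fun x => f x * g x)}.
Proof. by move=> cf cg x; apply: cvgM; [exact: cf|exact: cg]. Qed.

Lemma within_cst K (c : R) : {within K, continuous (fun _ : 'rV[R]_n => c)}.
Proof. by move=> x; exact: cvg_cst. Qed.
Hint Resolve within_cst : core.

Lemma withinZ K (c : R) f : {within K, continuous f} ->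
  {within K, continuous (fun x => c * f x)}.
Proof. exact: withinM. Qed.

Lemma within_min K f g : {within K, continuous f} -> {within K, continuous g} ->
  {within K, continuous (fun x => Num.min (f x) (g x))}.
Proof. by move=> cf cg x; apply: continuous_min; [exact: cf|exact: cg]. Qed.

Lemma within_max K f g : {within K, continuous f} -> {within K, continuous g} ->
  {within K, continuous (fun x => Num.max (f x) (g x))}.
Proof. by move=> cf cg x; apply: continuous_max; [exact: cf|exact: cg]. Qed.

End within_continuous.

Section riesz.
Context {R : realType} {n : nat}.
Variable K : set 'rV[R]_n.
Hint Resolve within_cst : core.
Hypothesis cK : compact K.
Implicit Types (f g : 'rV[R]_n -> R) (x : 'rV[R]_n) (A G X : set 'rV[R]_n).
Variable L : ('rV[R]_n -> R) -> R.
Hypothesis LD : forall f g, {within K, continuous f} -> {within K, continuous g} ->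
  L (fun x => f x + g x) = L f + L g.
Hypothesis LZ : forall c f, {within K, continuous f} -> L (fun x => c * f x) = c * L f.
Hypothesis Lle : forall f g, {within K, continuous f} -> {within K, continuous g} ->
  (forall x, K x -> f x <= g x) -> L f <= L g.

Let L0 : L (fun=> 0) = 0.
Proof.
by have := LZ 0 (@within_cst R n K 1); rewrite !mul0r.
Qed.

Let L_ge0 f : {within K, continuous f} -> (forall x, K x -> 0 <= f x) -> 0 <= L f.
Proof. by move=> cf f0; rewrite -L0; exact: Lle. Qed.

(** The cost of majorizing the indicator of [A] on [K] by an increasing sequence of continuous
    functions. Sequences play the role of open neighbourhoods in the usual construction, so that
    countable unions are handled by adding sequences. All conditions are imposed on [K] only, whence
    the part of [A] outside [K] is ignored. *)
Definition cover_cost A : set R := [set c | exists F : nat -> 'rV[R]_n -> R,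
  [/\ forall N, {within K, continuous (F N)},
      forall N x, K x -> 0 <= F N x <= F N.+1 x,
      forall N, L (F N) <= c &
      forall x, A x -> K x -> exists N, 1 <= F N x]].

Definition cover_inf A : R := inf (cover_cost A).

Lemma cover_mono (F : nat -> 'rV[R]_n -> R) x :
  (forall N, 0 <= F N x <= F N.+1 x) -> forall M N, (M <= N)%N -> F M x <= F N x.
Proof.
move=> H M N /subnK <-; elim: (N - M)%N => // k IH; apply: le_trans IH _.
by have /andP[] := H (k + M)%N.
Qed.

Lemma cover_cost_lb A : lbound (cover_cost A) 0.
Proof.
move=> c [F [cF F0 FL _]]; apply: le_trans (FL 0%N); apply: L_ge0 => //.
by move=> x Kx; have /andP[] := F0 0%N x Kx.
Qed.

Lemma cover_cost_has_lb A : has_lbound (cover_cost A).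
Proof. by exists 0; exact: cover_cost_lb. Qed.

Lemma cover_cost_fun A g : {within K, continuous g} ->
  (forall x, K x -> 0 <= g x) -> (forall x, A x -> K x -> 1 <= g x) ->
  cover_cost A (L g).
Proof.
move=> cg g0 gA; exists (fun=> g); split => // [N x Kx|x Ax Kx].
  by rewrite g0//= lexx.
by exists 0%N; exact: gA.
Qed.

Lemma cover_cost_neq0 A : cover_cost A !=set0.
Proof. by exists (L (fun=> 1)); apply: cover_cost_fun. Qed.

Lemma cover_inf_le_fun A g : {within K, continuous g} ->
  (forall x, K x -> 0 <= g x) -> (forall x, A x -> K x -> 1 <= g x) ->
  cover_inf A <= L g.
Proof. by move=> *; apply: (ge_inf (cover_cost_has_lb _)); exact: cover_cost_fun. Qed.

Lemma cover_inf_ge0 A : 0 <= cover_inf A.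
Proof. exact: lb_le_inf (cover_cost_neq0 A) (@cover_cost_lb A). Qed.

Lemma cover_inf0 : cover_inf set0 = 0.
Proof.
apply/eqP; rewrite eq_le cover_inf_ge0 andbT -L0.
exact: cover_inf_le_fun.
Qed.

Lemma le_cover_inf : {homo cover_inf : A B / A `<=` B >-> A <= B}.
Proof.
move=> A B AB; apply: lb_le_inf; first exact: cover_cost_neq0.
move=> c [F [cF F0 FL FB]]; apply: (ge_inf (cover_cost_has_lb _)).
by exists F; split => // x /AB; exact: FB.
Qed.

Let sum_within (F : nat -> nat -> 'rV[R]_n -> R) M N :
  (forall k N, {within K, continuous (F k N)}) ->
  {within K, continuous (fun x => \sum_(k < M) F k N x)} /\
  L (fun x => \sum_(k < M) F k N x) = \sum_(k < M) L (F k N).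
Proof.
move=> cF; elim: M => [|M [IH1 IH2]].
  rewrite big_ord0 (_ : (fun x => _) = fun=> 0) ?L0//.
  by apply/funext => x; rewrite big_ord0.
rewrite (_ : (fun x => _) = fun x => \sum_(k < M) F k N x + F M N x); last first.
  by apply/funext => x; rewrite big_ord_recr.
by split; [exact: withinD|rewrite LD// IH2 big_ord_recr].
Qed.

(** Covers of the [A k] with excess [e / 2^(k+1)] are merged diagonally: the [N]-th function adds
    the [N]-th functions of the first [N] covers. It is a finite sum, to which the additivity of [L]
    applies. *)
Lemma cover_inf_sigma_subadditive : sigma_subadditive (fun A => (cover_inf A)%:E).
Proof.
move=> A; set c := (\sum_(i <oo) _)%E; have [->|cy] := eqVneq c +oo%E.
  by rewrite leey.
have c0 : (0 <= c)%E by apply: nneseries_ge0 => k _ _; rewrite lee_fin cover_inf_ge0.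
have cfin : c \is a fin_num by rewrite ge0_fin_numE// ltey.
apply/lee_addgt0Pr => e e0; rewrite -(fineK cfin) -EFinD lee_fin.
have e2 k : 0 < e / (2 ^ k.+1)%:R by rewrite divr_gt0// ltr0n expn_gt0.
have adh k : exists d, exists F : nat -> 'rV[R]_n -> R,
    [/\ forall N, {within K, continuous (F N)},
      forall N x, K x -> 0 <= F N x <= F N.+1 x,
      forall N, L (F N) <= d &
      forall x, A k x -> K x -> exists N, 1 <= F N x] /\
    d < cover_inf (A k) + e / (2 ^ k.+1)%:R.
  have [d [F HF] dl] := inf_adherent (e2 k)
    (conj (cover_cost_neq0 (A k)) (@cover_cost_has_lb (A k))).
  by exists d, F.
have [d /choice-[F HF]] := choice adh.
have cF k N : {within K, continuous (F k N)} by have [[]] := HF k.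
have F0 k N x : K x -> 0 <= F k N x <= F k N.+1 x by have [[_ h _ _] _] := HF k; exact: h.
apply: (ge_inf (@cover_cost_has_lb _)).
exists (fun N x => \sum_(k < N) F k N x); split.
- by move=> N; have [] := sum_within N N cF.
- move=> N x Kx; rewrite sumr_ge0 => [/=|k _]; last by have /andP[] := F0 k N x Kx.
  rewrite big_ord_recr/= -[leLHS]addr0 lerD//.
    by apply: ler_sum => k _; have /andP[] := F0 k N x Kx.
  by have /andP[] := F0 N N.+1 x Kx.
- move=> N; have [_ ->] := sum_within N N cF.
  have : \sum_(k < N) L (F k N) <= \sum_(k < N) (cover_inf (A k) + e / (2 ^ k.+1)%:R).
    apply: ler_sum => k _; have [[_ _ /(_ N) h _] /ltW] := HF k.
    exact: le_trans.
  move=> /le_trans; apply; rewrite big_split/=; apply: lerD.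
    rewrite -lee_fin fineK// -sumEFin -(big_mkord xpredT (fun k => (cover_inf (A k))%:E)).
    by apply: nneseries_lim_ge => k _; rewrite lee_fin cover_inf_ge0.
  have -> : \sum_(k < N) e / (2 ^ k.+1)%:R = e * (1 - (2 ^ N)%:R^-1).
    elim: N => [|N IH]; first by rewrite big_ord0 expn0 invr1 subrr mulr0.
    rewrite big_ord_recr/= IH expnS natrM invfM.
    have : (2 ^ N)%:R != 0 :> R by rewrite pnatr_eq0 expn_eq0.
    by move=> ?; field.
  by rewrite ler_piMr ?ltW// ltrBlDr ltrDl invr_gt0 ltr0n expn_gt0.
- move=> x [k _ Akx] Kx; have [[_ _ _ /(_ x Akx Kx)[N FN]] _] := HF k.
  exists (maxn N k.+1); rewrite (bigD1 (Ordinal (leq_maxr N k.+1)))//=.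
  apply: le_trans (_ : _ <= F k (maxn N k.+1) x) _.
    apply: le_trans FN _; apply: (@cover_mono (F k)); last exact: leq_maxl.
    by move=> M; exact: F0.
  rewrite lerDl sumr_ge0// => j _; by have /andP[] := F0 j (maxn N k.+1) x Kx.
Qed.

(** The Carathéodory inequality for open sets. Functions [phi j] increase to the indicator of [G]. A
    cover [F] of [X] splits into the diagonal products [F N * phi N], covering the part in [G], and,
    for each fixed [j], the functions [F N * (1 - phi j)], covering the rest at cost at most
    [c - L (F j * phi j)]. Taking the supremum over [j] adds the two costs up to [c]. *)
Lemma cover_inf_open G X : open G ->
  cover_inf (X `&` G) + cover_inf (X `&` ~` G) <= cover_inf X.
Proof.
move=> oG; have [g [cg g0 gG]] := open_bump oG.
apply: lb_le_inf; first exact: cover_cost_neq0.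
move=> c [F [cF F0 FL FX]].
pose phi (j : nat) x := Num.min 1 (j%:R * g x).
have phi0 j x : 0 <= phi j x by rewrite le_min ler01 mulr_ge0.
have phi1 j x : phi j x <= 1 by rewrite ge_min lexx.
have phiS j x : phi j x <= phi j.+1 x.
  by rewrite le_min phi1/= ge_min; apply/orP; right; rewrite ler_wpM2r// ler_nat.
have cphi j : {within K, continuous (phi j)}.
  by apply: within_min => //; apply: withinZ; exact: continuous_subspaceT.
have phiG j x : ~ G x -> phi j x = 0.
  move=> /gG/negP; rewrite -leNgt => gx.
  have -> : phi j x = Num.min 1 0 by congr Num.min; apply/eqP; rewrite
    mulf_eq0; apply/orP; right; rewrite eq_le gx g0.
  by rewrite minEle ler10.
have phiE x : G x -> exists j, forall k, (j <= k)%N -> phi k x = 1.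
  move=> /gG gx; exists (Num.truncn (g x)^-1).+1 => k jk.
  rewrite /phi minEle ifT//.
  rewrite -ler_pdivrMr// mul1r ltW// (lt_le_trans (truncnS_gt _))// ler_nat.
  done.
pose H N x := F N x * phi N x.
have cH N : {within K, continuous (H N)} by exact: withinM.
have H0 N x : K x -> 0 <= H N x <= H N.+1 x.
  move=> Kx; have /andP[F1 F2] := F0 N x Kx.
  by rewrite mulr_ge0//= ler_pM.
have LH N : L (H N) <= c.
  apply: le_trans (FL N); apply: Lle => // x Kx.
  by have /andP[F1 F2] := F0 N x Kx; rewrite ler_piMr.
have part2 j : cover_inf (X `&` ~` G) <= c - L (H j).
  pose J N x := F N x * (1 + -1 * phi j x).
  have cJ N : {within K, continuous (J N)}.
    by apply: withinM => //; apply: withinD => //; exact: withinZ.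
  have psi0 x : 0 <= 1 + -1 * phi j x by rewrite mulN1r subr_ge0.
  have J0 N x : K x -> 0 <= J N x <= J N.+1 x.
    move=> Kx; have /andP[F1 F2] := F0 N x Kx.
    by rewrite mulr_ge0//= ler_wpM2r.
  apply: (ge_inf (cover_cost_has_lb _)); exists J; split => //.
    move=> N; apply: (@le_trans _ _ (L (J (maxn N j)))).
      apply: Lle => // x Kx; apply: (@cover_mono J); last exact: leq_maxl.
      by move=> M; exact: J0.
    have JE : L (J (maxn N j)) = L (F (maxn N j)) - L (fun x => F (maxn N j) x * phi j x).
      rewrite -mulN1r -LZ; last exact: withinM.
      rewrite -LD//; last by apply: withinZ; exact: withinM.
      by congr L; apply/funext => x; rewrite /J; ring.
    rewrite JE lerB//; apply: Lle => //; first exact: withinM.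
    move=> x Kx; rewrite ler_wpM2r//; apply: (@cover_mono F); last exact: leq_maxr.
    by move=> M; exact: F0.
  move=> x [Xx Gx] Kx; have [N FN] := FX x Xx Kx; exists N.
  by rewrite /J phiG// mulr0 addr0 mulr1.
pose a := sup (range (fun N => L (H N))).
have hs : has_sup (range (fun N => L (H N))).
  by split; [exists (L (H 0%N)), 0%N|exists c => _ [N _ <-]].
have part1 : cover_inf (X `&` G) <= a.
  apply: (ge_inf (cover_cost_has_lb _)); exists H; split => //.
    by move=> N; apply: ub_le_sup; [case: hs|exists N].
  move=> x [Xx Gx] Kx; have [N FN] := FX x Xx Kx; have [j jP] := phiE x Gx.
  exists (maxn N j); rewrite /H jP ?leq_maxr// mulr1 (le_trans FN)//.
  by apply: (@cover_mono F); [move=> M; exact: F0|exact: leq_maxl].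
apply: le_trans (lerD part1 (lexx _)) _; rewrite -lerBrDr.
apply: ge_sup; first by exists (L (H 0%N)), 0%N.
by move=> _ [N _ <-]; rewrite lerBrDr addrC -lerBrDr.
Qed.

(* By Dini, the partial covers of [A] exceed [g - e] uniformly on [K]. *)
Lemma le_cover_inf_fun A g : {within K, continuous g} ->
  (forall x, K x -> g x <= 1) -> (forall x, K x -> ~ A x -> g x <= 0) ->
  L g <= cover_inf A.
Proof.
move=> cg g1 gA; apply: lb_le_inf; first exact: cover_cost_neq0.
move=> c [F [cF F0 FL FA]].
have L1 : 0 <= L (fun=> 1) by apply: L_ge0.
suff H e : 0 < e -> L g <= c + e * L (fun=> 1).
  apply/ler_addgt0Pr => e e0.
  have d0 : 0 < L (fun=> 1) + 1 by rewrite ltr_wpDl.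
  apply: le_trans (H (e / (L (fun=> 1) + 1)) (divr_gt0 e0 d0)) _.
  rewrite lerD2l mulrAC ler_pdivrMr// ler_wpM2l ?(ltW e0)//.
  by rewrite lerDl.
move=> e0; suff [N gN] : exists N, forall x, K x -> g x <= F N x + e * 1.
  apply: (@le_trans _ _ (L (fun x => F N x + e * 1))).
    by apply: Lle => //; apply: withinD => //; exact: withinZ.
  by rewrite LD// (LZ e (f := fun=> 1))// lerD.
have : \forall N \near \oo, K `<=` [set x | K x -> g x <= F N x + e * 1].
  apply: ((compact_near_coveringP _).1 cK) => x Kx.
  have near_within f : {within K, continuous f} -> forall r, r < f x ->
      \forall y \near x, K y -> r < f y.
    move=> cf r rf; have /cvgr_gt/(_ _ rf) := (subspace_continuousP _ _).1 cf x Kx.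
    rewrite /prop_near1/= withinE => -[B nB BK].
    near=> y => Ky; have By : B y by near: y.
    by have : (B `&` K) y by []; rewrite -BK => -[].
  have [M Hx] : exists M, g x < F M x + e.
    have [Ax|nAx] := pselect (A x).
      have [M FM] := FA x Ax Kx; exists M.
      by have := g1 x Kx; lra.
    exists 0%N; have := gA x Kx nAx; have /andP[] := F0 0%N x Kx; lra.
  have cFg : {within K, continuous (fun y => (F M y + e) + -1 * g y)}.
    by apply: withinD; [exact: withinD|exact: withinZ].
  have := near_within _ cFg 0; rewrite mulN1r subr_gt0 => /(_ Hx) nx.
  exists ([set y | K y -> 0 < F M y + e + -1 * g y], [set N | (M <= N)%N]).
    by split => //=; exists M.
  move=> [y N] /= [h1 h2] Ky; have := h1 Ky.
  have := @cover_mono F y (fun k => F0 k y Ky) _ _ h2; lra.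
move=> H; near \oo => N; exists N => x Kx.
have HN : K `<=` [set x | K x -> g x <= F N x + e * 1] by near: N; exact: H.
exact: HN.
Unshelve. all: by end_near. Qed.

End riesz.

(** * Borel measurability and integrability of continuous functions on compact sets *)

Section borel_row_vectors.
Context {R : realType} {n : nat}.
Implicit Types (f g : 'rV[R]_n -> R) (K U : set 'rV[R]_n).

Lemma open_borel U : open U -> measurable (U : set (borelRn R n)).
Proof. exact: sub_sigma_algebra. Qed.

Lemma closed_borel K : closed K -> measurable (K : set (borelRn R n)).
Proof.
move=> cK; rewrite -(setCK (K : set (borelRn R n))).
by apply: measurableC; apply: open_borel; exact: closed_openC.
Qed.

Lemma compact_closed_rV K : compact K -> closed K.
Proof. by apply: compact_closed; exact: norm_hausdorff. Qed.

Lemma within_continuous_measurable K f : closed K -> {within K, continuous f} ->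
  measurable_fun (K : set (borelRn R n)) f.
Proof.
move=> clK /continuousP cf mK; apply: (measurability _ (RGenOpens.measurableE R)) => //.
move=> _ [_ [a [b ->] <-]].
have /cf/open_subspaceP[V oV VE] : open (`]a, b[%classic : set R) by exact: interval_open.
by rewrite setIC -VE; apply: measurableI => //; exact: open_borel.
Qed.

Lemma within_continuous_integrable K f
    (mu : {measure set (borelRn R n) -> \bar R}) : compact K ->
  (mu K < +oo)%E -> {within K, continuous f} ->
  mu.-integrable (K : set (borelRn R n)) (EFin \o f).
Proof.
move=> cK muK cf; have clK := compact_closed_rV cK.
apply: measurable_bounded_integrable => //; first exact: closed_borel.
  exact: within_continuous_measurable.
have [M M0 fM] := within_continuous_bounded cK cf.
by exists M; split; [exact: num_real|move=> r /ltW Mr x /fM /le_trans; exact].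
Qed.

End borel_row_vectors.

(** * The Borel measure representing a positive linear functional *)

Section riesz_measure.
Context {R : realType} {n : nat}.
Variable K : set 'rV[R]_n.
Hypothesis cK : compact K.
Variable L : ('rV[R]_n -> R) -> R.
Hypothesis LD : forall f g : 'rV[R]_n -> R, {within K, continuous f} -> {within K, continuous g} ->
  L (fun x => f x + g x) = L f + L g.
Hypothesis LZ : forall (c : R) (f : 'rV[R]_n -> R), {within K, continuous f} ->
  L (fun x => c * f x) = c * L f.
Hypothesis Lle : forall f g : 'rV[R]_n -> R, {within K, continuous f} -> {within K, continuous g} ->
  (forall x, K x -> f x <= g x) -> L f <= L g.
Implicit Types (f g : 'rV[R]_n -> R).

Let m (A : set 'rV[R]_n) : \bar R := (cover_inf K L A)%:E.

Let m0 : m set0 = 0%E.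
Proof. by rewrite /m cover_inf0. Qed.

Let m_ge0 A : (0 <= m A)%E.
Proof. by rewrite lee_fin; exact: cover_inf_ge0. Qed.

Let m_le : {homo m : A B / A `<=` B >-> (A <= B)%E}.
Proof. by move=> A B AB; rewrite lee_fin; exact: le_cover_inf. Qed.

Let m_sub : sigma_subadditive m.
Proof. exact: cover_inf_sigma_subadditive. Qed.

Let om : {outer_measure set 'rV[R]_n -> \bar R} :=
  HB.pack m (isOuterMeasure.Build R 'rV[R]_n m m0 m_ge0 m_le m_sub).

Let borel_cara (A : set (borelRn R n)) : measurable A -> om.-caratheodory A.
Proof.
apply: smallest_sub.
  exact: (@sigma_algebra_measurable _ (caratheodory_type om)).
move=> G oG; apply: le_caratheodory_measurable => X.
by rewrite /= /m -EFinD lee_fin; exact: cover_inf_open.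
Qed.

Let m_additive : semi_sigma_additive (m : set (borelRn R n) -> \bar R).
Proof.
move=> F mF tF mU; apply: (@caratheodory_measure_sigma_additive _ _ om) => //.
  by move=> i; exact: borel_cara.
exact: borel_cara.
Qed.

Let mu : {measure set (borelRn R n) -> \bar R} :=
  HB.pack (m : set (borelRn R n) -> \bar R)
    (isMeasure.Build _ (borelRn R n) R m m0 m_ge0 m_additive).

Let clK : closed K := compact_closed_rV cK.
Let mK : measurable (K : set (borelRn R n)) := closed_borel clK.

Let LE1 : mu K = (L (fun=> 1))%:E.
Proof.
rewrite /= /m; congr EFin; apply/eqP; rewrite eq_le.
rewrite (@cover_inf_le_fun _ _ _ _ LZ Lle _ (fun=> 1))//=; last first.
  by move=> x; exact: cvg_cst.
by apply: le_cover_inf_fun => //; move=> x; exact: cvg_cst.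
Qed.

(* [f] is cut into the slices [clamp (f - i/N) 0 1/N], each lying between the
   indicators of [f > (i+1)/N] and [f > i/N] divided by [N]. *)
Let integral_le f : {within K, continuous f} -> (forall x, K x -> 0 <= f x <= 1) ->
  (\int[mu]_(x in (K : set (borelRn R n))) (f x)%:E <= (L f)%:E)%E.
Proof.
move=> cf f01; apply/lee_addgt0Pr => e e0.
have L1 : 0 <= L (fun=> 1) by rewrite -lee_fin -LE1.
have [N hN] : exists N : nat, N.+1%:R^-1 * L (fun=> 1) <= e.
  exists (Num.truncn (L (fun=> 1) / e)).
  rewrite mulrC ler_pdivrMr// mulrC -ler_pdivrMr//.
  by rewrite ltW// truncnS_gt.
set h : R := N.+1%:R^-1 in hN; have h0 : 0 < h by rewrite invr_gt0 ltr0n.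
pose slice (i : nat) x := Num.min h (Num.max 0 (f x + -1 * (i%:R * h))).
have cs i : {within K, continuous (slice i)}.
  apply: (@within_min _ _ K (fun=> h)); first exact: within_cst.
  apply: (@within_max _ _ K (fun=> 0)); first exact: within_cst.
  by apply: withinD => //; exact: within_cst.
have s0 i x : 0 <= slice i x by rewrite le_min (ltW h0)/= le_max lexx.
have ssum k x : 0 <= f x -> \sum_(i < k) slice i x = Num.min (k%:R * h) (f x).
  move=> f0; elim: k => [|k IH]; first by rewrite big_ord0 mul0r minEle f0.
  rewrite big_ord_recr/= IH -natr1 /slice.
  have kh : 0 <= k%:R * h by rewrite mulr_ge0// ltW.
  rewrite mulrDl mul1r; move: (k%:R * h) kh => t t0.
  by case: (leP t (f x)) => ?; case: (leP (t + h) (f x)) => ?;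
    case: (leP 0 (f x + -1 * t)) => ?; rewrite minEle;
    case: ifP => [|/negbT]; rewrite -?ltNge; lra.
have fE x : K x -> f x = \sum_(i < N.+1) slice i x.
  move=> /f01/andP[f0 f1]; rewrite ssum// /h mulfV ?pnatr_eq0//.
  by rewrite minElt ltNge f1.
have LfE : L f = \sum_(i < N.+1) L (slice i).
  have Lsum k : {within K, continuous (fun x => \sum_(i < k) slice i x)} /\
      L (fun x => \sum_(i < k) slice i x) = \sum_(i < k) L (slice i).
    elim: k => [|k [IH1 IH2]].
      rewrite big_ord0 (_ : (fun x => _) = fun=> 0 : R); last first.
        by apply/funext => x; rewrite big_ord0.
      split; first exact: within_cst.
      by have := LZ 0 (@within_cst R n K 1); rewrite !mul0r.
    rewrite (_ : (fun x => _) = fun x => \sum_(i < k) slice i x + slice k x); last first.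
      by apply/funext => x; rewrite big_ord_recr.
    by split; [exact: withinD|rewrite LD// IH2 big_ord_recr].
  have [cS <-] := Lsum N.+1.
  by apply/eqP; rewrite eq_le !Lle// => x /fE ->.
pose A (i : nat) : set (borelRn R n) := K `&` [set x | i%:R * h < f x].
have mA i : measurable (A i).
  have := within_continuous_measurable clK cf mK (measurable_itv `](i%:R * h), +oo[).
  rewrite (_ : K `&` _ = A i)//.
  by apply/seteqP; split => x [Kx]; rewrite /= in_itv/= andbT.
have mus i : (\int[mu]_(x in (K : set (borelRn R n))) (slice i x)%:E <= h%:E * mu (A i))%E.
  have -> : (h%:E * mu (A i) = \int[mu]_(x in (K : set (borelRn R n))) (h * \1_(A i) x)%:E)%E.
    rewrite (@integralZl_indic _ _ _ _ _ mK (fun=> A i))//; last by rewrite ltNge ltW.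
    by rewrite integral_indic//; congr (_ * mu _)%E; apply/esym/setIidPl => x [].
  apply: ge0_le_integral => //.
  - by move=> x _; rewrite lee_fin.
  - by apply/measurable_EFinP; exact: within_continuous_measurable.
  - by apply/measurable_EFinP; apply: measurable_funM => //; exact: measurable_indic.
  - move=> x Kx; rewrite lee_fin indicE.
    have [fx|fx] := ltP (i%:R * h) (f x).
      by rewrite mem_set// mulr1 ge_min lexx.
    rewrite memNset ?mulr0; last by move=> [_]; rewrite /= ltNge fx.
    rewrite ge_min; apply/orP; right; rewrite ge_max lexx/=; lra.
have muA i : (h%:E * mu (A i.+1) <= (L (slice i))%:E)%E.
  rewrite [mu _]/= /m -EFinM lee_fin mulrC -ler_pdivlMr// mulrC -LZ//.
  apply: (cover_inf_le_fun LZ Lle); first exact: withinZ.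
    by move=> x _; rewrite mulr_ge0// invr_ge0 ltW.
  move=> x [_] /= fx _; rewrite -(mulVf (lt0r_neq0 h0)) ler_wpM2l ?invr_ge0 ?(ltW h0)//.
  rewrite le_min lexx/= le_max; apply/orP; right.
  by move: fx; rewrite -natr1 mulrDl mul1r; lra.
have muA0 : (h%:E * mu (A 0%N) <= (h * L (fun=> 1))%:E)%E.
  rewrite EFinM -LE1; apply: lee_wpmul2l; first by rewrite lee_fin ltW.
  by apply: le_measure => //; rewrite ?inE// => x [].
have -> : (\int[mu]_(x in (K : set (borelRn R n))) (f x)%:E =
    \sum_(i < N.+1) \int[mu]_(x in (K : set (borelRn R n))) (slice i x)%:E)%E.
  rewrite -ge0_integral_sum//; first by
    apply: eq_integral => x /set_mem/fE ->; rewrite sumEFin.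
  - by move=> i; apply/measurable_EFinP; exact: within_continuous_measurable.
  - by move=> i x _; rewrite lee_fin.
apply: (@le_trans _ _ (\sum_(i < N.+1) h%:E * mu (A i))%E).
  by apply: lee_sum => i _; exact: mus.
(* The upper estimate of slice [i + 1] uses the same set as the lower estimate of slice [i].
   Shifting the index leaves over the term of [A 0], which is at most [h * L 1 <= e]. *)
rewrite big_ord_recl LfE big_ord_recr/= addeC EFinD leeD//.
  rewrite -sumEFin; apply: (@le_trans _ _ (\sum_(i < N) (L (slice i))%:E)%E).
    by apply: lee_sum => i _; exact: muA.
  rewrite leeDl// lee_fin.
  rewrite (_ : 0 = L (fun=> 0)); last by
    have := LZ 0 (@within_cst R n K 1); rewrite !mul0r.
  by apply: Lle => [||x _]; [exact: within_cst|exact: cs|exact: s0].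
by apply: le_trans muA0 _; rewrite lee_fin.
Qed.

(** The one-sided estimate [integral_le], applied to [f] and to [1 - f], becomes an equality because
    the total mass is exactly [L 1]. General [f] are brought into [0, 1] by an affine change. *)
Lemma riesz : exists mu : {measure set (borelRn R n) -> \bar R},
  forall f, {within K, continuous f} ->
  (\int[mu]_(x in (K : set (borelRn R n))) (f x)%:E)%E = (L f)%:E.
Proof.
exists mu.
have muK : (mu K < +oo)%E by rewrite LE1 ltry.
have int1 (c : R) : (\int[mu]_(x in (K : set (borelRn R n))) c%:E = c%:E * (L (fun=> 1))%:E)%E.
  by rewrite integral_cst// LE1.
have unit f : {within K, continuous f} -> (forall x, K x -> 0 <= f x <= 1) ->
    (\int[mu]_(x in (K : set (borelRn R n))) (f x)%:E = (L f)%:E)%E.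
  move=> cf f01; have cg : {within K, continuous (fun x => 1 + -1 * f x)}.
    by apply: withinD; [exact: within_cst|exact: withinZ].
  have If := within_continuous_integrable cK muK cf.
  have Ig := within_continuous_integrable cK muK cg.
  have le1 := integral_le cf f01.
  have le2 : (\int[mu]_(x in (K : set (borelRn R n))) (1 + -1 * f x)%:E <=
      (L (fun x => 1 + -1 * f x))%:E)%E.
    by apply: integral_le => // x /f01/andP[]; lra.
  have := int1 1; rewrite mul1e.
  have -> : (\int[mu]_(x in (K : set (borelRn R n))) 1%:E =
      \int[mu]_(x in (K : set (borelRn R n))) (f x)%:E +
      \int[mu]_(x in (K : set (borelRn R n))) (1 + -1 * f x)%:E)%E.
    rewrite -integralD_EFin//; apply: eq_integral => x _ /=.
    by rewrite -EFinD; congr EFin; ring.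
  move: le1 le2; rewrite LD; [|exact: within_cst|exact: withinZ].
  rewrite LZ//.
  have fI : (\int[mu]_(x in (K : set (borelRn R n))) (f x)%:E)%E \is a fin_num.
    exact: (integrable_fin_num mK If).
  have gI : (\int[mu]_(x in (K : set (borelRn R n))) (1 + -1 * f x)%:E)%E \is a fin_num.
    exact: (integrable_fin_num mK Ig).
  rewrite -(fineK fI) -(fineK gI) !lee_fin -EFinD => h1 h2 h3.
  by have {}h3 := EFin_inj h3; congr EFin; lra.
move=> f cf; have [M M0 fM] := within_continuous_bounded cK cf.
pose g x := (2 * M)^-1 * (f x + M).
have M2 : 0 < 2 * M by rewrite mulr_gt0.
have cg : {within K, continuous g} by apply: withinZ; apply: withinD => //; exact: within_cst.
have fE x : f x = 2 * M * g x + - M.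
  by rewrite /g mulVKf ?gt_eqF// addrK.
have g01 x : K x -> 0 <= g x <= 1.
  move=> /fM; rewrite ler_norml => /andP[h1 h2].
  rewrite /g mulrC ler_pdivrMr// mul1r divr_ge0/=; lra.
have -> : f = fun x => 2 * M * g x + - M by apply/funext.
rewrite LD; [|exact: withinZ|exact: within_cst].
rewrite LZ// (_ : L (fun=> - M) = - M * L (fun=> 1)); last first.
  by rewrite -LZ; [congr L; apply/funext => x; rewrite mulr1|exact: within_cst].
have Ig := within_continuous_integrable cK muK cg.
have I2g := within_continuous_integrable cK muK (@withinZ R n K (2 * M) g cg).
have IM := within_continuous_integrable cK muK (@within_cst R n K (- M)).
transitivity (\int[mu]_(x in (K : set (borelRn R n)))
    ((EFin \o (fun x => 2 * M * g x)%R) \+ (EFin \o (fun=> - M)%R)) x)%E.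
  by apply: eq_integral.
rewrite (integralD_EFin mK I2g IM)/= int1.
have -> : (\int[mu]_(x in (K : set (borelRn R n))) (2 * M * g x)%:E =
    (2 * M)%:E * (L g)%:E)%E.
  by rewrite -unit// -integralZl//; apply: eq_integral.
by rewrite -!EFinM -EFinD.
Qed.

End riesz_measure.

(** * Harmonic measures of ellipsoids *)

Lemma convex_connected (R : realType) (n : nat) (A : set 'rV[R]_n) :
  (forall x y t, A x -> A y -> 0 <= t <= 1 -> A (t *: (y - x) + x)) -> connected A.
Proof.
move=> cA; have [[x0 Ax0]|A0] := pselect (A !=set0); last first.
  rewrite (_ : A = set0); first exact: connected0.
  by apply/seteqP; split => // x Ax; apply: A0; exists x.
pose seg y : set 'rV[R]_n := (fun t : R => t *: (y - x0) + x0) @` `[0, 1]%classic.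
have -> : A = \bigcup_(y in A) seg y.
  apply/seteqP; split => [y Ay|_ [y Ay [t /= t01 <-]]].
    exists y => //; exists 1; last by rewrite scale1r subrK.
    by rewrite /= in_itv/= ler01 lexx.
  by apply: cA => //; move: t01; rewrite in_itv.
apply: bigcup_connected.
  exists x0 => y Ay; exists 0; last by rewrite scale0r add0r.
  by rewrite /= in_itv/= ler01 lexx.
move=> y Ay; apply: connected_continuous_connected; first exact: segment_connected.
apply: continuous_subspaceT => t; apply: cvgD; last exact: cvg_cst.
by apply: cvgZr_tmp; exact: cvg_id.
Qed.

Section harmonic_measure_existence.
Context {R : realType} {n : nat}.
Variables (rho : 'rV[R]_n -> R) (xi : 'rV[R]_n).
Let D : set 'rV[R]_n := [set x | rho x < 0].
Hypotheses (n0 : (0 < n)%N) (prho : polyfun 3 rho) (bD : bounded_set D) (Dxi : D xi).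
Implicit Types (f g h : 'rV[R]_n -> R).

Definition harmonic_poly (E : set 'rV[R]_n) h : Prop :=
  (exists k, polyfun k h) /\ forall x, E x -> laplacian h x = 0.

Lemma harmonic_poly_on E h : harmonic_poly E h -> harmonic_on E h.
Proof. by move=> [[k ph] lh]; split => //; exact: polyfun_C2 ph. Qed.

Lemma harmonic_poly_cst E c : harmonic_poly E (fun=> c).
Proof.
by split=> [|x _]; [exists 1%N; exact: polyfunC|rewrite laplacian_cst].
Qed.

Lemma harmonic_polyD E g h : harmonic_poly E g -> harmonic_poly E h ->
  harmonic_poly E (fun x => g x + h x).
Proof.
move=> [[k pg] lg] [[l ph] lh]; split.
  exists (k + l)%N; apply: polyfunD; first exact: polyfun_leq (leq_addr _ _) pg.
  exact: polyfun_leq (leq_addl _ _) ph.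
by move=> x Ex; rewrite (laplacian_polyfunD pg ph) lg// lh// addr0.
Qed.

Lemma harmonic_polyZ E c h : harmonic_poly E h -> harmonic_poly E (fun x => c * h x).
Proof.
move=> [[k ph] lh]; split; first by exists k; exact: polyfunZ.
by move=> x Ex; rewrite (laplacian_polyfunZ c ph) lh// mulr0.
Qed.

Let crho : continuous rho := polyfun_continuous prho.
Let oD : open D := @sublevel_open R n rho 0 crho.

(** [h + e] belongs to the upper class of [f], and [h - e] lies below every member of it by
    [upper_PWB_ge]. *)
Lemma harmonic_poly_PWB f h e : harmonic_poly D h ->
  (forall y, bdry D y -> `|f y - h y| <= e) ->
  upper_PWB D f xi \is a fin_num /\ `|fine (upper_PWB D f xi) - h xi| <= e.
Proof.
move=> hh fh.
have c h' : harmonic_poly D h' -> continuous h'.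
  by move=> [[k ph] _]; exact: polyfun_continuous ph.
have hp := harmonic_polyD hh (harmonic_poly_cst D e).
have hm := harmonic_polyD hh (harmonic_poly_cst D (- e)).
have ub : (upper_PWB D f xi <= (h xi + e)%:E)%E.
  apply: (@upper_PWB_le _ _ _ (fun y => h y + e)) => //; first by exists xi.
  - by move=> x _; exact: (c _ hp).
  - move=> x Dx; case: hp => -[k ph] lh.
    by apply: touched_above_jet (jet2_C2 oD (polyfun_C2 _ ph) Dx) _; rewrite -/(laplacian _ _) lh.
  - by move=> y /fh; rewrite ler_norml => /andP[_]; lra.
have lb : ((h xi - e)%:E <= upper_PWB D f xi)%E.
  apply: (@upper_PWB_ge _ _ rho (fun y => h y + - e) f xi crho bD Dxi (c _ hm)
    (harmonic_poly_on hm)).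
  by move=> y /fh; rewrite ler_norml => /andP[+ _]; lra.
have fin : upper_PWB D f xi \is a fin_num.
  by rewrite fin_numE; apply/andP; split; apply/eqP => E; move: lb ub; rewrite E.
split => //; rewrite -(fineK fin) !lee_fin in ub lb.
by rewrite ler_norml; apply/andP; split; lra.
Qed.

Lemma bdry_compact : compact (bdry D).
Proof.
apply: (subclosed_compact _ (compact_closure bD)); last exact: bdry_closure.
apply: closedI; first exact: closed_closure.
exact: open_closedC.
Qed.

Lemma harmonic_poly_approx f e : {within bdry D, continuous f} -> 0 < e ->
  exists2 h, harmonic_poly D h & forall y, bdry D y -> `|f y - h y| <= e.
Proof.
move=> cf e0; have [k [q [pq fq]]] := continuous_poly_approx bdry_compact cf e0.
have [h [l [ph [_ lh] hq]]] := dirichlet_polyfun n0 prho bD pq.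
exists h; first by split=> //; exists l.
by move=> y by0; rewrite hq; [exact: fq|exact: (sublevel_bdry crho by0)].
Qed.

(** An upper Perron solution is not visibly additive in its data. Here, however, its value at [xi]
    is, up to any error, the value of a harmonic polynomial close to the data on the boundary, so
    linearity passes to the limit and the representation theorem applies. *)
Theorem harmonic_measure_exists : exists mu : {measure set (borelRn R n) -> \bar R},
  harmonic_measure D xi mu.
Proof.
pose L f := fine (upper_PWB D f xi).
have small (r : R) (c : R) : 0 <= c -> (forall e, 0 < e -> `|r| <= c * e) -> r = 0.
  move=> c0 H; apply/normr0_eq0/eqP; rewrite eq_le normr_ge0 andbT.
  apply/ler_addgt0Pr => e e0; rewrite add0r.
  have c1 : 0 < c + 1 by rewrite ltr_wpDl.
  apply: le_trans (H (e / (c + 1)) (divr_gt0 e0 c1)) _.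
  by rewrite mulrCA ler_piMr ?(ltW e0)// ler_pdivrMr// mul1r lerDl.
have LD f g : {within bdry D, continuous f} -> {within bdry D, continuous g} ->
    L (fun x => f x + g x) = L f + L g.
  move=> cf cg; apply/eqP; rewrite -subr_eq0; apply/eqP.
  apply: (small _ 4) => // e e0.
  have [h hh fh] := harmonic_poly_approx cf e0.
  have [k hk gk] := harmonic_poly_approx cg e0.
  have [_] := harmonic_poly_PWB hh fh; have [_] := harmonic_poly_PWB hk gk.
  have [|_] := @harmonic_poly_PWB (fun x => f x + g x) _ (2 * e) (harmonic_polyD hh hk).
    move=> y by0; rewrite opprD addrACA (le_trans (ler_normD _ _))//.
    by have := fh y by0; have := gk y by0; lra.
  rewrite -/(L _) -/(L f) -/(L g) !ler_norml => /andP[? ?] /andP[? ?] /andP[? ?].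
  by apply/andP; split; lra.
have LZ (c : R) f : {within bdry D, continuous f} -> L (fun x => c * f x) = c * L f.
  move=> cf; apply/eqP; rewrite -subr_eq0; apply/eqP.
  apply: (small _ (2 * `|c|)); first by rewrite mulr_ge0.
  move=> e e0; have [h hh fh] := harmonic_poly_approx cf e0.
  have [_ H1] := harmonic_poly_PWB hh fh.
  have [|_ H2] := @harmonic_poly_PWB (fun x => c * f x) _ (`|c| * e) (harmonic_polyZ c hh).
    by move=> y by0; rewrite -mulrBr normrM ler_wpM2l// fh.
  rewrite (_ : _ - _ = (L (fun x => c * f x) - c * h xi) - c * (L f - h xi)); last first.
    by rewrite /L; ring.
  rewrite (le_trans (ler_normB _ _))// normrM mulr2n mulrDl mul1r mulrDl lerD//.
  by rewrite ler_wpM2l.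
have Lle f g : {within bdry D, continuous f} -> {within bdry D, continuous g} ->
    (forall x, bdry D x -> f x <= g x) -> L f <= L g.
  move=> cf cg fg; apply: fine_le; last exact: le_upper_PWB.
    have [h hh fh] := harmonic_poly_approx cf ltr01.
    by have [] := harmonic_poly_PWB hh fh.
  have [h hh gh] := harmonic_poly_approx cg ltr01.
  by have [] := harmonic_poly_PWB hh gh.
have [mu muE] := riesz bdry_compact LD LZ Lle.
exists mu => f cf; rewrite muE// fineK//.
have [h hh fh] := harmonic_poly_approx cf ltr01.
by have [] := harmonic_poly_PWB hh fh.
Qed.

Lemma harmonic_measure_poly h (mu : {measure set (borelRn R n) -> \bar R}) :
  harmonic_measure D xi mu -> harmonic_poly D h ->
  (\int[mu]_(x in (bdry D : set (borelRn R n))) (h x)%:E)%E = (h xi)%:E.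
Proof.
move=> hmu hh; rewrite hmu; last first.
  by have [[k ph] _] := hh; exact: polyfun_within ph.
have [|fin] := @harmonic_poly_PWB h h 0 hh.
  by move=> y _; rewrite subrr normr0.
by rewrite normr_le0 subr_eq0 => /eqP <-; rewrite fineK.
Qed.

End harmonic_measure_existence.

(** * Ellipsoids as admissible subdomains *)

Section ellipsoid.
Context {R : realType} {n : nat}.
Variables (c w : 'rV[R]_n).
Hypothesis w0 : forall i, 0 < w 0 i.

Definition ellipsoid_fun (x : 'rV[R]_n) : R :=
  \sum_i w 0 i * (x 0 i - c 0 i) ^+ 2 + -1.

Lemma polyfun_ellipsoid : polyfun 3 ellipsoid_fun.
Proof.
apply: polyfunD; last exact: polyfunC.
apply: polyfun_sum => i; apply: polyfunZ.
have H := polyfunD (polyfun_coord i) (polyfunC 1 (- c 0 i)).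
by apply: polyfun_ext (polyfunM H H) => x; rewrite expr2.
Qed.

Lemma ellipsoid_coord x i : ellipsoid_fun x <= 0 -> w 0 i * (x 0 i - c 0 i) ^+ 2 <= 1.
Proof.
rewrite subr_le0 (bigD1 i)//=; apply: le_trans; rewrite lerDl.
by apply: sumr_ge0 => j _; rewrite mulr_ge0 ?sqr_ge0// ltW.
Qed.

Lemma ellipsoid_bounded : bounded_set [set x | ellipsoid_fun x < 0].
Proof.
apply/bounded_setP; exists (\sum_i (`|c 0 i| + 1 + (w 0 i)^-1)) => x /= /ltW Ex.
have [->|x0] := eqVneq x 0.
  rewrite normr0; apply: sumr_ge0 => i _.
  by rewrite !addr_ge0// invr_ge0 ltW.
have [] := @mx_norm_neq0 _ 1 n x; first by rewrite -[mx_norm x]/`|x| normr_eq0.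
move=> [i j] /= xE; rewrite -[`|x|]/(mx_norm x) xE ord1.
rewrite (bigD1 j)//= ler_wpDr//.
  by apply: sumr_ge0 => k _; rewrite !addr_ge0// invr_ge0 ltW.
have := ellipsoid_coord j Ex.
rewrite mulrC -ler_pdivlMr// mul1r; set d := x 0 j - c 0 j => d2.
have -> : x 0 j = c 0 j + d by rewrite /d addrC subrK.
rewrite (le_trans (ler_normD _ _))// -addrA lerD2l.
have iw : 0 < (w 0 j)^-1 by rewrite invr_gt0.
have : `|d| ^+ 2 <= (w 0 j)^-1 by rewrite real_normK ?num_real.
have := normr_ge0 d; move: `|d| => t; nra.
Qed.

Lemma ellipsoid_connected : connected [set x | ellipsoid_fun x < 0].
Proof.
apply: convex_connected => x y t /= Ex Ey /andP[t0 t1].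
apply: (@le_lt_trans _ _ ((1 - t) * ellipsoid_fun x + t * ellipsoid_fun y)).
  rewrite /ellipsoid_fun !mulrDr !mulr_sumr addrACA -big_split/=.
  apply: lerD; last lra.
  apply: ler_sum => i _; rewrite !mxE.
  move: (x 0 i) (y 0 i) (c 0 i) (w 0 i) (w0 i) => a b d v v0.
  rewrite -subr_ge0.
  rewrite (_ : _ - _ = v * (t * (1 - t) * (a - b) ^+ 2)); last by ring.
  by rewrite mulr_ge0 ?(ltW v0)// mulr_ge0 ?sqr_ge0// mulr_ge0// subr_ge0.
have [->|tn0] := eqVneq t 0; first by rewrite subr0 mul1r mul0r addr0.
have tp : 0 < t by rewrite lt_neqAle eq_sym tn0.
nra.
Qed.

Lemma ellipsoid_closure : closure [set x | ellipsoid_fun x < 0] `<=`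
  [set x | ellipsoid_fun x <= 0].
Proof. exact: (sublevel_closure (polyfun_continuous polyfun_ellipsoid)). Qed.

Lemma ellipsoid_admissible (E : set 'rV[R]_n) xi : ellipsoid_fun xi < 0 ->
  [set x | ellipsoid_fun x <= 0] `<=` E ->
  admissible E xi [set x | ellipsoid_fun x < 0].
Proof.
move=> Exi EE; split => //.
- split; last exact: ellipsoid_connected.
  exact: (sublevel_open (polyfun_continuous polyfun_ellipsoid)).
- exact: ellipsoid_bounded.
- by move=> x /ellipsoid_closure; exact: EE.
Qed.

End ellipsoid.

(** * Special functions *)

Section bernoulli.
Context {R : realType}.

(** Young's inequality for the product of [x] and 1. *)
Lemma bernoulli_powR (x q : R) : 0 <= x -> 1 < q -> 1 + q * (x - 1) <= x `^ q.
Proof.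
move=> x0 q1; have q0 : 0 < q by lra.
have c0 : 0 < 1 - q^-1 by rewrite subr_gt0 invf_lt1.
have := @conjugate_powR R x 1 q (1 - q^-1)^-1 x0 ler01.
rewrite q0 invr_gt0 c0 invrK addrC subrK powR1 mulr1 mul1r => /(_ isT isT erefl).
rewrite -(ler_pM2l q0) mulrDr mulrCA divff ?gt_eqF// mulr1 mulrBr mulr1 divff ?gt_eqF//.
lra.
Qed.

Lemma concave_powR (x p : R) : 0 <= x -> 0 < p < 1 -> x `^ p <= 1 + p * (x - 1).
Proof.
move=> x0 /andP[p0 p1].
have := bernoulli_powR (powR_ge0 x p) (_ : 1 < p^-1).
rewrite invf_gt1// p1 -powRrM divff ?gt_eqF// powRr1// => /(_ isT).
rewrite -(ler_pM2l p0) mulrDr mulrA divff ?gt_eqF//; lra.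
Qed.

End bernoulli.

(** * The Burkholder function for p > 2 *)

Section special_function.
Context {R : realType}.
Variable p : R.
Hypothesis p2 : 2 < p.
Implicit Types u y t : R.

Let a : R := p ^+ 2 / 4.
Let b : R := (p - 2) / p.
Let c : R := p * (p - 2) / (2 * (p - 1)).
Let K : R := (p / 2) `^ p / (p - 1).

Let p0 : 0 < p. Proof. by move: p2 => ?; lra. Qed.
Let p1 : 0 < p - 1. Proof. by move: p2 => ?; lra. Qed.
Let a0 : 0 < a. Proof. by rewrite divr_gt0// exprn_gt0. Qed.
Let p_2 : 0 < p - 2. Proof. by rewrite subr_gt0. Qed.
Let b0 : 0 < b. Proof. by rewrite divr_gt0. Qed.
Let pb : p * b = p - 2. Proof. by rewrite mulrC divfK// gt_eqF. Qed.
Let c_p1 : (p - 1) * c = p * (p - 2) / 2.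
Proof. by rewrite /c; field; rewrite gt_eqF. Qed.
Let c_le : c <= p - 2.
Proof.
rewrite -(ler_pM2l p1) c_p1 -subr_ge0 (_ : _ - _ = (p - 2) ^+ 2 / 2); last by field.
by rewrite divr_ge0 ?sqr_ge0.
Qed.
Let c0 : 0 < c.
Proof. by rewrite divr_gt0// mulr_gt0. Qed.

(* For fixed [t], [layer] is a difference of squares plus a multiple of [u], which
   differential subordination makes superharmonic; [special] takes for [t] the
   larger critical point, a local minimum, cut off at [1]. *)
Definition layer u y t : R :=
  a * t `^ (p - 2) * ((y - b * t) ^+ 2 - u ^+ 2) + c * t `^ (p - 1) * u.

Lemma powR_derive (q t : R) : 0 < t ->
  is_derive t 1 (fun s : R => s `^ q) (q * t `^ (q - 1)).
Proof.
move=> t0; have tI : t \in `]0, +oo[ by rewrite in_itv/= t0.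
apply: DeriveDef; first exact: derivable_powR.
by rewrite -derive1E powR_derive1.
Qed.

Lemma powR_mul (t q r : R) : 0 < t -> t `^ (q + r) = t `^ q * t `^ r.
Proof. by move=> t0; rewrite powRD// (gt_eqF t0) implybT. Qed.

(* The two critical points of [layer u y] are [u + y] and [(y - u) / b]. *)
Lemma layer_derive u y t : 0 < t -> is_derive t 1 (layer u y)
  (p * a * b ^+ 2 * t `^ (p - 3) * ((t - (u + y)) * (t - (y - u) / b))).
Proof.
move=> t0.
have d2 := powR_derive (p - 2) t0; have d1 := powR_derive (p - 1) t0.
have d0 : is_derive t 1 (cst y + - b *: (id : R -> R)) (0 + - b *: (1 : R)).
  exact: is_deriveD (is_derive_cst y t 1) (is_deriveZ (- b) (is_derive_id t 1)).
have dq := is_deriveB (is_deriveX 2 d0) (is_derive_cst (u ^+ 2) t 1).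
have := is_deriveD (is_deriveM (is_deriveZ a d2) dq)
  (is_deriveM (is_deriveZ c d1) (is_derive_cst u t 1)).
rewrite [X in is_derive _ _ X _](_ : _ = layer u y); last first.
  apply/funext => s; rewrite /layer.
  by rewrite !fctE /= /GRing.scale/=; ring.
move=> H; apply: (is_derive_eq H); rewrite !fctE /= /GRing.scale/=.
have F1 : p - 2 - 1 = p - 3 by ring.
have F2 : p - 1 - 1 = p - 2 by ring.
have F3 : p - 2 = p - 3 + 1 by ring.
have F4 : p - 1 = p - 2 + 1 by ring.
have E2 : t `^ (p - 2) = t `^ (p - 3) * t by rewrite F3 powR_mul// powRr1// ltW.
have E1 : t `^ (p - 1) = t `^ (p - 3) * t * t.
  by rewrite F4 powR_mul// E2 powRr1// ltW.
rewrite F1 F2 E1 E2; move: (t `^ (p - 3)) => T.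
rewrite /a /b /c; field.
by rewrite !gt_eqF.
Qed.

Lemma layer_MVT u y t1 t2 : 0 < t1 -> t1 < t2 -> exists2 t, t1 < t < t2 &
  layer u y t2 - layer u y t1 =
  p * a * b ^+ 2 * t `^ (p - 3) * ((t - (u + y)) * (t - (y - u) / b)) * (t2 - t1).
Proof.
move=> t10 t12.
pose df t := p * a * b ^+ 2 * t `^ (p - 3) * ((t - (u + y)) * (t - (y - u) / b)).
have [||t] := @MVT R (layer u y) df t1 t2 t12.
- move=> t; rewrite in_itv/= => /andP[t1t _].
  exact: (layer_derive u y (lt_trans t10 t1t)).
- apply: derivable_within_continuous => t; rewrite in_itv/= => /andP[t1t _].
  by have [] := layer_derive u y (lt_le_trans t10 t1t).
- by rewrite in_itv/= => tI tE; exists t.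
Qed.

Definition apex u y : R := Num.max (u + y) ((y - u) / b).
Definition level u y : R := Num.min 1 (apex u y).
Definition special u y : R := layer u y (level u y).

Lemma apex_gt0 u y : 0 < u -> 0 <= y -> 0 < apex u y.
Proof. by move=> u0 y0; rewrite lt_max ltr_wpDr. Qed.

Lemma level_gt0 u y : 0 < u -> 0 <= y -> 0 < level u y.
Proof. by move=> u0 y0; rewrite lt_min ltr01/= apex_gt0. Qed.

Lemma apex_lip u y u0 y0 :
  apex u y - apex u0 y0 <= (1 + b^-1) * (`|u - u0| + `|y - y0|).
Proof.
have ib : 0 < b^-1 by rewrite invr_gt0.
have := ler_norm (u - u0); have := ler_norm (y - y0).
have := ler_norm (- (u - u0)); rewrite normrN => h1 h2 h3.
have n1 := normr_ge0 (u - u0); have n2 := normr_ge0 (y - y0).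
rewrite lerBlDr ge_max; apply/andP; split.
  have : u0 + y0 <= apex u0 y0 by rewrite le_max lexx.
  nra.
have : (y0 - u0) / b <= apex u0 y0 by rewrite le_max lexx orbT.
move: (apex u0 y0) (b^-1) ib => m i i0; nra.
Qed.

Let C : R := p * a * b ^+ 2.
Let C_gt0 : 0 < C.
Proof. exact: (mulr_gt0 (mulr_gt0 p0 a0) (exprn_gt0 2 b0)). Qed.
Let CT_ge0 t : 0 <= p * a * b ^+ 2 * t `^ (p - 3).
Proof. exact: (mulr_ge0 (ltW C_gt0) (powR_ge0 _ _)). Qed.

Lemma layer_le_right u y t1 t2 : 0 < t1 -> t1 <= t2 ->
  apex u y <= t1 -> layer u y t1 <= layer u y t2.
Proof.
move=> t10; rewrite le_eqVlt => /predU1P[<-//|t12]; rewrite ge_max => /andP[h1 h2].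
rewrite -subr_ge0; have [t /andP[tl tr] ->] := layer_MVT u y t10 t12.
apply: mulr_ge0; last lra.
by apply: mulr_ge0; [exact: CT_ge0|apply: mulr_ge0; lra].
Qed.

Lemma layer_ge_left u y t1 t2 : 0 < t1 -> t1 <= t2 ->
  Num.min (u + y) ((y - u) / b) <= t1 -> t2 <= apex u y ->
  layer u y t2 <= layer u y t1.
Proof.
move=> t10; rewrite le_eqVlt => /predU1P[<-//|t12] h1 h2.
rewrite -subr_le0; have [t /andP[tl tr] ->] := layer_MVT u y t10 t12.
apply: mulr_le0_ge0; last by rewrite subr_ge0 ltW.
apply: mulr_ge0_le0; first exact: CT_ge0.
move: h1 h2; rewrite /apex; move: (u + y) ((y - u) / b) => m1 m2.
case: (leP m1 m2) => _ h1 h2; [rewrite mulr_ge0_le0//|rewrite mulr_le0_ge0//]; lra.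
Qed.

(** The layer frozen at [t0 = level u0 y0] is above [special] near the base point, except possibly
    when both critical points of [layer u y] exceed [t0]. In that case both are within O(distance)
    of [t0], so the derivative is quadratically small on an interval of linearly small length, and
    the excess is cubic: the quadratic penalty absorbs it. *)
Lemma special_touch u0 y0 (e : R) : 0 < u0 -> 0 <= y0 -> 0 < e ->
  exists2 d : R, 0 < d & forall u y, 0 < u -> 0 <= y ->
    `|u - u0| < d -> `|y - y0| < d ->
    special u y <= layer u y (level u0 y0) + e * ((u - u0) ^+ 2 + (y - y0) ^+ 2).
Proof.
move=> u00 y00 e0; set t0 := level u0 y0; set M0 := apex u0 y0.
have t00 : 0 < t0 by exact: level_gt0.
pose B : R := 1 + b^-1.
have B0 : 0 < B by rewrite ltr_wpDr// invr_ge0 ltW.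
pose C1 := C / t0; have C10 : 0 < C1 by rewrite divr_gt0.
(* Within [d1] the apex cannot climb from below 1 up to 1, so a cut-off at [(u, y)] implies a
   cut-off at the base point. *)
have [d1 d10 Hd1] : exists2 d : R, 0 < d & M0 < 1 -> 2 * B * d <= 1 - M0.
  have [M1|M1] := ltP M0 1; last by exists 1.
  exists ((1 - M0) / (2 * B)) => [|_].
    by rewrite divr_gt0 ?subr_gt0// mulr_gt0.
  by rewrite mulrC divfK// gt_eqF// mulr_gt0.
(* Chosen so that the cubic bound [C1 * r^3], with [r] at most [B] times the sum of the two
   increments, is at most [e] times the sum of their squares. *)
pose d2 := e / (4 * C1 * B ^+ 3).
have DB : 0 < 4 * C1 * B ^+ 3.
  by apply: mulr_gt0; [exact: mulr_gt0|exact: exprn_gt0].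
have d20 : 0 < d2 by exact: divr_gt0.
exists (Num.min d1 d2); first by rewrite lt_min d10 d20.
move=> u y up yp; rewrite !lt_min => /andP[ud1 ud2] /andP[yd1 yd2].
have rest : 0 <= e * ((u - u0) ^+ 2 + (y - y0) ^+ 2).
  by rewrite mulr_ge0 ?(ltW e0)// addr_ge0 ?sqr_ge0.
have lip := apex_lip u y u0 y0; rewrite -/M0 -/B in lip.
have Mp := apex_gt0 up yp.
rewrite /special /level; set M := apex u y in lip Mp *.
have [M1|M1] := leP 1 M.
  have M01 : 1 <= M0.
    rewrite leNgt; apply/negP => M01; have := Hd1 M01; nra.
  have -> : t0 = 1 by rewrite /t0 /level minEle -/M0 M01.
  by rewrite lerDl.
have [t0M|Mt0] := leP M t0.
  by apply: (@le_trans _ _ (layer u y t0)); [exact: layer_le_right|rewrite lerDl].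
have t0E : t0 = M0.
  by move: (Mt0); rewrite /t0 /level -/M0 gt_min ltNge (ltW M1)/= => ?; case: leP => //; lra.
set m := Num.min (u + y) ((y - u) / b).
have [mt0|t0m] := leP m t0.
  by apply: (@le_trans _ _ (layer u y t0)); [apply: layer_ge_left => //; exact: ltW|rewrite lerDl].
have mM : m <= M.
  by apply: (@le_trans _ _ (u + y)); rewrite ?ge_min ?le_max lexx.
have m0 : 0 < m by exact: lt_trans t0m.
apply: (@le_trans _ _ (layer u y m)); first exact: layer_ge_left.
rewrite -lerBlDl; have [t /andP[tl tr] ->] := layer_MVT u y t00 t0m.
have tp : 0 < t by exact: lt_trans tl.
have T1 : t `^ (p - 3) <= t0^-1.
  have -> : t `^ (p - 3) = t `^ (p - 2) / t.
    rewrite (_ : p - 2 = p - 3 + 1) ?powR_mul//; last by ring.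
    by rewrite powRr1 ?(ltW tp)// mulfK// gt_eqF.
  apply: (@le_trans _ _ t^-1); last by rewrite lef_pV2 ?posrE// ltW.
  rewrite ler_piMl ?invr_ge0 ?(ltW tp)//.
  have := @ger_powR R t; rewrite tp/= => /(_ _ 0 (p - 2)).
  rewrite powRr0; apply; last exact: ltW.
  by rewrite (le_trans (ltW tr))// (le_trans mM)// ltW.
have T0 : 0 <= t `^ (p - 3) by exact: powR_ge0.
have S : (t - (u + y)) * (t - (y - u) / b) <= (M - t0) ^+ 2 /\
    0 <= (t - (u + y)) * (t - (y - u) / b).
  have : [/\ t <= u + y, t <= (y - u) / b, u + y <= M & (y - u) / b <= M].
    have h1 : m <= u + y by rewrite /m ge_min lexx.
    have h2 : m <= (y - u) / b by rewrite /m ge_min lexx orbT.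
    have h3 : u + y <= M by rewrite /M le_max lexx.
    have h4 : (y - u) / b <= M by rewrite /M le_max lexx orbT.
    by split => //; lra.
  move: (u + y) ((y - u) / b) => s q [? ? ? ?].
  split; last by rewrite mulr_le0//; lra.
  rewrite -mulrNN expr2; apply: ler_pM; lra.
move: S; set S := (t - (u + y)) * _ => -[S1 S2].
set r := M - t0 in S1; have r0 : 0 < r by rewrite subr_gt0.
have mr : m - t0 <= r by rewrite lerD2r.
apply: (@le_trans _ _ (C1 * r ^+ 3)).
  rewrite -/C /C1 exprSr mulrA; apply: ler_pM => //.
  - by apply: mulr_ge0 => //; exact: CT_ge0.
  - by rewrite subr_ge0 ltW.
  apply: ler_pM => //.
  by rewrite ler_wpM2l// ltW.
have rB : r <= B * (`|u - u0| + `|y - y0|) by rewrite /r t0E.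
set X := `|u - u0| in ud1 ud2 rB; set Y := `|y - y0| in yd1 yd2 rB.
have -> : (u - u0) ^+ 2 = X ^+ 2 by rewrite /X real_normK ?num_real.
have -> : (y - y0) ^+ 2 = Y ^+ 2 by rewrite /Y real_normK ?num_real.
have X0 : 0 <= X by exact: normr_ge0. have Y0 : 0 <= Y by exact: normr_ge0.
have r2 : r ^+ 2 <= B ^+ 2 * (2 * (X ^+ 2 + Y ^+ 2)).
  apply: (@le_trans _ _ ((B * (X + Y)) ^+ 2)).
    by rewrite lerXn2r ?nnegrE// ltW// (lt_le_trans r0).
  rewrite exprMn ler_wpM2l ?sqr_ge0//.
  by rewrite -subr_ge0 (_ : _ - _ = (X - Y) ^+ 2) ?sqr_ge0//; ring.
have rd : r <= B * (2 * d2) by apply: (le_trans rB); rewrite ler_wpM2l ?(ltW B0)//; lra.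
rewrite exprSr mulrA.
apply: (@le_trans _ _ (C1 * (B ^+ 2 * (2 * (X ^+ 2 + Y ^+ 2))) * (B * (2 * d2)))).
  apply: ler_pM => //; first by rewrite mulr_ge0 ?sqr_ge0// ltW.
    exact: ltW.
  by rewrite ler_wpM2l// ltW.
have -> : C1 * (B ^+ 2 * (2 * (X ^+ 2 + Y ^+ 2))) * (B * (2 * d2)) =
    (4 * C1 * B ^+ 3) * d2 * (X ^+ 2 + Y ^+ 2) by ring.
by rewrite /d2 [X in X * _]mulrC divfK// gt_eqF.
Qed.

Lemma layer_tangent u t : 0 < u -> 0 < t ->
  a * t `^ (p - 2) * u ^+ 2 <= K * u `^ p + c * t `^ (p - 1) * u.
Proof.
move=> u0 t0; pose r := u / t; have r0 : 0 < r by rewrite divr_gt0.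
have uE : u = r * t by rewrite divfK// gt_eqF.
have tp0 : 0 < t `^ (p - 2) by exact: powR_gt0.
have F1 : p - 1 = p - 2 + 1 by ring.
have F0 : p = p - 1 + 1 by ring.
have E1 : t `^ (p - 1) = t `^ (p - 2) * t.
  by rewrite F1 powR_mul// powRr1// ltW.
have Ep : t `^ p = t `^ (p - 2) * t * t.
  by rewrite -E1 {1}F0 powR_mul// powRr1// ltW.
have Er : r `^ p = r * r `^ (p - 1) by rewrite mulr_powRB1// ltW.
have bern : 1 + (p - 1) * (r * (p / 2) - 1) <= (r * (p / 2)) `^ (p - 1).
  apply: bernoulli_powR; last by rewrite ltrBrDr.
  by rewrite mulr_ge0 ?divr_ge0// ltW.
have q0 : 0 < p / 2 by rewrite divr_gt0.
rewrite (powRM _ (ltW r0) (ltW q0)) in bern.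
have KE : K = (p / 2) * (p / 2) `^ (p - 1) / (p - 1) by rewrite mulr_powRB1// ltW.
have up : u `^ p = r * r `^ (p - 1) * (t `^ (p - 2) * t * t).
  by rewrite uE powRM ?ltW// Ep Er.
rewrite up E1 KE uE; move: (r `^ (p - 1)) ((p / 2) `^ (p - 1)) bern => X Y bern.
suff H : a * r <= p / 2 * Y / (p - 1) * X + c.
  rewrite -subr_ge0 (_ : _ - _ =
    t `^ (p - 2) * t * t * r * (p / 2 * Y / (p - 1) * X + c - a * r)); last by ring.
  by apply: mulr_ge0; [exact: (ltW (mulr_gt0 (mulr_gt0 (mulr_gt0 tp0 t0) t0) r0))|rewrite subr_ge0].
rewrite -(ler_pM2l p1) mulrDr c_p1 /a.
have -> : (p - 1) * (p / 2 * Y / (p - 1) * X) = p / 2 * (X * Y).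
  by field; rewrite gt_eqF.
have H : p / 2 * (1 + (p - 1) * (r * (p / 2) - 1)) <= p / 2 * (X * Y).
  exact: (ler_wpM2l (ltW q0) bern).
apply: le_trans (_ : _ <= p / 2 * (1 + (p - 1) * (r * (p / 2) - 1)) + p * (p - 2) / 2) _.
  by rewrite le_eqVlt; apply/orP; left; apply/eqP; field.
by rewrite lerD2r.
Qed.

Lemma special_ge u y : 0 < u -> 0 <= y -> - (K * u `^ p) <= special u y.
Proof.
move=> u0 y0; have t0 := level_gt0 u0 y0.
have := layer_tangent u0 t0; rewrite /special /layer mulrBr.
have : 0 <= a * level u y `^ (p - 2) * (y - b * level u y) ^+ 2.
  by rewrite mulr_ge0 ?sqr_ge0// mulr_ge0 ?powR_ge0// ltW.
lra.
Qed.

Lemma special_ge1 u y : 0 < u -> 1 <= y -> 1 - K * u `^ p <= special u y.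
Proof.
move=> u0 y1; have := layer_tangent u0 ltr01; rewrite /special.
have -> : level u y = 1.
  rewrite /level minEle ifT// le_max; apply/orP; left; lra.
rewrite /layer !powR1 !mulr1 mulrBr.
have b1 : 0 <= 1 - b.
  by rewrite -(pmulr_rge0 _ p0) mulrBr pb mulr1; move: p0 => ?; lra.
have : 1 <= a * (y - b) ^+ 2.
  have -> : 1 = a * (1 - b) ^+ 2 by rewrite /a /b; field; rewrite gt_eqF.
  by rewrite ler_wpM2l ?(ltW a0)// lerXn2r ?nnegrE ?lerD2r//; lra.
lra.
Qed.

(** For [y <= u] the second critical point is nonpositive, so the apex is [u + y]. After a positive
    power of [t] is factored out, a polynomial inequality remains, governed by [c <= p - 2]. *)
Lemma special_le0 u y : 0 < u -> 0 <= y <= u -> special u y <= 0.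
Proof.
move=> u0 /andP[y0 yu]; rewrite /special.
have th : (y - u) / b <= 0 by rewrite pmulr_lle0 ?invr_gt0// subr_le0.
have aE : apex u y = u + y by rewrite /apex maxElt ifF//; apply/negbTE; rewrite -leNgt; lra.
have s0 : 0 < u + y by lra.
have key t : 0 < t -> t <= u + y -> a * ((y - b * t) ^+ 2 - u ^+ 2) + c * t * u <= 0 ->
   layer u y t <= 0.
  move=> t0 tu H; rewrite /layer.
  have F1 : p - 1 = p - 2 + 1 by ring.
  have E1 : t `^ (p - 1) = t `^ (p - 2) * t by rewrite F1 powR_mul// powRr1// ltW.
  rewrite E1.
  rewrite (_ : _ + _ = t `^ (p - 2) * (a * ((y - b * t) ^+ 2 - u ^+ 2) + c * t * u)); last by ring.
  by rewrite mulr_ge0_le0 ?powR_ge0.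
have bp : a * (1 - b) = p / 2 by rewrite /a /b; field; rewrite gt_eqF.
have ab : a * b = p * (p - 2) / 4 by rewrite /a /b; field; rewrite gt_eqF.
have hc := c_le; have hp := p_2; have hc0 := c0.
rewrite /level aE minEle; case: ifPn => [s1|]; last rewrite -ltNge => s1.
  apply: key => //; rewrite !mulr1.
  (* Expansion in [u - y] and [u + y - 1], both nonnegative in this case; the coefficients are
     nonnegative because [c <= p - 2] and [p > 2]. *)
  have -> : a * ((y - b) ^+ 2 - u ^+ 2) + c * u =
    - ((u - y) * (a * (1 - b) - c / 2 + a * (u + y - 1))
       + (a * b * (1 - b) - c / 2 + (a * b - c / 2) * (u + y - 1))) by field.
  rewrite oppr_le0 bp; apply: addr_ge0.
    apply: mulr_ge0; first lra.
    apply: addr_ge0; first lra.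
    by apply: mulr_ge0; [exact: ltW|lra].
  have -> : a * b * (1 - b) = (p - 2) / 2 by rewrite mulrAC bp /b; field; rewrite gt_eqF.
  apply: addr_ge0; first lra.
  apply: mulr_ge0; last lra.
  by rewrite ab; nra.
apply: key => //.
have -> : a * ((y - b * (u + y)) ^+ 2 - u ^+ 2) + c * (u + y) * u =
    (u + y) * (a * (1 - b) * ((1 - b) * y - (1 + b) * u) + c * u) by ring.
rewrite bp pmulr_rle0//.
have -> : p / 2 * ((1 - b) * y - (1 + b) * u) = y - (p - 1) * u.
  by rewrite /b; field; rewrite gt_eqF.
nra.
Qed.

(** Replaces [|v|], which is not differentiable at zeros of [v], by [sg * v]: since [b * t >= 0],
    the square can only grow. Equality holds wherever [sg * v = |v|]. *)
Lemma layer_norm_le u v t (sg : R) : 0 <= t -> `|sg| = 1 ->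
  layer u `|v| t <= a * t `^ (p - 2) * ((sg * v - b * t) ^+ 2 - u ^+ 2) + c * t `^ (p - 1) * u.
Proof.
move=> t0 sg1; rewrite /layer lerD2r ler_wpM2l//.
  by rewrite mulr_ge0 ?powR_ge0// ltW.
rewrite lerD2r -subr_ge0.
have sv : sg * v <= `|v| by rewrite (le_trans (ler_norm _))// normrM sg1 mul1r.
have -> : (sg * v - b * t) ^+ 2 - (`|v| - b * t) ^+ 2 =
    (sg ^+ 2 * v ^+ 2 - `|v| ^+ 2) + 2 * (b * t) * (`|v| - sg * v) by ring.
rewrite -(real_normK (num_real sg)) sg1 expr1n mul1r real_normK ?num_real// subrr add0r.
by rewrite mulr_ge0 ?subr_ge0// mulr_ge0// mulr_ge0// ltW.
Qed.

End special_function.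

(** * Superharmonicity produced by differential subordination *)

Section subordinate.
Context {R : realType} {n : nat}.
Implicit Types (u v : 'rV[R]_n -> R) (x : 'rV[R]_n) (E D : set 'rV[R]_n).

(** Keeps only the pointwise gradient inequality, in terms of jets: unlike the full subordination it
    survives adding a constant to [u] alone, as is done to make [u] strictly positive. *)
Definition subordinate_at u v x : Prop := exists au av,
  [/\ jet2 u x au 0, jet2 v x av 0 & \sum_i av i ^+ 2 <= \sum_i au i ^+ 2].

Lemma diff_subordinate_at D xi u v x : open D -> harmonic_on D u ->
  harmonic_on D v -> diff_subordinate D xi u v -> D x -> subordinate_at u v x.
Proof.
move=> oD hu hv [_ sub] Dx.
exists (fun i => partial i u x), (fun i => partial i v x); split.
- exact: jet2_harmonic oD hu Dx.
- exact: jet2_harmonic oD hv Dx.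
- have := sub x Dx; rewrite /grad_norm ler_sqrt//.
  by apply: sumr_ge0 => i _; exact: sqr_ge0.
Qed.

Lemma subordinate_at_affine u v x (k e : R) : subordinate_at u v x ->
  subordinate_at (fun y => k * u y + e) (fun y => k * v y) x.
Proof.
move=> [au [av [ju jv s]]].
exists (fun i => k * au i), (fun i => k * av i); split.
- apply: jet2_eq (jet2D (jet2Z k ju) (jet2_cst e x)) _ _ => [i|].
    by rewrite addr0.
  by rewrite mulr0 addr0.
- by apply: jet2_eq (jet2Z k jv) _ _ => //; rewrite mulr0.
- under eq_bigr do rewrite exprMn.
  under [X in _ <= X]eq_bigr do rewrite exprMn.
  by rewrite -!mulr_sumr ler_wpM2l// sqr_ge0.
Qed.

(** The one Laplacian computation serving both Burkholder functions: a branch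
    [k * ((sg * v + r)^2 - u^2) + g * u] with a penalty of weight [eta]. *)
Lemma jet2_quadratic u v x au av (k sg r g eta u0 v0 : R) :
  jet2 u x au 0 -> jet2 v x av 0 ->
  exists a, jet2 (fun y => k * ((sg * v y + r) ^+ 2 + -1 * u y ^+ 2) + g * u y +
      eta * ((u y + - u0) ^+ 2 + (v y + - v0) ^+ 2)) x a
    (k * (2 * (sg ^+ 2 * \sum_i av i ^+ 2) - 2 * \sum_i au i ^+ 2) +
     eta * (2 * \sum_i au i ^+ 2 + 2 * \sum_i av i ^+ 2)).
Proof.
move=> ju jv; eexists.
apply: jet2_eq (jet2D (jet2D (jet2Z k (jet2D
  (jet2_sqr (jet2D (jet2Z sg jv) (jet2_cst r x))) (jet2Z (-1) (jet2_sqr ju))))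
  (jet2Z g ju)) (jet2Z eta (jet2D (jet2_sqr (jet2D ju (jet2_cst (- u0) x)))
  (jet2_sqr (jet2D jv (jet2_cst (- v0) x)))))) (frefl _) _.
have -> : \sum_i (sg * av i + 0) ^+ 2 = sg ^+ 2 * \sum_i av i ^+ 2.
  by rewrite mulr_sumr; apply: eq_bigr => i _; rewrite addr0 exprMn.
have -> : \sum_i (au i + 0) ^+ 2 = \sum_i au i ^+ 2.
  by apply: eq_bigr => i _; rewrite addr0.
have -> : \sum_i (av i + 0) ^+ 2 = \sum_i av i ^+ 2.
  by apply: eq_bigr => i _; rewrite addr0.
ring.
Qed.

(* Burkholder's function for the weak type (1, 1) inequality, equal to
   [v ^ 2 - u ^ 2 + 2 * u] where [u + |v| < 1] and to [1] elsewhere. *)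
Definition weak1_fun (u v : R) : R :=
  1 - Num.max 0 (Num.max 0 (1 - u) ^+ 2 - v ^+ 2).

Lemma weak1_fun_le1 (u v : R) : weak1_fun u v <= 1.
Proof. by rewrite gerBl le_max lexx. Qed.

Lemma weak1_fun_in (u v : R) : u + `|v| < 1 ->
  weak1_fun u v = v ^+ 2 - u ^+ 2 + 2 * u.
Proof.
move=> uv; have v0 := normr_ge0 v.
have u1 : 0 < 1 - u by lra.
have E : Num.max 0 (1 - u) = 1 - u by rewrite maxElt u1.
rewrite /weak1_fun E maxElt ifT; first by ring.
rewrite subr_gt0 -(real_normK (num_real v)) ltrXn2r ?nnegrE//; lra.
Qed.

Lemma weak1_fun_out (u v : R) : 1 <= u + `|v| -> weak1_fun u v = 1.
Proof.
move=> uv; have v0 := normr_ge0 v.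
rewrite /weak1_fun [X in 1 - X](_ : _ = 0) ?subr0//.
apply/eqP; rewrite eq_le le_max lexx andbT ge_max lexx/= subr_le0.
rewrite -(real_normK (num_real v)) lerXn2r ?nnegrE ?le_max ?lexx//.
by rewrite ge_max v0/=; lra.
Qed.

Lemma weak1_fun_ge0 (u v : R) : 0 <= u -> 0 <= weak1_fun u v.
Proof.
move=> u0; have v0 := normr_ge0 v; have [uv|uv] := leP 1 (u + `|v|).
  by rewrite weak1_fun_out// ler01.
rewrite weak1_fun_in//; have := sqr_ge0 v; nra.
Qed.

Lemma weak1_fun_ge1 (u v : R) : 0 <= u -> 1 <= `|v| -> 1 <= weak1_fun u v.
Proof. by move=> u0 v1; rewrite weak1_fun_out//; lra. Qed.

Lemma weak1_fun_le (u v : R) : `|v| <= u -> weak1_fun u v <= 2 * u.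
Proof.
move=> vu; have v0 := normr_ge0 v; have [uv|uv] := leP 1 (u + `|v|).
  by rewrite weak1_fun_out//; lra.
rewrite weak1_fun_in// -(real_normK (num_real v)); nra.
Qed.

(** Where u + |v| >= 1 the function attains its maximal value 1 and the constant touches it.
    Elsewhere it coincides locally with [v^2 - u^2 + 2 * u], whose Laplacian is twice |grad v|^2 -
    |grad u|^2. *)
Lemma weak1_touched u v x : {for x, continuous u} -> {for x, continuous v} ->
  subordinate_at u v x -> touched_above (fun y => weak1_fun (u y) (v y)) x.
Proof.
move=> cu cv [au [av [ju jv suv]]] e e0.
have [uv|uv] := leP 1 (u x + `|v x|).
  exists (fun=> 1), (fun=> 0), 0; split => //; first exact: jet2_cst.
    exact: weak1_fun_out.
  by near=> y; exact: weak1_fun_le1.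
have [a ja] := jet2_quadratic 1 1 0 2 0 0 0 ju jv.
eexists; exists a; eexists; split; first exact: ja.
- rewrite mul0r addr0 expr1n !mul1r; lra.
- rewrite weak1_fun_in//; ring.
- near=> y; rewrite weak1_fun_in; first by rewrite le_eqVlt; apply/orP; left; apply/eqP; ring.
  near: y.
  have cuv : u y + `|v y| @[y --> x] --> u x + `|v x|.
    have cav : {for x, continuous (fun y => `|v y|)}.
      exact: (continuous_comp cv (@norm_continuous _ _ _)).
    exact: (cvgD cu cav).
  exact: (cvgr_lt _ cuv).
Unshelve. all: by end_near. Qed.

(** The touching function is the layer frozen at the level of the point [x], with [|v|] unfolded by
    a fixed sign, plus the penalty of [special_touch]. *)
Lemma special_touched (p : R) u v x : 2 < p ->
  {for x, continuous u} -> {for x, continuous v} -> 0 < u x ->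
  subordinate_at u v x -> touched_above (fun y => special p (u y) `|v y|) x.
Proof.
move=> p2 cu cv u0 [au [av [ju jv suv]]] e e0.
set Su := \sum_i au i ^+ 2 in suv *.
have Su0 : 0 <= Su by apply: sumr_ge0 => i _; exact: sqr_ge0.
(* By subordination the penalty contributes at most [4 * eta * Su < e] to the Laplacian. *)
pose eta := e / (4 * Su + 1).
have d0 : 0 < 4 * Su + 1 by lra.
have eta0 : 0 < eta by rewrite divr_gt0.
have etaE : eta * (4 * Su + 1) = e by rewrite divfK// gt_eqF.
have [d dp Hd] := special_touch p2 u0 (normr_ge0 (v x)) eta0.
set t0 := level p (u x) `|v x| in Hd.
have t00 : 0 < t0 by exact: level_gt0.
(* A sign of modulus 1 even where [v x = 0], where it is taken to be 1. *)
have [sg sg1 sgv] : exists2 sg : R, `|sg| = 1 & sg * v x = `|v x|.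
  exists (Num.sg (v x) + (v x == 0)%:R); last first.
    by rewrite mulrDl -normrEsg; case: eqVneq => [->|_]; rewrite ?mulr0 ?mul0r addr0.
  have [->|vx] := eqVneq (v x) 0; first by rewrite sgr0 add0r normr1.
  by rewrite addr0 normr_sg vx.
pose k := p ^+ 2 / 4 * t0 `^ (p - 2).
have k0 : 0 <= k by rewrite mulr_ge0 ?powR_ge0// divr_ge0// sqr_ge0.
pose g := p * (p - 2) / (2 * (p - 1)) * t0 `^ (p - 1).
pose r := - ((p - 2) / p * t0).
have [a ja] := jet2_quadratic k sg r g eta (u x) (v x) ju jv.
eexists; exists a; eexists; split; first exact: ja.
- rewrite -/Su -(real_normK (num_real sg)) sg1 expr1n mul1r.
  set Sv := \sum_i av i ^+ 2 in suv *.
  have : k * (2 * Sv - 2 * Su) <= 0 by rewrite mulr_ge0_le0//; lra.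
  by nra.
- rewrite /= !subrr expr0n addr0 mulr0 addr0 /special -/t0 /layer sgv.
  by rewrite /k /g /r; ring.
- near=> y.
  have uy : 0 < u y by near: y; exact: (cvgr_gt _ cu).
  have udy : `|u y - u x| < d.
    by rewrite distrC; near: y; move/cvgrPdist_lt : cu; exact.
  have vdy : `|v y - v x| < d.
    by rewrite distrC; near: y; move/cvgrPdist_lt : cv; exact.
  have vdy' : `| `|v y| - `|v x| | < d by apply: le_lt_trans vdy; exact: ler_dist_dist.
  apply: le_trans (Hd (u y) `|v y| uy (normr_ge0 _) udy vdy') _.
  apply: lerD.
    apply: le_trans (layer_norm_le p2 (u y) (v y) (ltW t00) sg1) _.
    by rewrite le_eqVlt; apply/orP; left; apply/eqP; rewrite /k /g /r; ring.
  rewrite ler_wpM2l ?(ltW eta0)// lerD2l.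
  rewrite -(real_normK (num_real (`|v y| - _))) -(real_normK (num_real (v y + - v x))).
  by rewrite lerXn2r ?nnegrE ?normr_ge0//; exact: ler_dist_dist.
Unshelve. all: by end_near. Qed.

Lemma continuous_powR (q x : R) : 0 < x -> {for x, continuous (fun t : R => t `^ q)}.
Proof.
move=> x0; apply: differentiable_continuous; apply/derivable1_diffP.
by apply: derivable_powR; rewrite in_itv/= x0.
Qed.

Lemma special_continuous (p : R) u v x : 2 < p ->
  {for x, continuous u} -> {for x, continuous v} -> 0 < u x ->
  {for x, continuous (fun y => special p (u y) `|v y|)}.
Proof.
move=> p2 cu cv u0.
have cav : {for x, continuous (fun y => `|v y|)}.
  exact: (continuous_comp cv (@norm_continuous _ _ _)).
have cl : {for x, continuous (fun y => level p (u y) `|v y|)}.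
  apply: (@continuous_min _ _ (fun=> 1)); first exact: cst_continuous.
  apply: (@continuous_max _ _ (fun y => u y + `|v y|)); first exact: (cvgD cu cav).
  exact: (cvgM (cvgB cav cu) (@cst_continuous _ _ _ _)).
have l0 : 0 < level p (u x) `|v x| by exact: level_gt0.
have cpow q : {for x, continuous (fun y => level p (u y) `|v y| `^ q)}.
  exact: (continuous_comp cl (@continuous_powR q _ l0)).
have sqr (f : 'rV[R]_n -> R) : {for x, continuous f} ->
    {for x, continuous (fun y => f y ^+ 2)}.
  move=> cf; apply: (@continuous_comp _ _ _ f (fun t : R => t ^+ 2)) => //.
  exact: exprn_continuous.
have ccst (k : R) : {for x, continuous (fun _ : 'rV[R]_n => k)}.
  exact: cst_continuous.
have c1 : {for x, continuous (fun y => (`|v y| - (p - 2) / p * level p (u y) `|v y|) ^+ 2)}.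
  apply: (sqr (fun y => `|v y| - (p - 2) / p * level p (u y) `|v y|)).
  exact: (cvgB cav (cvgM (ccst _) cl)).
exact: (cvgD (cvgM (cvgM (ccst _) (cpow _)) (cvgB c1 (sqr _ cu)))
  (cvgM (cvgM (ccst _) (cpow _)) cu)).
Qed.

Lemma weak1_continuous u v x : {for x, continuous u} -> {for x, continuous v} ->
  {for x, continuous (fun y => weak1_fun (u y) (v y))}.
Proof.
move=> cu cv; have sqr (f : 'rV[R]_n -> R) : {for x, continuous f} ->
    {for x, continuous (fun y => f y ^+ 2)}.
  move=> cf; apply: (@continuous_comp _ _ _ f (fun t : R => t ^+ 2)) => //.
  exact: exprn_continuous.
have ccst (k : R) : {for x, continuous (fun _ : 'rV[R]_n => k)}.
  exact: cst_continuous.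
have c1 : {for x, continuous (fun y => Num.max 0 (1 - u y))}.
  apply: (@continuous_max _ _ (fun=> 0)) => //; exact: (cvgB (ccst _) cu).
have c2 : {for x, continuous (fun y => Num.max 0 (Num.max 0 (1 - u y) ^+ 2 - v y ^+ 2))}.
  apply: (@continuous_max _ _ (fun=> 0)) => //.
  exact: (cvgB (sqr _ c1) (sqr _ cv)).
exact: (cvgB (ccst _) c2).
Qed.

End subordinate.

(** * Weak-type estimates for a fixed subdomain *)

Section weak_type.
Context {R : realType} {n : nat}.
Hypothesis n0 : (0 < n)%N.
Variables (E : set 'rV[R]_n) (xi : 'rV[R]_n).
Hypotheses (oE : open E) (bE : bounded_set E) (Exi : E xi).
Variable mu : {measure set (borelRn R n) -> \bar R}.
Hypothesis hmu : harmonic_measure E xi mu.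
Implicit Types (f g s u v : 'rV[R]_n -> R) (x : 'rV[R]_n).

Let K := bdry E.

Lemma bdry_compact_bounded : compact (bdry E).
Proof.
apply: (subclosed_compact _ (compact_closure bE)); last exact: bdry_closure.
by apply: closedI; [exact: closed_closure|exact: open_closedC].
Qed.

Let cK : compact K := bdry_compact_bounded.
Let mK : measurable (K : set (borelRn R n)) := closed_borel (compact_closed_rV cK).

Lemma closure_within f : (forall x, closure E x -> {for x, continuous f}) ->
  {within K, continuous f}.
Proof. by move=> cf; apply: continuous_in_within => x /bdry_closure; exact: cf. Qed.

Lemma harmonic_measure_touched s :
  (forall x, closure E x -> {for x, continuous s}) ->
  (forall x, E x -> touched_above s x) ->
  (\int[mu]_(x in (K : set (borelRn R n))) (s x)%:E <= (s xi)%:E)%E.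
Proof.
move=> cs ts; rewrite (hmu (closure_within cs)).
by apply: upper_PWB_le => //; exists xi.
Qed.

(** The constant 1 is touched above; for an arbitrary subdomain this one inequality is all that the
    upper bounds use about the total mass. *)
Lemma harmonic_measure_le1 : (mu K <= 1)%E.
Proof.
have := @harmonic_measure_touched (fun=> 1).
rewrite integral_cst// mul1e; apply => x _; first exact: cst_continuous.
exact: touched_above_jet (jet2_cst 1 x) (lexx 0).
Qed.

Let muK : (mu K < +oo)%E.
Proof. exact: le_lt_trans harmonic_measure_le1 (ltry 1). Qed.

Definition superlevel v (lam : R) : set (borelRn R n) :=
  [set x | bdry E x /\ lam <= `|v x|].

Lemma superlevel_measurable v lam : {within K, continuous v} ->
  measurable (superlevel v lam).
Proof.
move=> cv; have cav : {within K, continuous (fun x => `|v x|)}.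
  by move=> x; exact: (continuous_comp (cv x) (@norm_continuous _ _ _)).
have := within_continuous_measurable (compact_closed_rV cK) cav mK
  (measurable_itv `[lam, +oo[).
rewrite (_ : K `&` _ = superlevel v lam)//.
by apply/seteqP; split => x [Kx]; rewrite /= in_itv/= andbT.
Qed.

Lemma superlevel_le v lam f : {within K, continuous v} -> {within K, continuous f} ->
  (forall x, K x -> 0 <= f x) -> (forall x, K x -> lam <= `|v x| -> 1 <= f x) ->
  (mu (superlevel v lam) <= \int[mu]_(x in (K : set (borelRn R n))) (f x)%:E)%E.
Proof.
move=> cv cf f0 f1; have mA := superlevel_measurable lam cv.
have -> : mu (superlevel v lam) =
    (\int[mu]_(x in (K : set (borelRn R n))) (\1_(superlevel v lam) x)%:E)%E.
  by rewrite integral_indic//; congr (mu _); apply/esym/setIidPl => x [].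
apply: ge0_le_integral => //.
- by apply/measurable_EFinP; exact: measurable_indic.
- apply/measurable_EFinP; apply: within_continuous_measurable => //.
  exact: compact_closed_rV.
- move=> x Kx; rewrite lee_fin indicE.
  have [lv|lv] := leP lam `|v x|; first by rewrite mem_set//; exact: f1.
  by rewrite memNset ?f0// => -[_ /=]; rewrite leNgt lv.
Qed.

Lemma weak_type1 u v : (forall x, closure E x -> {for x, continuous u}) ->
  (forall x, closure E x -> {for x, continuous v}) ->
  (forall x, E x -> subordinate_at u v x) -> (forall x, closure E x -> 0 <= u x) ->
  `|v xi| <= u xi -> (mu (superlevel v 1) <= (2 * u xi)%:E)%E.
Proof.
move=> cu cv suv u0 vu.
have cw x : closure E x -> {for x, continuous (fun y => weak1_fun (u y) (v y))}.
  by move=> Ex; apply: weak1_continuous; [exact: cu|exact: cv].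
apply: (@le_trans _ _ (weak1_fun (u xi) (v xi))%:E); last first.
  by rewrite lee_fin; exact: weak1_fun_le.
apply: (le_trans _ (harmonic_measure_touched cw _)).
  apply: superlevel_le; [exact: closure_within|exact: closure_within| |].
    by move=> x /bdry_closure Ex; apply: weak1_fun_ge0; exact: u0.
  by move=> x /bdry_closure Ex; apply: weak1_fun_ge1; exact: u0.
move=> x Ex; have clx := subset_closure Ex.
by apply: weak1_touched; [exact: cu|exact: cv|exact: suv].
Qed.

Let weak_type_of s u v (k p : R) : 0 <= k -> 1 < p ->
  (forall x, closure E x -> {for x, continuous u}) ->
  (forall x, closure E x -> {for x, continuous v}) ->
  (forall x, closure E x -> {for x, continuous s}) ->
  (forall x, closure E x -> 0 < u x) ->
  (forall x, E x -> touched_above s x) -> s xi <= 0 ->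
  (forall x, closure E x -> - (k * u x `^ p) <= s x) ->
  (forall x, closure E x -> 1 <= `|v x| -> 1 - k * u x `^ p <= s x) ->
  (mu (superlevel v 1) <=
    k%:E * \int[mu]_(x in (K : set (borelRn R n))) (u x `^ p)%:E)%E.
Proof.
move=> k0 p1 cu cv cs u0 ts sxi s0 s1.
have cup x : closure E x -> {for x, continuous (fun y => u y `^ p)}.
  move=> Ex; exact: (continuous_comp (cu x Ex) (@continuous_powR _ p _ (u0 x Ex))).
have wup := closure_within cup; have ws := closure_within cs.
have wkup : {within K, continuous (fun x => k * u x `^ p)} by exact: withinZ.
apply: (@le_trans _ _ (\int[mu]_(x in (K : set (borelRn R n))) (s x + k * u x `^ p)%:E)%E).
  apply: superlevel_le; [exact: closure_within|exact: withinD| |].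
    by move=> x /bdry_closure Ex; have := s0 x Ex; lra.
  by move=> x /bdry_closure Ex v1; have := s1 x Ex v1; lra.
have Is := within_continuous_integrable cK muK ws.
have Iu := within_continuous_integrable cK muK wup.
have Iku := within_continuous_integrable cK muK wkup.
have -> : (\int[mu]_(x in (K : set (borelRn R n))) (s x + k * u x `^ p)%:E =
    \int[mu]_(x in (K : set (borelRn R n))) (s x)%:E +
    k%:E * \int[mu]_(x in (K : set (borelRn R n))) (u x `^ p)%:E)%E.
  rewrite -integralZl//.
  have -> : (\int[mu]_(x in (K : set (borelRn R n))) (k%:E * (u x `^ p)%:E) =
     \int[mu]_(x in (K : set (borelRn R n))) (k * u x `^ p)%:E)%E.
    by apply: eq_integral.
  by rewrite -(integralD_EFin mK Is Iku); apply: eq_integral.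
rewrite -[leRHS]add0e leeD2r//.
by apply: le_trans (harmonic_measure_touched cs ts) _; rewrite lee_fin.
Qed.

Lemma weak_typep u v (p : R) : 2 <= p ->
  (forall x, closure E x -> {for x, continuous u}) ->
  (forall x, closure E x -> {for x, continuous v}) ->
  (forall x, E x -> subordinate_at u v x) -> (forall x, closure E x -> 0 < u x) ->
  `|v xi| <= u xi ->
  (mu (superlevel v 1) <= ((p / 2) `^ p / (p - 1))%:E *
    \int[mu]_(x in (K : set (borelRn R n))) (u x `^ p)%:E)%E.
Proof.
move=> p2 cu cv suv u0 vu.
have k0 : 0 <= (p / 2) `^ p / (p - 1) by rewrite divr_ge0 ?powR_ge0//; lra.
have p1 : 1 < p by lra.
have Exi' := subset_closure Exi.
(* At [p = 2] the layers degenerate, since [b = 0] and the apex divides by [b]; the function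
   [v^2 - u^2] takes their place, with factor [K = 1]. *)
move: p2; rewrite le_eqVlt => /predU1P[p2|p2].
  have up x : closure E x -> (p / 2) `^ p / (p - 1) * u x `^ p = u x ^+ 2.
    move=> Ex; rewrite -p2 divff// powR1 (_ : 2 - 1 = 1) ?invr1 ?mulr1 ?mul1r; last by ring.
    by rewrite powR_mulrn// ltW// u0.
  have sq f x : {for x, continuous f} -> {for x, continuous (fun y => f y ^+ 2)}.
    move=> cf; apply: (@continuous_comp _ _ _ f (fun t : R => t ^+ 2)) => //.
    exact: exprn_continuous.
  apply: (@weak_type_of (fun y => v y ^+ 2 + -1 * u y ^+ 2)) => //.
  - move=> x Ex; have ccst : {for x, continuous (fun _ : 'rV[R]_n => -1 : R)}.
      exact: cst_continuous.
    exact: (cvgD (sq _ _ (cv x Ex)) (cvgM ccst (sq _ _ (cu x Ex)))).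
  - move=> x Ex; have [au [av [ju jv s]]] := suv x Ex.
    apply: touched_above_jet (jet2D (jet2_sqr jv) (jet2Z (-1) (jet2_sqr ju))) _.
    by rewrite !mulr0; lra.
  - have := normr_ge0 (v xi); rewrite -(real_normK (num_real (v xi))); nra.
  - by move=> x Ex; rewrite up//; have := sqr_ge0 (v x); lra.
  - move=> x Ex v1; rewrite up// -(real_normK (num_real (v x))); nra.
apply: (@weak_type_of (fun y => special p (u y) `|v y|)) => //.
- move=> x Ex; apply: special_continuous => //; [exact: cu|exact: cv|exact: u0].
- move=> x Ex; have clx := subset_closure Ex.
  by apply: special_touched => //; [exact: cu|exact: cv|exact: u0|exact: suv].
- by apply: special_le0 => //; [exact: u0|rewrite normr_ge0].
- by move=> x Ex; apply: special_ge => //; exact: u0.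
- by move=> x Ex v1; apply: special_ge1 => //; exact: u0.
Qed.

End weak_type.

(** * The upper bounds *)

Section norms.
Context {R : realType} {n : nat}.
Hypothesis n0 : (0 < n)%N.
Implicit Types (f u v : 'rV[R]_n -> R) (x xi : 'rV[R]_n) (D E : set 'rV[R]_n).

Lemma powRVK (p t : R) : 0 < p -> 0 <= t -> (t `^ p) `^ p^-1 = t.
Proof. by move=> p0 t0; rewrite -powRrM divff ?gt_eqF// powRr1. Qed.

Lemma poweR_le_root (p t : R) (z : \bar R) : 0 < p -> 0 <= t -> (0 <= z)%E ->
  (z <= (t `^ p)%:E)%E -> (z `^ p^-1 <= t%:E)%E.
Proof.
move=> p0 t0 z0 zt.
apply: (le_trans (gt0_ler_poweR _ _ _ zt)); rewrite ?invr_ge0 ?(ltW p0)//.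
- by rewrite in_itv/= z0 leey.
- by rewrite in_itv/= lee_fin powR_ge0 leey.
- by rewrite poweR_EFin powRVK.
Qed.

Lemma root_le_poweR (p t : R) (z : \bar R) : 0 < p -> 0 <= t ->
  ((t `^ p)%:E <= z)%E -> (t%:E <= z `^ p^-1)%E.
Proof.
move=> p0 t0 tz; rewrite -{1}(powRVK p0 t0) -poweR_EFin.
have z0 : (0 <= z)%E by apply: le_trans tz; rewrite lee_fin powR_ge0.
apply: gt0_ler_poweR tz; rewrite ?invr_ge0 ?(ltW p0)//.
- by rewrite in_itv/= lee_fin powR_ge0 leey.
- by rewrite in_itv/= z0 leey.
Qed.

(* Small balls around [xi] carry a harmonic measure of mass [1], on which [u] is
   close to [u xi]. *)
Lemma le_hnorm_point D xi u (p : R) : 0 < p -> open D -> D xi ->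
  {for xi, continuous u} -> (forall x, D x -> {for x, continuous u}) ->
  (`|u xi|%:E <= hnorm D xi p u)%E.
Proof.
move=> p0 oD Dxi cuxi cu; apply/lee_addgt0Pr => e e0.
have : \forall x \near xi, D x /\ `|u xi - u x| < e.
  near=> x; split; first by near: x; exact: open_nbhs_nbhs.
  by near: x; move/cvgrPdist_lt : cuxi; exact.
move=> /nbhs_ballP[d /= d0 Hd].
(* Equal weights give the Euclidean ball of radius [d / 2], whose closure lies in the max-norm ball
   of radius [d]. *)
pose w : 'rV[R]_n := const_mx ((d / 2) ^- 2).
have d2 : 0 < (d / 2) ^- 2 by rewrite invr_gt0 exprn_gt0// divr_gt0.
have w0 i : 0 < w 0 i by rewrite mxE.
have sub : [set x | ellipsoid_fun xi w x <= 0] `<=` ball xi d.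
  move=> x /= Ex; split => // i j; rewrite ord1 -ball_normE/= .
  have dd : 0 < d / 2 by exact: divr_gt0.
  have := ellipsoid_coord w0 j Ex; rewrite mxE mulrC ler_pdivrMr ?exprn_gt0// mul1r.
  move=> H; suff : `|xi 0 j - x 0 j| <= d / 2 by move=> h; apply: (le_lt_trans h); move: d0; lra.
  rewrite distrC -ler_sqr ?nnegrE ?(ltW dd)//.
  by rewrite real_normK ?num_real.
have Exi : ellipsoid_fun xi w xi < 0.
  by rewrite /ellipsoid_fun big1 => [|i _]; [lra|rewrite subrr expr0n mulr0].
have adm : admissible D xi [set x | ellipsoid_fun xi w x < 0].
  by apply: ellipsoid_admissible => // x /sub/Hd[].
set E := [set x | _] in adm.
have bE : bounded_set E by exact: ellipsoid_bounded.
have [mu hmu] := harmonic_measure_exists n0 (polyfun_ellipsoid xi w) bE Exi.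
have cK : compact (bdry E) by exact: (bdry_compact (polyfun_ellipsoid xi w) bE).
have mK := closed_borel (compact_closed_rV cK).
have muK : mu (bdry E) = 1%E.
  have := harmonic_measure_poly n0 (polyfun_ellipsoid xi w) bE Exi hmu (harmonic_poly_cst _ 1).
  by rewrite integral_cst// mul1e.
(* A lower bound for [|u|] on the boundary of the ball, truncated at 0 so that powers are monotone
   in it. *)
pose t := Num.max 0 (`|u xi| - e).
have t0 : 0 <= t by rewrite le_max lexx.
have tu : `|u xi| <= t + e by rewrite -lerBlDr le_max lexx orbT.
suff H : (t%:E <= hnorm D xi p u)%E.
  by apply: (@le_trans _ _ (t + e)%:E); rewrite ?lee_fin// EFinD leeD2r.
apply: (@le_trans _ _ ((\int[mu]_(x in (bdry E : set (borelRn R n))) (`|u x| `^ p)%:E) `^ p^-1)%E).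
  apply: root_le_poweR => //.
  have -> : ((t `^ p)%:E = \int[mu]_(x in (bdry E : set (borelRn R n))) (t `^ p)%:E)%E.
    by rewrite integral_cst// muK mule1.
  have EK x : bdry E x -> D x /\ `|u xi - u x| < e.
    by move=> /bdry_closure/(ellipsoid_closure (w := w))/sub/Hd.
  have wu : {within bdry E, continuous (fun x => `|u x|)}.
    apply: continuous_in_within => x /EK[Dx _].
    exact: (continuous_comp (cu x Dx) (@norm_continuous _ _ _)).
  apply: ge0_le_integral => //.
  - by move=> x _; rewrite lee_fin powR_ge0.
  - apply/measurable_EFinP; apply: (measurableT_comp (measurable_powR p)).
    by apply: within_continuous_measurable => //; exact: compact_closed_rV.
  - move=> x /EK[_ ux]; rewrite lee_fin ge0_ler_powR ?nnegrE ?(ltW p0)//.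
    rewrite ge_max normr_ge0/= lerBlDr -lerBlDl.
    by apply: le_trans (ltW ux); exact: lerB_dist.
by apply: ereal_sup_ubound; exists E, mu.
Unshelve. all: by end_near. Qed.

Lemma hweak_norm_le D xi v (p C : R) (N : \bar R) :
  (forall (lam : R) E (mu : {measure set (borelRn R n) -> \bar R}),
    0 < lam -> admissible D xi E -> harmonic_measure E xi mu ->
    (((lam `^ p)%:E * mu (superlevel E v lam)) `^ p^-1 <= N)%E) ->
  (hweak_norm D xi p v <= N)%E.
Proof.
by move=> H; apply: ub_ereal_sup => _ [lam [E [mu [l0 adm hmu ->]]]]; exact: H.
Qed.

Section upper_bounds.
Variables (D : set 'rV[R]_n) (xi : 'rV[R]_n) (u v : 'rV[R]_n -> R).
Hypotheses (dD : domain D) (Dxi : D xi).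
Hypotheses (hu : harmonic_on D u) (hv : harmonic_on D v).
Hypothesis u_ge0 : forall x, D x -> 0 <= u x.
Hypothesis uv : diff_subordinate D xi u v.

Let oD : open D := proj1 dD.

Let harmonic_cont f x : harmonic_on D f -> D x -> {for x, continuous f}.
Proof. by move=> [[df _ _] _] Dx; apply: differentiable_continuous; exact: df. Qed.

Let affine_cont f x (k e : R) : harmonic_on D f -> D x ->
  {for x, continuous (fun y => k * f y + e)}.
Proof.
move=> hf Dx; have ccst (c : R) : {for x, continuous (fun _ : 'rV[R]_n => c)}.
  exact: cst_continuous.
exact: (cvgD (cvgM (ccst k) (harmonic_cont hf Dx)) (ccst e)).
Qed.

Let scale_cont f x (k : R) : harmonic_on D f -> D x ->
  {for x, continuous (fun y => k * f y)}.
Proof.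
move=> hf Dx; have ccst (c : R) : {for x, continuous (fun _ : 'rV[R]_n => c)}.
  exact: cst_continuous.
exact: (cvgM (ccst k) (harmonic_cont hf Dx)).
Qed.

Let vu : `|v xi| <= u xi.
Proof. by have [] := uv; rewrite (ger0_norm (u_ge0 Dxi)). Qed.

Let superlevel_scale E (lam : R) : 0 < lam ->
  superlevel E v lam = superlevel E (fun x => lam^-1 * v x) 1.
Proof.
move=> l0; apply/seteqP; split => x [Kx] /= H; split => //=; move: H;
  by rewrite normrM gtr0_norm ?invr_gt0// mulrC ler_pdivlMr// mul1r.
Qed.

Lemma hweak_norm_le_small (p : R) : 0 < p < 1 ->
  (hweak_norm D xi p v <= 2%:E * hnorm D xi p u)%E.
Proof.
move=> /andP[p0 p1].
have u0 : 0 <= u xi by exact: u_ge0.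
apply: (@le_trans _ _ (2 * u xi)%:E); last first.
  rewrite EFinM lee_wpmul2l//.
  rewrite -{1}(ger0_norm u0).
  apply: le_hnorm_point => //; first exact: harmonic_cont.
  by move=> x Dx; exact: harmonic_cont.
apply: hweak_norm_le => // lam E mu l0 [[oE cE] bE Exi clE] hmu.
have le1 := harmonic_measure_le1 n0 oE bE Exi hmu.
have leu : (mu (superlevel E v lam) <= (2 * (lam^-1 * u xi))%:E)%E.
  rewrite superlevel_scale//.
  have H := @weak_type1 R n n0 E xi oE bE Exi mu hmu (fun y => lam^-1 * u y + 0)
    (fun y => lam^-1 * v y).
  rewrite addr0 in H; apply: H.
  - by move=> x /clE; exact: affine_cont.
  - by move=> x /clE; exact: scale_cont.
  - move=> x /subset_closure/clE Dx; apply: subordinate_at_affine.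
    exact: diff_subordinate_at oD hu hv uv Dx.
  - by move=> x /clE/u_ge0 ux; rewrite addr0 mulr_ge0// invr_ge0 ltW.
  - by rewrite normrM gtr0_norm ?invr_gt0// ler_wpM2l// invr_ge0 ltW.
pose t := 2 * (lam^-1 * u xi).
have t0 : 0 <= t by rewrite !mulr_ge0// invr_ge0 ltW.
have mut : (mu (superlevel E v lam) <= (t `^ p)%:E)%E.
  have [t1|t1] := leP t 1.
    apply: (le_trans leu); rewrite lee_fin -/t.
    move: t0; rewrite le_eqVlt => /predU1P[<-|tp]; first exact: powR_ge0.
    by apply: ger1_powR; rewrite ?tp ?t1// ltW.
  apply: (@le_trans _ _ 1%E).
    apply: le_trans le1; apply: le_measure; rewrite ?inE.
    - apply: (superlevel_measurable (E := E)) => //.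
      apply: closure_within => x /clE; exact: harmonic_cont.
    - exact: closed_borel (compact_closed_rV (bdry_compact_bounded oE bE)).
    - by move=> x [].
  have : 1 `^ p <= t `^ p by rewrite ge0_ler_powR ?nnegrE ?(ltW p0) ?(ltW t1).
  by rewrite powR1 lee_fin.
have -> : 2 * u xi = lam * t by rewrite /t mulrCA mulVKf ?gt_eqF.
apply: poweR_le_root => //.
- by rewrite mulr_ge0// ltW.
- by rewrite mule_ge0// lee_fin powR_ge0.
- by rewrite powRM ?(ltW l0)// EFinM lee_wpmul2l// lee_fin powR_ge0.
Qed.

(** [weak_typep] needs a strictly positive function, so it is applied to [(u + e) / lam] and
    [v / lam]; then [e] tends to 0 in the integral. *)
Lemma hweak_norm_le_large (p : R) : 2 <= p ->
  (hweak_norm D xi p v <=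
    (p / 2 * (p - 1) `^ (- p^-1))%:E * hnorm D xi p u)%E.
Proof.
move=> p2; have p0 : 0 < p by lra. have p10 : 0 < p - 1 by lra.
apply: hweak_norm_le => // lam E mu l0 adm hmu.
have [[oE cE] bE Exi clE] := adm.
set K := bdry E.
have cK : compact K by exact: bdry_compact_bounded.
have mK := closed_borel (compact_closed_rV cK).
have le1 := harmonic_measure_le1 n0 oE bE Exi hmu.
have muK : (mu K < +oo)%E by exact: le_lt_trans le1 (ltry 1).
have cu x : closure E x -> {for x, continuous u}.
  by move=> /clE; exact: harmonic_cont.
pose k := (p / 2) `^ p / (p - 1).
have k0 : 0 <= k by rewrite divr_ge0 ?powR_ge0// ltW.
have cpow (e : R) : 0 < e -> {within K, continuous (fun x => (u x + e) `^ p)}.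
  move=> e0; apply: continuous_in_within => x /bdry_closure/clE Dx.
  have ccst : {for x, continuous (fun _ : 'rV[R]_n => e)} by exact: cst_continuous.
  have ue : 0 < u x + e by rewrite ltr_wpDl// u_ge0.
  exact: (continuous_comp (cvgD (harmonic_cont hu Dx) ccst) (@continuous_powR _ p _ ue)).
have step (e : R) : 0 < e -> ((lam `^ p)%:E * mu (superlevel E v lam) <=
    k%:E * \int[mu]_(x in (K : set (borelRn R n))) ((u x + e) `^ p)%:E)%E.
  move=> e0; rewrite superlevel_scale//.
  have lp0 : 0 < lam^-1 by rewrite invr_gt0.
  have H := @weak_typep R n n0 E xi oE bE Exi mu hmu
    (fun y => lam^-1 * u y + lam^-1 * e) (fun y => lam^-1 * v y) p p2.
  have ue x : closure E x -> 0 < u x + e by move=> /clE Dx; rewrite ltr_wpDl// u_ge0.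
  have {H} := H _ _ _ _ _; rewrite -/k -/K.
  have -> : (\int[mu]_(x in (K : set (borelRn R n))) ((lam^-1 * u x + lam^-1 * e) `^ p)%:E =
      (lam^-1 `^ p)%:E * \int[mu]_(x in (K : set (borelRn R n))) ((u x + e) `^ p)%:E)%E.
    rewrite -ge0_integralZl_EFin ?powR_ge0//.
    - apply: eq_integral => x /set_mem/bdry_closure clx.
      by rewrite -mulrDr powRM ?EFinM ?ltW// ue.
    - by move=> x _; rewrite lee_fin powR_ge0.
    - apply/measurable_EFinP; apply: within_continuous_measurable; last exact: cpow.
      exact: compact_closed_rV.
  move=> H; have lamp : (lam `^ p)%:E != 0%E :> \bar R.
    by rewrite eqe gt_eqF// powR_gt0.
  apply: (@le_trans _ _ ((lam `^ p)%:E * (k%:E * ((lam^-1 `^ p)%:E *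
      \int[mu]_(x in (K : set (borelRn R n))) ((u x + e) `^ p)%:E)))%E).
    rewrite lee_wpmul2l ?lee_fin ?powR_ge0//; apply: H.
    - by move=> x /clE; exact: affine_cont.
    - by move=> x /clE; exact: scale_cont.
    - move=> x /subset_closure/clE Dx; apply: subordinate_at_affine.
      exact: diff_subordinate_at oD hu hv uv Dx.
    - by move=> x clx; rewrite -mulrDr mulr_gt0// ue.
    - rewrite normrM gtr0_norm// -mulrDr ler_wpM2l ?(ltW lp0)//.
      by rewrite (le_trans vu)// lerDl ltW.
  rewrite muleCA [X in (_ * X)%E]muleA -EFinM -powRM ?(ltW l0) ?(ltW lp0)//.
  by rewrite divff ?gt_eqF// powR1 mul1e.
have wu : {within K, continuous u} by exact: closure_within.
have Ku x : K x -> 0 <= u x by move=> /bdry_closure/clE; exact: u_ge0.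
pose I := (\int[mu]_(x in (K : set (borelRn R n))) (`|u x| `^ p)%:E)%E.
have I0 : (0 <= I)%E by apply: integral_ge0 => x _; rewrite lee_fin powR_ge0.
have lim : ((lam `^ p)%:E * mu (superlevel E v lam) <= k%:E * I)%E.
  have [M _ Mu] := within_continuous_bounded cK wu.
  pose M' := Num.max M 0.
  (* A bound for the derivative of the [p]-th power on [[0, M' + 1]], where [u + e] takes its values
     for [e <= 1]. It makes the passage to the limit quantitative. *)
  pose c := p * (M' + 1) `^ (p - 1).
  have c0 : 0 <= c by rewrite mulr_ge0 ?powR_ge0// ltW.
  have Ie (e : R) : 0 < e -> e <= 1 ->
      (\int[mu]_(x in (K : set (borelRn R n))) ((u x + e) `^ p)%:E <= I + (c * e)%:E)%E.
    move=> e0 e1.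
    have mup : measurable_fun (K : set (borelRn R n)) (fun x => (`|u x| `^ p)%:E).
      apply/measurable_EFinP; apply: (measurableT_comp (measurable_powR p)).
      apply: (measurableT_comp (@normr_measurable R setT)).
      by apply: within_continuous_measurable => //; exact: compact_closed_rV.
    apply: (@le_trans _ _ (I + (c * e)%:E * mu K)%E); last first.
      apply: leeD2l; rewrite -[leRHS]mule1; apply: lee_wpmul2l le1.
      by rewrite lee_fin mulr_ge0// ltW.
    have -> : ((c * e)%:E * mu K = \int[mu]_(x in (K : set (borelRn R n))) (c * e)%:E)%E.
      by rewrite integral_cst.
    have ce : (0 <= (c * e)%:E)%E by rewrite lee_fin mulr_ge0// ltW.
    rewrite -ge0_integralD//.
    apply: ge0_le_integral => //.
    - by move=> x _; rewrite lee_fin powR_ge0.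
    - apply/measurable_EFinP; apply: within_continuous_measurable; last exact: cpow.
      exact: compact_closed_rV.
    - exact: emeasurable_funD.
    - move=> x Kx; rewrite -EFinD lee_fin ger0_norm ?Ku//.
      have := Ku x Kx; set a := u x => a0.
      have ae : 0 < a + e by rewrite ltr_wpDl.
      have pe : 0 < (a + e) `^ p by rewrite powR_gt0.
      have aM : a + e <= M' + 1.
        by rewrite lerD// le_max (le_trans (ler_norm _) (Mu x Kx)).
      (* Multiplied by [(a + e)]^
         p[, Bernoulli's inequality says that the]p[-th power lies above its tangent at]a +
         e[, hence grows by at most]p * e * (a + e) [^ (p - 1)] from [a] to [a + e]. *)
      have := @bernoulli_powR R (a / (a + e)) p; rewrite divr_ge0 ?(ltW ae)//.
      move=> /(_ isT); have -> : 1 < p by lra.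
      move=> /(_ isT) B; rewrite -(ler_pM2l pe) -powRM ?divr_ge0 ?(ltW ae)// in B.
      move: B.
      rewrite [(a + e) * (a / _)]mulrC divfK ?gt_eqF//.
      have -> : (a + e) `^ p * (1 + p * (a / (a + e) - 1)) =
          (a + e) `^ p - p * e * ((a + e) `^ p / (a + e)) by field; rewrite gt_eqF.
      have -> : (a + e) `^ p / (a + e) = (a + e) `^ (p - 1).
        by rewrite powR_mul// powRN powRr1// ltW.
      rewrite lerBlDr => h; apply: (le_trans h); rewrite lerD2l /c mulrAC ler_wpM2r ?(ltW e0)//.
      rewrite ler_wpM2l ?(ltW p0)// ge0_ler_powR ?nnegrE ?(ltW ae) ?(ltW p10)//.
      exact: le_trans (ltW ae) _.
  apply/lee_addgt0Pr => d d0.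
  pose e := Num.min 1 (d / (k * c + 1)).
  have kc : 0 < k * c + 1 by rewrite ltr_wpDl// mulr_ge0.
  have e0 : 0 < e by rewrite lt_min ltr01 divr_gt0.
  apply: (le_trans (step e e0)).
  apply: (@le_trans _ _ (k%:E * (I + (c * e)%:E))%E).
    by rewrite lee_wpmul2l// Ie// ge_min lexx.
  have ce : (0 <= (c * e)%:E)%E by rewrite lee_fin mulr_ge0// ltW.
  rewrite (ge0_muleDr _ I0 ce); apply: leeD2l; rewrite -EFinM lee_fin mulrA.
  have : e <= d / (k * c + 1) by rewrite ge_min lexx orbT.
  by rewrite ler_pdivlMr// mulrDr mulr1 => h; rewrite mulrC; apply: le_trans h; rewrite lerDl ltW.
apply: (@le_trans _ _ ((k%:E * I) `^ p^-1)%E).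
  have m0 : (0 <= (lam `^ p)%:E * mu (superlevel E v lam))%E.
    by rewrite mule_ge0// lee_fin powR_ge0.
  apply: gt0_ler_poweR lim; first by rewrite invr_ge0 ltW.
    by rewrite in_itv/= m0 leey.
  by rewrite in_itv/= leey mule_ge0.
rewrite poweRM ?lee_fin// poweR_EFin.
have -> : k `^ p^-1 = p / 2 * (p - 1) `^ (- p^-1).
  rewrite /k powRM ?powR_ge0 ?invr_ge0 ?(ltW p10)// powRVK//; last by rewrite divr_ge0// ltW.
  by rewrite -(powR_inv1 (ltW p10)) -powRrM mulN1r.
apply: lee_wpmul2l; first by rewrite lee_fin mulr_ge0 ?powR_ge0// divr_ge0// ltW.
by apply: ereal_sup_ubound; exists E, mu.
Qed.

End upper_bounds.
End norms.

(** * Sharpness of the constant 2 *)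

Section sharpness.
Context {R : realType} {n : nat}.
Hypothesis n0 : (0 < n)%N.
Implicit Types (x : 'rV[R]_n) (E : set 'rV[R]_n).

Lemma jet2_partial (f : 'rV[R]_n -> R) x a l i : jet2 f x a l -> partial i f x = a i.
Proof. by move=> [b /(_ i)[_ H _] _]; exact: derive_val. Qed.

Lemma jet2_laplacian (f : 'rV[R]_n -> R) x a l : jet2 f x a l -> laplacian f x = l.
Proof.
by move=> [b H ->]; apply: eq_bigr => i _; have [_ _ ?] := H i; exact: derive_val.
Qed.

Let i0 : 'I_n := Ordinal n0.

Let harmonic_coord E : harmonic_poly E (fun x => x 0 i0).
Proof.
split; first by exists 2%N; exact: polyfun_coord.
by move=> x _; exact: jet2_laplacian (jet2_coord i0 x).
Qed.

Let harmonic_quadratic E :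
  harmonic_poly E (fun x => \sum_i x 0 i ^+ 2 + - n%:R * x 0 i0 ^+ 2).
Proof.
have sq i : polyfun 3 (fun x : 'rV[R]_n => x 0 i ^+ 2).
  by apply: polyfun_ext (polyfunM (polyfun_coord i) (polyfun_coord i)) => x; rewrite expr2.
split; first by exists 3%N; apply: polyfunD; [exact: polyfun_sum|exact: polyfunZ].
move=> x _.
rewrite (_ : (fun x => _) = fun x : 'rV[R]_n => \sum_i (x 0 i - (0 : 'rV[R]_n) 0 i) ^+ 2 +
    - n%:R * x 0 i0 ^+ 2); last first.
  by apply/funext => y; congr (_ + _); apply: eq_bigr => i _; rewrite mxE subr0.
rewrite (jet2_laplacian (jet2D (jet2_dist2 0 x)
  (jet2Z (- n%:R) (jet2_sqr (jet2_coord i0 x))))).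
rewrite mulr0 add0r (bigD1 i0)//= big1 => [|i /negbTE ->]; last by rewrite expr0n.
by rewrite ?eqxx ?expr1n; ring.
Qed.

Let D : set 'rV[R]_n := [set x | -1 < x 0 i0].
Let u x : R := 1 + x 0 i0.
Let v x : R := 1 + -1 * x 0 i0.

Let hu E : harmonic_poly E u.
Proof. by apply: harmonic_polyD; [exact: harmonic_poly_cst|exact: harmonic_coord]. Qed.

Let hv E : harmonic_poly E v.
Proof.
by apply: harmonic_polyD; [exact: harmonic_poly_cst|exact/harmonic_polyZ/harmonic_coord].
Qed.

Let poly_cont E f x : harmonic_poly E f -> {for x, continuous f}.
Proof. by move=> [[k pf] _]; exact: polyfun_continuous pf _. Qed.

Let dD : domain D.
Proof.
split.
  rewrite (_ : D = [set x | -1 * u x < 0]); last first.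
    by apply/seteqP; split => x; rewrite /D/= /u; lra.
  apply: sublevel_open => x; exact: poly_cont (harmonic_polyZ (-1) (hu setT)).
apply: convex_connected => x y t; rewrite /D/= !mxE => x1 y1 /andP[t0 t1].
have [->|tn0] := eqVneq t 0; first by rewrite mul0r add0r.
have tp : 0 < t by rewrite lt_neqAle eq_sym tn0.
nra.
Qed.

Let D0 : D 0.
Proof. by rewrite /D/= mxE; lra. Qed.

Let u0 x : D x -> 0 <= u x.
Proof. by rewrite /D/= /u; lra. Qed.

Let uv : diff_subordinate D 0 u v.
Proof.
split => [|x _]; first by rewrite /u /v mxE mulr0.
rewrite /grad_norm ler_wsqrtr//; apply: ler_sum => i _.
rewrite (jet2_partial i (jet2D (jet2_cst 1 x) (jet2_coord i0 x))).
rewrite (jet2_partial i (jet2D (jet2_cst 1 x) (jet2Z (-1) (jet2_coord i0 x)))).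
by rewrite !add0r mulN1r sqrrN.
Qed.

Let hnorm_le1 (p : R) : 0 < p < 1 -> (hnorm D 0 p u <= 1)%E.
Proof.
move=> /andP[p0 p1]; apply: ub_ereal_sup => _ [E [mu [adm hmu ->]]].
have [[oE cE] bE E0 clE] := adm.
have mK := closed_borel (compact_closed_rV (bdry_compact_bounded oE bE)).
have Ku x : bdry E x -> 0 <= u x by move=> /bdry_closure/clE; exact: u0.
apply: poweR_le_root => //.
  by apply: integral_ge0 => x _; rewrite lee_fin powR_ge0.
rewrite powR1.
pose s x : R := 1 + p * x 0 i0.
have hs : harmonic_poly E s.
  by apply: harmonic_polyD; [exact: harmonic_poly_cst|exact/harmonic_polyZ/harmonic_coord].
have ms f : harmonic_poly E f ->
    measurable_fun (bdry E : set (borelRn R n)) f.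
  move=> hf; apply: within_continuous_measurable.
    exact: compact_closed_rV (bdry_compact_bounded oE bE).
  by apply: closure_within => x _; exact: poly_cont hf.
have : (\int[mu]_(x in (bdry E : set (borelRn R n))) (s x)%:E <= (s 0)%:E)%E.
  apply: (@harmonic_measure_touched R n n0 E 0 bE E0 mu hmu s) => x Ex.
    exact: poly_cont hs.
  apply: (touched_above_jet (jet2D (jet2_cst 1 x) (jet2Z p (jet2_coord i0 x)))).
  by rewrite mulr0 addr0.
rewrite {2}/s mxE mulr0 addr0; apply: le_trans.
apply: ge0_le_integral => //.
- apply/measurable_EFinP; apply: (measurableT_comp (measurable_powR p)).
  apply: (measurableT_comp (@normr_measurable R setT)); exact: ms (hu E).
- by apply/measurable_EFinP; exact: ms hs.
- move=> x Kx; rewrite lee_fin ger0_norm ?Ku//.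
  have := @concave_powR R (u x) p (Ku x Kx); rewrite p0 p1 => /(_ isT).
  by rewrite {2}/u [1 + _ - 1]addrAC subrr add0r.
Qed.

(** The complement is estimated: the total mass is 1, and Markov's inequality for a nonnegative
    harmonic function bounds the mass away from the cap by its value at the origin. *)
Let weak_large (lam m : R) : 1 < lam < 2 -> 0 < m < 1 ->
  exists E (mu : {measure set (borelRn R n) -> \bar R}),
    [/\ admissible D 0 E, harmonic_measure E 0 mu & (m%:E <= mu (superlevel E v lam))%E].
Proof.
move=> /andP[l1 l2] /andP[m0 m1].
(* With [s = x 0 i0 + th] the ellipsoid occupies [0 <= s <= 2 * A]; it stays inside the half-space
   because [th < 1]. The condition [v >= lam] reads [s <= eps], which defines the cap. The size of
   [A] makes [th / A] at most [(1 - m) / 2]. *)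
have [th thE] : exists th, th = lam / 2 by eexists.
have [eps epsE] : exists eps, eps = 1 - lam / 2 by eexists.
have e0 : 0 < eps by lra.
have [A AE] : exists A : R, A = 2 / (1 - m) by eexists.
have A1 : 1 <= A by rewrite AE ler_pdivlMr; lra.
have A0 : 0 < A by lra.
have nR : 0 < n%:R :> R by rewrite ltr0n.
(* With [k = A * om / eps] below, this makes [k * (4 * n * A^2)], the second part of [H 0], exactly
   [(1 - m) / 2]. *)
have [om omE] : exists om, om = eps * (1 - m) / (8 * n%:R * A ^+ 3) by eexists.
have m1' : 0 < 1 - m by lra.
have om0 : 0 < om by rewrite omE divr_gt0 ?mulr_gt0 ?exprn_gt0.
pose c : 'rV[R]_n := \row_i if i == i0 then A - th else 0.
pose w : 'rV[R]_n := \row_i if i == i0 then A ^- 2 else om.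
have w0 i : 0 < w 0 i by rewrite mxE; case: ifP => // _; rewrite invr_gt0 exprn_gt0.
pose S x : R := \sum_(i | i != i0) x 0 i ^+ 2.
have S0 x : 0 <= S x by apply: sumr_ge0 => i _; exact: sqr_ge0.
have rhoE x : ellipsoid_fun c w x = A ^- 2 * (x 0 i0 + th - A) ^+ 2 + om * S x - 1.
  rewrite /ellipsoid_fun (bigD1 i0)//= !mxE eqxx opprB addrA; congr (_ + _ + _).
  rewrite /S mulr_sumr; apply: eq_bigr => i /negbTE ni.
  by rewrite !mxE ni subr0.
have rho0 : ellipsoid_fun c w 0 < 0.
  rewrite rhoE mxE add0r /S big1 => [|i _]; last by rewrite mxE expr0n.
  rewrite mulr0 addr0 subr_lt0 mulrC ltr_pdivrMr ?exprn_gt0// mul1r.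
  by move: A1; rewrite thE; nra.
have s_range x : ellipsoid_fun c w x <= 0 -> 0 <= x 0 i0 + th <= 2 * A.
  rewrite rhoE; set s := x 0 i0 + th => H.
  have : A ^- 2 * (s - A) ^+ 2 <= 1 by have := mulr_ge0 (ltW om0) (S0 x); lra.
  rewrite mulrC ler_pdivrMr ?exprn_gt0// mul1r => h.
  by apply/andP; split; nra.
have adm : admissible D 0 [set x | ellipsoid_fun c w x < 0].
  apply: ellipsoid_admissible => // x /= /s_range/andP[h _].
  by rewrite /D/=; move: h; rewrite thE; lra.
set E := [set x | _] in adm.
have [[oE cE] bE E0 clE] := adm.
have [mu hmu] := harmonic_measure_exists n0 (polyfun_ellipsoid c w) bE E0.
exists E, mu; split => //.
have ipoly := harmonic_measure_poly n0 (polyfun_ellipsoid c w) bE E0 hmu.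
have [k kE] : exists k, k = A * om / eps by eexists.
have k0 : 0 < k by rewrite kE divr_gt0// mulr_gt0.
(* [E] is long in the direction [i0] and stretched so far in the others that the
   path from [0] leaves it near the cap [x 0 i0 = - th] with probability close to
   [1]: [H] is a small positive harmonic function exceeding [1] off the cap. *)
pose Q x : R := \sum_i x 0 i ^+ 2 + - n%:R * x 0 i0 ^+ 2.
pose H x : R := A^-1 * (th + x 0 i0) + k * (4 * n%:R * A ^+ 2 + Q x).
have hH : harmonic_poly E H.
  apply: harmonic_polyD; apply: harmonic_polyZ; apply: harmonic_polyD => //;
    exact: harmonic_poly_cst.
have H0E : H 0 <= 1 - m.
  have -> : H 0 = th / A + (1 - m) / 2.
    rewrite /H /Q mxE addr0 expr0n/= mulr0 addr0 big1 => [|i _]; last by rewrite mxE expr0n.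
    rewrite addr0 kE omE mulrC; congr (_ + _).
    field; rewrite !gt_eqF//.
  have : th / A = th * (1 - m) / 2 by rewrite AE; field; lra.
  by move=> ->; rewrite thE; nra.
(* The summand [4 * n * A^2] in [H] compensates the negative part [(n - 1) * x 0 i0 ^+ 2] of [Q],
   since [|x 0 i0| <= 2 * A] on the ellipsoid. *)
have HS x : bdry E x -> A^-1 * (th + x 0 i0) + k * S x <= H x.
  move=> /bdry_closure/(ellipsoid_closure (w := w))/s_range/andP[s1 s2].
  rewrite /H lerD2l ler_wpM2l ?(ltW k0)// /Q (bigD1 i0)//= -/(S x).
  have : x 0 i0 ^+ 2 <= 4 * A ^+ 2 by move: s1 s2 A1; rewrite thE; nra.
  have := sqr_ge0 (x 0 i0); nra.
have bdryE x : bdry E x -> A ^+ 2 * om * S x = (x 0 i0 + th) * (2 * A - (x 0 i0 + th)).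
  move=> Kx; have : ellipsoid_fun c w x = 0.
    exact: (sublevel_bdry (polyfun_continuous (polyfun_ellipsoid c w))) Kx.
  rewrite rhoE => Z.
  have {Z} : A ^+ 2 * (A ^- 2 * (x 0 i0 + th - A) ^+ 2 + om * S x - 1) = 0 by rewrite Z mulr0.
  rewrite !mulrDr mulVKf ?gt_eqF ?exprn_gt0// => Z.
  by rewrite -mulrA; move: Z; lra.
have cH : {within bdry E, continuous H} by apply: closure_within => x _; exact: poly_cont hH.
have cv : {within bdry E, continuous v}.
  by apply: closure_within => x _; exact: poly_cont (hv E).
have mK := closed_borel (compact_closed_rV (bdry_compact_bounded oE bE)).
have mB := superlevel_measurable oE bE lam cv.
have mH := superlevel_measurable oE bE 1 cH.
have H_ge0 x : bdry E x -> 0 <= H x.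
  move=> Kx; apply: le_trans (HS x Kx).
  move: Kx => /bdry_closure/(ellipsoid_closure (w := w))/s_range/andP[s1 s2].
  by rewrite addr_ge0// mulr_ge0// ?invr_ge0 ?(ltW A0) ?(ltW k0)// addrC.
have muH : (mu (superlevel E H 1) <= (1 - m)%:E)%E.
  apply: (@le_trans _ _ (H 0)%:E); last by rewrite lee_fin.
  rewrite -(ipoly _ hH); apply: superlevel_le => // x Kx.
  by rewrite ger0_norm// H_ge0.
have cover : bdry E `<=` superlevel E v lam `|` superlevel E H 1.
  move=> x Kx; have [xl|xl] := leP (x 0 i0) (1 - lam); [left|right]; split => //.
    by rewrite /v ger0_norm; lra.
  rewrite (ger0_norm (H_ge0 x Kx)); apply: (le_trans _ (HS x Kx)).
  have SE := bdryE x Kx; move: Kx => /bdry_closure/(ellipsoid_closure (w := w))/s_range/andP[].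
  rewrite [th + _]addrC; move: xl SE; set s := x 0 i0 + th => xl SE s1 s2.
  have es : eps < s by rewrite /s epsE thE; move: xl; lra.
  have -> : A^-1 * s + k * S x = s / A + s / eps * ((2 * A - s) / A).
    have -> : s / eps * ((2 * A - s) / A) = A ^+ 2 * om * S x / (eps * A).
      by rewrite SE; field; rewrite !gt_eqF.
    by rewrite kE; field; rewrite !gt_eqF.
  (* The equation of the boundary has turned [k * S x] into [(s / eps) * ((2 * A - s) / A)]: up to
     the middle of the ellipsoid both factors are at least 1, and beyond it [s / A] alone is. *)
  have [sA|sA] := leP s A.
    have h1 : 1 <= s / eps by rewrite ler_pdivlMr// mul1r ltW.
    have h2 : 1 <= (2 * A - s) / A by rewrite ler_pdivlMr//; lra.
    have h3 : 0 <= s / A by rewrite divr_ge0// ltW.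
    by nra.
  have h1 : 1 <= s / A by rewrite ler_pdivlMr// mul1r ltW.
  rewrite ler_wpDr// !mulr_ge0 ?invr_ge0 ?(ltW e0) ?(ltW A0)//; lra.
have muK : mu (bdry E) = 1%E.
  by have := ipoly _ (harmonic_poly_cst E 1); rewrite integral_cst// mul1e.
have : (1 <= mu (superlevel E v lam) + (1 - m)%:E)%E.
  have : (mu (bdry E) <= mu (superlevel E v lam `|` superlevel E H 1))%E.
    by apply: le_measure; rewrite ?inE//; exact: measurableU.
  rewrite muK => /le_trans; apply; apply: (le_trans (measureU2 mu mB mH)).
  exact: leeD2l.
case: (mu (superlevel E v lam)) => [r|_|].
- by rewrite -EFinD !lee_fin; lra.
- exact: leey.
- by [].
Qed.

Lemma weak_constant_sharp (p : R) : 0 < p < 1 -> forall c : R, c < 2 ->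
  exists (D : set 'rV[R]_n) (xi : 'rV[R]_n) (u v : 'rV[R]_n -> R),
    [/\ domain D /\ D xi, harmonic_on D u /\ harmonic_on D v,
        (forall x, D x -> 0 <= u x), diff_subordinate D xi u v &
        (c%:E * hnorm D xi p u < hweak_norm D xi p v)%E].
Proof.
move=> p01 c c2; have /andP[p0 p1] := p01.
exists D, 0, u, v; split => //.
  by split; exact: harmonic_poly_on.
pose c1 := Num.max c 1.
have c12 : c1 < 2 by rewrite gt_max c2; lra.
have c11 : 1 <= c1 by rewrite le_max lexx orbT.
pose t := c1 + (2 - c1) / 3; pose lam := c1 + 2 * (2 - c1) / 3.
have tl : t < lam by rewrite /t /lam; lra.
have t0 : 0 < t by rewrite /t; lra.
have l0 : 0 < lam by lra.
have [||E [mu [adm hmu Hm]]] := @weak_large lam ((t / lam) `^ p).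
- by rewrite /lam; lra.
- rewrite powR_gt0 ?divr_gt0//=.
  have : (t / lam) `^ p < 1 `^ p.
    by rewrite gt0_ltr_powR ?nnegrE// ?divr_ge0 ?(ltW t0) ?(ltW l0)// ltr_pdivrMr// mul1r.
  by rewrite powR1.
(* A supremum over an empty family would be [-oo]; the small balls around the origin exclude
   this. *)
have h0 : (0 <= hnorm D 0 p u)%E.
  have ccu x : {for x, continuous u} by exact: poly_cont (hu setT).
  apply: le_trans (le_hnorm_point n0 p0 (proj1 dD) D0 (ccu 0) (fun x _ => ccu x)).
  by rewrite lee_fin.
apply: (@le_lt_trans _ _ c1%:E).
  apply: (@le_trans _ _ (c1%:E * hnorm D 0 p u)%E).
    by apply: lee_wpmul2r => //; rewrite lee_fin le_max lexx.
  rewrite -[leRHS]mule1; apply: lee_wpmul2l (hnorm_le1 p01).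
  by rewrite lee_fin; lra.
apply: (@lt_le_trans _ _ t%:E); first by rewrite lte_fin /t; lra.
apply: (@le_trans _ _ (((lam `^ p)%:E * mu (superlevel E v lam)) `^ p^-1)%E).
  apply: root_le_poweR => //; first exact: ltW.
  have -> : t `^ p = lam `^ p * (t / lam) `^ p.
    by rewrite -powRM ?(ltW l0) ?divr_ge0 ?(ltW t0) ?(ltW l0)// mulrC divfK ?gt_eqF.
  by rewrite EFinM lee_wpmul2l// lee_fin powR_ge0.
by apply: ereal_sup_ubound; exists lam, E, mu.
Qed.

End sharpness.

Theorem theorem8p1 (R : realType) (n : nat) : (1 <= n)%N ->
  (forall (D : set 'rV[R]_n) (xi : 'rV[R]_n) (u v : 'rV[R]_n -> R),
     domain D -> D xi -> harmonic_on D u -> harmonic_on D v ->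
     (forall x, D x -> 0 <= u x) -> diff_subordinate D xi u v ->
     (forall p : R, 0 < p < 1 ->
        (hweak_norm D xi p v <= 2%:E * hnorm D xi p u)%E) /\
     (forall p : R, 2 <= p ->
        (hweak_norm D xi p v
           <= (p / 2 * (p - 1) `^ (- p^-1))%:E * hnorm D xi p u)%E)) /\
  (forall p : R, 0 < p < 1 -> forall c : R, c < 2 ->
     exists (D : set 'rV[R]_n) (xi : 'rV[R]_n) (u v : 'rV[R]_n -> R),
       [/\ domain D /\ D xi, harmonic_on D u /\ harmonic_on D v,
           (forall x, D x -> 0 <= u x), diff_subordinate D xi u v &
           (c%:E * hnorm D xi p u < hweak_norm D xi p v)%E]).
Proof.
move=> n0; split; last exact: weak_constant_sharp.
move=> D xi u v dD Dxi hu hv u0 uv; split => p hp.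
  exact: (hweak_norm_le_small n0 dD).
exact: (hweak_norm_le_large n0 dD).
Qed.
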